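(* For every $i\in\mathbb{S}$, the space $\mathrm{BMOSH}(\mathbb{D})$ equipped with $$\|f\|_{\mathrm{BMOSH}(\mathbb{D}_i)} = |f(0)| + |f|_{\mathrm{BMOSH}(\mathbb{D}_i)}$$ is a quaternionic right Banach space. Similarly, $\mathrm{BMOSH}(\mathbb{D})$ is a quaternionic right Banach space when equipped with $$\|f\|_{\mathrm{BMOSH}(\mathbb{D})} = |f(0)| + |f|_{\mathrm{BMOSH}(\mathbb{D})}.$$ Moreover, these norms are equivalent.
   Context: Let $\mathbb{H}$ be the quaternions, $\mathbb{S}=\{x\in\mathbb{H}:\mathrm{Re}(x)=0,|x|=1\}$, $\mathbb{C}_i=\{x_0+ix_1:x_0,x_1\in\mathbb{R}\}$ for $i\in\mathbb{S}$, $\mathbb{D}$ the open unit ball of $\mathbb{H}$, $\mathbb{D}_i=\mathbb{D}\cap\mathbb{C}_i$. Every $x\in\mathbb{H}$ is written $x=x_0+i_xx_1$ with $x_0=\mathrm{Re}(x)$, $x_1=|\mathrm{Im}(x)|\ge 0$, $i_x\in\mathbb{S}$. A real differentiable $f:\mathbb{D}\to\mathbb{H}$ is (left) slice hyperholomorphic, $f\in\mathcal{SH}_L(\mathbb{D})$, if $f(x)=\alpha(x_0,x_1)+i_x\beta(x_0,x_1)$ for all $x\in\mathbb{D}$, where the $\mathbb{H}$-valued functions $\alpha,\beta$ satisfy $\alpha(x_0,-x_1)=\alpha(x_0,x_1)$, $\beta(x_0,-x_1)=-\beta(x_0,x_1)$, $\partial_{x_0}\alpha=\partial_{x_1}\beta$,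 $\partial_{x_0}\beta=-\partial_{x_1}\alpha$. For $0<p<\infty$, $\mathcal{H}^p(\mathbb{D})$ is the set of $f\in\mathcal{SH}_L(\mathbb{D})$ with $\|f\|_{\mathcal{H}^p(\mathbb{D})}=\sup_{i\in\mathbb{S}}\lim_{r\nearrow1}\left(\frac1{2\pi}\int_0^{2\pi}|f(re^{i\theta})|^p\,d\theta\right)^{1/p}<\infty$; boundary values $f(e^{i\theta})$ are radial limits (existing for almost every $\theta$). For $f\in\mathcal{H}^2(\mathbb{D})$, $i\in\mathbb{S}$ and an interval $I=(\alpha,\beta)\subset\mathbb{R}$ with $|I|=\beta-\alpha\le2\pi$, let $f_{I,i}=\frac1{|I|}\int_If(e^{i\theta})\,d\theta$, and put $$|f|_{\mathrm{BMOSH}(\mathbb{D}_i)}^2=\sup_{I\subset\mathbb{R},|I|\le2\pi}\frac1{|I|}\int_I|f(e^{i\theta})-f_{I,i}|^2\,d\theta,\qquad |f|_{\mathrm{BMOSH}(\mathbb{D})}=\sup_{i\in\mathbb{S}}|f|_{\mathrm{BMOSH}(\mathbb{D}_i)}.$$ $\mathrm{BMOSH}(\mathbb{D})$ is the set of $f\in\mathcal{H}^2(\mathbb{D})$ with $|f|_{\mathrm{BMOSH}(\mathbb{D})}<\infty$. A quaternionic right Banach space is a right $\mathbb{H}$-vector space with a norm satisfying $\|fa\|=\|f\||a|$ for $a\in\mathbb{H}$, complete for this norm. *)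

(* Defs.v *)
From HB Require Import structures.
From mathcomp Require Import all_boot all_order all_algebra.
From mathcomp Require Import all_classical all_reals all_analysis.
From mathcomp Require Import ring lra.

Set Implicit Arguments.
Unset Strict Implicit.
Unset Printing Implicit Defensive.

Import Order.TTheory GRing.Theory Num.Theory.
Import numFieldNormedType.Exports.

Local Open Scope classical_set_scope.
Local Open Scope ring_scope.

(* [Quat a b c d] is a + b e1 + c e2 + d e3, where e1, e2, e3 is the standard
   basis of the imaginary quaternions, with e1 e2 = e3. *)
Record quat (R : realType) := Quat { q0 : R; q1 : R; q2 : R; q3 : R }.

Section QuatAlgebra.
Variable R : realType.
Implicit Types (x y z : quat R) (a b : R).

Definition quat_tuple x := (q0 x, q1 x, q2 x, q3 x).
Definition tuple_quat (t : R * R * R * R) :=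
  Quat t.1.1.1 t.1.1.2 t.1.2 t.2.

Lemma quat_tupleK : cancel quat_tuple tuple_quat.
Proof. by case. Qed.

HB.instance Definition _ := Choice.copy (quat R) (can_type quat_tupleK).

Definition quat_opp x := Quat (- q0 x) (- q1 x) (- q2 x) (- q3 x).
Definition quat_add x y :=
  Quat (q0 x + q0 y) (q1 x + q1 y) (q2 x + q2 y) (q3 x + q3 y).
Definition quat_mul x y := Quat
  (q0 x * q0 y - q1 x * q1 y - q2 x * q2 y - q3 x * q3 y)
  (q0 x * q1 y + q1 x * q0 y + q2 x * q3 y - q3 x * q2 y)
  (q0 x * q2 y - q1 x * q3 y + q2 x * q0 y + q3 x * q1 y)
  (q0 x * q3 y + q1 x * q2 y - q2 x * q1 y + q3 x * q0 y).
Definition quat_scale a x := Quat (a * q0 x) (a * q1 x) (a * q2 x) (a * q3 x).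

Let quat_addA : associative quat_add.
Proof. by move=> x y z; congr Quat => /=; ring. Qed.
Let quat_addC : commutative quat_add.
Proof. by move=> x y; congr Quat => /=; ring. Qed.
Let quat_add0 : left_id (Quat 0 0 0 0) quat_add.
Proof. by case=> *; congr Quat => /=; ring. Qed.
Let quat_addN : left_inverse (Quat 0 0 0 0) quat_opp quat_add.
Proof. by move=> x; congr Quat => /=; ring. Qed.

HB.instance Definition _ := GRing.isZmodule.Build (quat R)
  quat_addA quat_addC quat_add0 quat_addN.

Let quat_mulA : associative quat_mul.
Proof. by move=> x y z; congr Quat => /=; ring. Qed.
Let quat_mul1l : left_id (Quat 1 0 0 0) quat_mul.
Proof. by case=> *; congr Quat => /=; ring. Qed.
Let quat_mul1r : right_id (Quat 1 0 0 0) quat_mul.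
Proof. by case=> *; congr Quat => /=; ring. Qed.
Let quat_mulDl : left_distributive quat_mul +%R.
Proof. by move=> x y z; congr Quat => /=; ring. Qed.
Let quat_mulDr : right_distributive quat_mul +%R.
Proof. by move=> x y z; congr Quat => /=; ring. Qed.
Let quat_1neq0 : Quat 1 0 0 0 != 0 :> quat R.
Proof. by apply/eqP => -[] /eqP; rewrite oner_eq0. Qed.

HB.instance Definition _ := GRing.Zmodule_isNzRing.Build (quat R)
  quat_mulA quat_mul1l quat_mul1r quat_mulDl quat_mulDr quat_1neq0.

Let quat_scaleA a b x : quat_scale a (quat_scale b x) = quat_scale (a * b) x.
Proof. by congr Quat => /=; ring. Qed.
Let quat_scale1 : left_id 1 quat_scale.
Proof. by case=> *; congr Quat => /=; ring. Qed.
Let quat_scaleDr : right_distributive quat_scale +%R.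
Proof. by move=> a x y; congr Quat => /=; ring. Qed.
Let quat_scaleDl x : {morph quat_scale^~ x : a b / a + b}.
Proof. by move=> a b; congr Quat => /=; ring. Qed.

HB.instance Definition _ := GRing.Zmodule_isLmodule.Build R (quat R)
  quat_scaleA quat_scale1 quat_scaleDr quat_scaleDl.

Definition quat_norm x :=
  Num.sqrt (q0 x ^+ 2 + q1 x ^+ 2 + q2 x ^+ 2 + q3 x ^+ 2).

Let sqs_ge0 x : 0 <= q0 x ^+ 2 + q1 x ^+ 2 + q2 x ^+ 2 + q3 x ^+ 2.
Proof. by rewrite !addr_ge0 ?sqr_ge0. Qed.

Let quat_normD x y : quat_norm (x + y) <= quat_norm x + quat_norm y.
Proof.
rewrite -(@ler_pXn2r _ 2%N) ?nnegrE ?addr_ge0 ?sqrtr_ge0 //.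
rewrite sqrrD !sqr_sqrtr ?sqs_ge0 //.
set d := q0 x * q0 y + q1 x * q1 y + q2 x * q2 y + q3 x * q3 y.
suff dle : d <= quat_norm x * quat_norm y by rewrite /d in dle; rewrite /=; lra.
apply: le_trans (ler_norm _) _; rewrite -sqrtr_sqr -sqrtrM ?sqs_ge0 //.
rewrite ler_wsqrtr // -subr_ge0 /d.
set u := (X in 0 <= X).
have -> : u = (q0 x * q1 y - q1 x * q0 y) ^+ 2 +
  (q0 x * q2 y - q2 x * q0 y) ^+ 2 + (q0 x * q3 y - q3 x * q0 y) ^+ 2 +
  (q1 x * q2 y - q2 x * q1 y) ^+ 2 + (q1 x * q3 y - q3 x * q1 y) ^+ 2 +
  (q2 x * q3 y - q3 x * q2 y) ^+ 2 by rewrite /u; ring.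
by rewrite !addr_ge0 ?sqr_ge0.
Qed.

Let quat_normZ a x : quat_norm (a *: x) = `|a| * quat_norm x.
Proof.
rewrite /quat_norm -sqrtr_sqr -sqrtrM ?sqr_ge0 //; congr Num.sqrt => /=; ring.
Qed.

Let quat_norm_eq0 x : quat_norm x = 0 -> x = 0.
Proof.
move=> /eqP; rewrite sqrtr_eq0 => h.
have [h0 h1 h2 h3] : [/\ q0 x ^+ 2 = 0, q1 x ^+ 2 = 0, q2 x ^+ 2 = 0
  & q3 x ^+ 2 = 0].
  by move: (sqr_ge0 (q0 x)) (sqr_ge0 (q1 x)) (sqr_ge0 (q2 x))
    (sqr_ge0 (q3 x)) => *; split; lra.
move: h0 h1 h2 h3; case: x {h} => a b c d /=.
by move=> /eqP + /eqP + /eqP + /eqP; rewrite !sqrf_eq0 => /eqP-> /eqP-> /eqP->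
  /eqP->.
Qed.

HB.instance Definition _ := Lmodule_isNormed.Build R (quat R)
  quat_normD quat_normZ quat_norm_eq0.

Lemma quat_normE x :
  `|x| = Num.sqrt (q0 x ^+ 2 + q1 x ^+ 2 + q2 x ^+ 2 + q3 x ^+ 2).
Proof. by []. Qed.

End QuatAlgebra.

Section SliceHyperholomorphic.
Variable R : realType.

Definition imag_sphere : set (quat R) := [set x | q0 x = 0 /\ `|x| = 1].

(* The point a + i b of the slice C_i. *)
Definition slice_pt (i : quat R) (a b : R) : quat R := a *: (1 : quat R) + b *: i.

Definition circle_pt (i : quat R) (t : R) : quat R := slice_pt i (cos t) (sin t).

Definition planar_disc (a b : R) : Prop := a ^+ 2 + b ^+ 2 < 1.

(* A function on the open unit ball is represented by its extension by 0 to all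
   quaternions, so that equality of functions is equality on the ball. *)
Definition slice_hyperholomorphic (f : quat R -> quat R) : Prop :=
  [/\ forall x : quat R, 1 <= `|x| -> f x = 0,
      forall x : quat R, `|x| < 1 -> differentiable f x &
      exists alpha beta : R -> R -> quat R,
      [/\ forall (i : quat R) (a b : R), imag_sphere i -> 0 <= b -> planar_disc a b ->
            f (slice_pt i a b) = alpha a b + i * beta a b,
          forall a b, planar_disc a b ->
            alpha a (- b) = alpha a b /\ beta a (- b) = - beta a b,
          forall a b, planar_disc a b ->
            [/\ derivable (alpha^~ b) a 1, derivable (alpha a) b 1,
                derivable (beta^~ b) a 1 & derivable (beta a) b 1] &
          forall a b, planar_disc a b ->
            'D_1 (alpha^~ b) a = 'D_1 (beta a) b /\
            'D_1 (beta^~ b) a = - 'D_1 (alpha a) b]].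

Local Notation mu := (@lebesgue_measure R).

Definition circle_mean (p : R) (f : quat R -> quat R) (i : quat R) (r : R) :
    \bar R :=
  poweR (((2 * pi)^-1)%:E *
    \int[mu]_(t in `[0%R, (2 * pi)%R]) (`|f (r *: circle_pt i t)| `^ p)%:E)%E
    p^-1.

Definition hardy_norm (p : R) (f : quat R -> quat R) : \bar R :=
  ereal_sup [set lim (circle_mean p f i r @[r --> 1^'-]) | i in imag_sphere].

Definition hardy (p : R) : set (quat R -> quat R) :=
  [set f | slice_hyperholomorphic f /\ (hardy_norm p f < +oo)%E].

(* [lim] is a junk value at the angles where the radial limit does not exist. *)
Definition boundary_value (f : quat R -> quat R) (i : quat R) (t : R) : quat R :=
  lim (f (r *: circle_pt i t) @[r --> 1^'-]).

Definition quat_integral (D : set R) (g : R -> quat R) : quat R :=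
  Quat (\int[mu]_(t in D) q0 (g t)) (\int[mu]_(t in D) q1 (g t))
       (\int[mu]_(t in D) q2 (g t)) (\int[mu]_(t in D) q3 (g t)).

Definition mean_value (f : quat R -> quat R) (i : quat R) (a b : R) : quat R :=
  (b - a)^-1 *: quat_integral `]a, b[ (boundary_value f i).

Definition mean_oscillation (f : quat R -> quat R) (i : quat R) (a b : R) :
    \bar R :=
  ((b - a)^-1%:E * \int[mu]_(t in `]a, b[)
     (`|boundary_value f i t - mean_value f i a b| ^+ 2)%:E)%E.

Definition bmo_seminorm_slice (i : quat R) (f : quat R -> quat R) : \bar R :=
  sqrte (ereal_sup [set mean_oscillation f i ab.1 ab.2
    | ab in [set ab : R * R | ab.1 < ab.2 /\ ab.2 - ab.1 <= 2 * pi]]).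

Definition bmo_seminorm (f : quat R -> quat R) : \bar R :=
  ereal_sup [set bmo_seminorm_slice i f | i in imag_sphere].

Definition BMOSH : set (quat R -> quat R) :=
  [set f | hardy 2 f /\ (bmo_seminorm f < +oo)%E].

(* The seminorms are finite on [BMOSH] (see [bmo_seminorm_slice_fin_num] and
   [bmo_seminorm_fin_num]), so that [fine] loses nothing there. *)
Definition bmo_norm_slice (i : quat R) (f : quat R -> quat R) : R :=
  `|f 0| + fine (bmo_seminorm_slice i f).

Definition bmo_norm (f : quat R -> quat R) : R := `|f 0| + fine (bmo_seminorm f).

Lemma bmo_seminorm_slice_fin_num i f : imag_sphere i -> BMOSH f ->
  bmo_seminorm_slice i f \is a fin_num.
Proof.
move=> Si [_ fltoo]; rewrite ge0_fin_numE ?sqrte_ge0//.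
by apply: le_lt_trans fltoo; apply: ereal_sup_ubound; exists i.
Qed.

Lemma bmo_seminorm_fin_num f : BMOSH f -> bmo_seminorm f \is a fin_num.
Proof.
move=> [_ fltoo]; rewrite ge0_fin_numE//.
pose i : quat R := Quat 0 1 0 0.
have Si : imag_sphere i.
  by split => //; rewrite quat_normE /= expr0n /= expr1n !addr0 add0r sqrtr1.
apply: le_trans (ereal_sup_ubound _); last by exists i.
exact: sqrte_ge0.
Qed.

End SliceHyperholomorphic.

Section RightBanach.
Variable R : realType.

(* [V], with the addition of [E], the right scaling [rscale] and the norm [N],
   is a right Banach space over the quaternions. *)
Record quaternionic_right_banach (E : zmodType) (rscale : E -> quat R -> E)
    (V : set E) (N : E -> R) : Prop := QuaternionicRightBanach {
  qrb_zero : V 0;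
  qrb_add : forall f g, V f -> V g -> V (f + g);
  qrb_opp : forall f, V f -> V (- f);
  qrb_scale : forall f a, V f -> V (rscale f a);
  qrb_scaleA : forall f a b, V f -> rscale (rscale f a) b = rscale f (a * b);
  qrb_scale1 : forall f, V f -> rscale f 1 = f;
  qrb_scaleDl : forall f g a, V f -> V g ->
    rscale (f + g) a = rscale f a + rscale g a;
  qrb_scaleDr : forall f a b, V f -> rscale f (a + b) = rscale f a + rscale f b;
  qrb_norm_ge0 : forall f, V f -> 0 <= N f;
  qrb_norm_eq0 : forall f, V f -> N f = 0 -> f = 0;
  qrb_normD : forall f g, V f -> V g -> N (f + g) <= N f + N g;
  qrb_normZ : forall f a, V f -> N (rscale f a) = N f * `|a|;
  qrb_complete : forall u : nat -> E, (forall n, V (u n)) ->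
    (forall e : R, 0 < e -> exists n0 : nat, forall m n : nat, (n0 <= m)%N -> (n0 <= n)%N ->
      N (u m - u n) < e) ->
    exists2 f, V f & N (u n - f) @[n --> \oo] --> 0 }.

Definition equivalent_norms (E : Type) (V : set E) (N1 N2 : E -> R) : Prop :=
  exists c C : R, [/\ 0 < c, 0 < C &
    forall f, V f -> c * N1 f <= N2 f /\ N2 f <= C * N1 f].

Definition pointwise_rscale (T : Type) (f : T -> quat R) (a : quat R) :
    T -> quat R := fun x => f x * a.

End RightBanach.

(* Main.v *)
(* On a slice, a slice hyperholomorphic function f satisfies Cauchy-Riemann
   equations with values in the left module H; Goursat's argument in logarithmic
   polar coordinates, applied to each real component, gives its Fourier
   coefficients on circles and hence f(x) = \sum_n x^n a_n, first on one slice
   and then on the whole ball by the representation formula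
     f(x_j) = (1 - j i)/2 f(x_i) + (1 + j i)/2 f(x_{-i}).
   By Parseval, H^2 is the space of the series with \sum_n |a_n|^2 < oo.  Their
   radial limits exist almost everywhere (maximal inequality for the Poisson
   kernel) and satisfy Parseval's formula up to constants.

   The mean of f on I minimises c |-> \int_I |f - c|^2, so the oscillation is
   bounded by any such second moment.  This gives the triangle inequality
   and, with the representation formula, the bound of the seminorm on one slice
   by twice the seminorm on another.  The oscillation on (0, 2 pi) dominates
   \sum_{n >= 1} |a_n|^2, so that the coefficients of a Cauchy sequence converge
   in l^2; the sum of the limit series is the limit in norm, because for each
   fixed interval the oscillation is continuous along L^2 convergence. *)

Require Import Defs.
From HB Require Import structures.
From mathcomp Require Import all_boot all_order all_algebra.
From mathcomp Require Import all_classical all_reals all_analysis.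
From mathcomp Require Import ring lra measurable_realfun.

Set Implicit Arguments.
Unset Strict Implicit.
Unset Printing Implicit Defensive.

Import Order.TTheory GRing.Theory Num.Theory.
Import numFieldNormedType.Exports.

Local Open Scope classical_set_scope.
Local Open Scope ring_scope.

(** * Integrals on segments *)

Section SegmentIntegral.
Variable R : realType.
Local Notation mu := (@lebesgue_measure R).
Implicit Types (f g F G : R -> R) (a b c : R).

(** [f] is only assumed differentiable, with no continuity of its derivatives; this rules out
    Green's formula and calls for Goursat's subdivision. In logarithmic polar coordinates circles
    become segments and annuli rectangles; periodicity cancels two sides of the rectangle, and the
    centre moves to minus infinity, where boundedness kills the negative modes. Boundary values are
    limits along radii, with a default value where there is none, so their measurability and their
    existence almost everywhere come before any use of their integrals. Triangle inequalities in L2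
    are proved with the weights 1 + e and 1 + 1/e, and e is optimised at the end. The constant 4 in
    the upper L2 bound is crude: that bound only serves finiteness and limits equal to 0. The factor
    2 between slices counts the terms of the representation formula, whose coefficients have norm at
    most 1. All norms of the theorem are instances of one norm, taken over a set of units that is a
    singleton or the whole sphere. *)

Definition segint f a b : R := \int[mu]_(x in `[a, b]) f x.

Definition cont_on f a b := {within `[a, b], continuous f}.

Lemma cont_onT f a b : continuous f -> cont_on f a b.
Proof. by move=> fc; apply: continuous_subspaceT. Qed.

Lemma cont_on_in f a b : (forall x, a <= x <= b -> {for x, continuous f}) ->
  cont_on f a b.
Proof.
by move=> fc; apply: continuous_in_subspaceT => x; rewrite inE /= in_itv/= => /fc.
Qed.

Lemma cont_onD f g a b : cont_on f a b -> cont_on g a b ->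
  cont_on (fun x => f x + g x) a b.
Proof. by move=> cf cg x; apply: continuousD; [apply: cf|apply: cg]. Qed.

Lemma cont_onB f g a b : cont_on f a b -> cont_on g a b ->
  cont_on (fun x => f x - g x) a b.
Proof. by move=> cf cg x; apply: continuousB; [apply: cf|apply: cg]. Qed.

Lemma cont_on_norm f a b : cont_on f a b -> cont_on (fun x => `|f x|) a b.
Proof.
by move=> cf x; apply: cvg_norm; exact: cf.
Qed.

Lemma cont_on_integrable f a b : cont_on f a b -> mu.-integrable `[a, b] (EFin \o f).
Proof. by move=> cf; apply: continuous_compact_integrable => //; exact: segment_compact. Qed.

Lemma integral_segint f a b : cont_on f a b ->
  (\int[mu]_(x in `[a, b]) (f x)%:E = (segint f a b)%:E)%E.
Proof. by move=> cf; rewrite /segint /Rintegral fineK// integrable_fin_num//; exact: cont_on_integrable. Qed.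

Lemma segintD f g a b : cont_on f a b -> cont_on g a b ->
  segint (fun x => f x + g x) a b = segint f a b + segint g a b.
Proof. by move=> cf cg; rewrite /segint RintegralD//; exact: cont_on_integrable. Qed.

Lemma segintB f g a b : cont_on f a b -> cont_on g a b ->
  segint (fun x => f x - g x) a b = segint f a b - segint g a b.
Proof. by move=> cf cg; rewrite /segint RintegralB//; exact: cont_on_integrable. Qed.

Lemma segintZ k f a b : cont_on f a b ->
  segint (fun x => k * f x) a b = k * segint f a b.
Proof. by move=> cf; rewrite /segint RintegralZl//; exact: cont_on_integrable. Qed.

Lemma le_segint f g a b : cont_on f a b -> cont_on g a b ->
  (forall x, a <= x <= b -> f x <= g x) -> segint f a b <= segint g a b.
Proof.
move=> /cont_on_integrable cf /cont_on_integrable cg fg; exact: le_Rintegral.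
Qed.

Lemma eq_segint f g a b : (forall x, a <= x <= b -> f x = g x) ->
  segint f a b = segint g a b.
Proof.
by move=> fg; apply: eq_Rintegral => x; rewrite inE/= in_itv/=; exact: fg.
Qed.

Lemma segint_cst k a b : a <= b -> segint (fun=> k) a b = k * (b - a).
Proof.
rewrite le_eqVlt => /predU1P[<-|ab]; first by rewrite /segint set_itv1 Rintegral_set1 subrr mulr0.
by rewrite /segint Rintegral_cst//= lebesgue_measure_itv/= lte_fin ab.
Qed.

Lemma segint_norm f a b : cont_on f a b ->
  `|segint f a b| <= segint (fun x => `|f x|) a b.
Proof. by move=> cf; apply: le_normr_Rintegral => //; exact: cont_on_integrable. Qed.

Lemma segint_bound f a b M : a <= b -> cont_on f a b ->
  (forall x, a <= x <= b -> `|f x| <= M) -> `|segint f a b| <= M * (b - a).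
Proof.
move=> ab cf fM; apply: le_trans (segint_norm cf) _.
rewrite -segint_cst//; apply: le_segint => //; first exact: cont_on_norm.
by apply: cont_onT => x; exact: cvg_cst.
Qed.

Lemma segint_ge0 f a b : (forall x, a <= x <= b -> 0 <= f x) -> 0 <= segint f a b.
Proof. by move=> f0; apply: Rintegral_ge0 => x /=; rewrite in_itv/=; exact: f0. Qed.

Lemma segint_chasles f a b c : a <= c -> c <= b -> cont_on f a b ->
  segint f a b = segint f a c + segint f c b.
Proof.
move=> ac cb cf; have cfab := cont_on_integrable cf.
have /(_ _ _)/eqP := Rintegral_itvB (x := c) cfab.
rewrite !bnd_simp => /(_ ac cb)/eqP.
rewrite Rintegral_itv_obnd_cbnd; last first.
  apply: integrableS cfab => // x /=; rewrite !in_itv/= => /andP[/ltW cx ->].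
  by rewrite (le_trans ac cx).
by rewrite /segint => <-; rewrite addrC subrK.
Qed.

Lemma segint_self f a : segint f a a = 0.
Proof. by rewrite /segint set_itv1 Rintegral_set1. Qed.

Lemma segint_FTC f F a b : a <= b -> cont_on f a b ->
  (forall x, a <= x <= b -> is_derive x 1 F (f x)) -> segint f a b = F b - F a.
Proof.
rewrite le_eqVlt => /predU1P[<-|ab] cf dF; first by rewrite segint_self subrr.
have cF x : a <= x <= b -> {for x, continuous F}.
  move=> /dF dx; apply: differentiable_continuous; apply/derivable1_diffP.
  exact: (@ex_derive _ _ _ _ _ _ _ dx).
apply: EFin_inj; rewrite -integral_segint// EFinB.
apply: continuous_FTC2 => //.
- split.
  + by move=> x; rewrite in_itv/= => /andP[/ltW ax /ltW xb]; apply: (@ex_derive _ _ _ _ _ _ _ (dF x _)); rewrite ax.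
  + by apply: cvg_at_right_filter; apply: cF; rewrite lexx ltW.
  + by apply: cvg_at_left_filter; apply: cF; rewrite lexx ltW.
- move=> x; rewrite in_itv/= => /andP[/ltW ax /ltW xb].
  by rewrite derive1E; apply: (@derive_val _ _ _ _ _ _ _ (dF x _)); rewrite ax.
Qed.

Lemma ex_primitive f : continuous f -> exists F : R -> R, forall x : R, is_derive x 1 F (f x).
Proof.
move=> cf; pose F x := if 0 <= x then segint f 0 x else - segint f x 0.
(* A base point to the left of both [0] and [x]: near [x], [F] is the integral from [w] minus a
   constant. *)
exists F => x; pose w := - `|x| - 1.
have w0 : w < 0 by rewrite /w; have := normr_ge0 x; lra.
have wx : w < x by rewrite /w; have := ler_norm (- x); rewrite normrN; lra.
have FE y : w <= y -> F y = segint f w y - segint f w 0.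
  move=> wy; rewrite /F; case: ifPn => [y0|].
    by rewrite (segint_chasles (ltW w0) y0 (cont_onT cf)) addrC addKr.
  rewrite -ltNge => /ltW y0.
  by rewrite (segint_chasles wy y0 (cont_onT cf)) opprD addrA subrr sub0r.
have xu : x < x + 1 by lra.
have [] := @continuous_FTC1_closed _ f w x (x + 1) xu (cont_on_integrable (cont_onT cf)) wx (cf x).
rewrite derive1E => dF dFE.
have H : is_derive x 1 (fun y => segint f w y - segint f w 0) (f x).
  have -> : f x = f x - 0 by rewrite subr0.
  by apply: is_deriveB; apply: DeriveDef.
apply: near_eq_is_derive H.
near=> y; rewrite FE//; apply: ltW; near: y.
exact: lt_nbhsr.
Unshelve. all: by end_near. Qed.

Lemma is_derive_continuous F f (x : R) : is_derive x 1 F (f x) -> {for x, continuous F}.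
Proof.
move=> dx; apply: differentiable_continuous; apply/derivable1_diffP.
exact: (@ex_derive _ _ _ _ _ _ _ dx).
Qed.

Lemma is_derive_comp_affine F (l k c x : R) : is_derive (k * x + c) 1 F l ->
  is_derive x 1 (fun y => F (k * y + c)) (k * l).
Proof.
move=> dF; have dg : is_derive x 1 (fun y => k * y + c) k.
  by apply: is_derive_eq; rewrite addr0 /GRing.scale/= mulr1.
rewrite mulrC; exact: (@is_derive1_comp _ F (fun y => k * y + c) x l k).
Qed.

(** For a primitive [F], the difference [F (x + T) - F x] has derivative [f (x + T) - f x = 0],
    hence is constant in [x]. *)
Lemma segint_periodic f a T : 0 <= T -> continuous f -> (forall x, f (x + T) = f x) ->
  segint f a (a + T) = segint f 0 T.
Proof.
move=> T0 cf pf; have [F dF] := ex_primitive cf.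
have FE x : segint f x (x + T) = F (x + T) - F x.
  by rewrite (segint_FTC (F := F) _ (cont_onT cf)) ?lerDl.
have := FE 0; rewrite add0r FE => ->.
pose D x := F (x + T) - F x.
have dD (x : R) : is_derive x 1 D 0.
  rewrite -(subrr (f x)) -{1}(pf x); apply: is_deriveB => //.
  have := @is_derive_comp_affine F (f (1 * x + T)) 1 T x (dF _).
  by rewrite !mul1r; congr is_derive; apply/funext => y; rewrite mul1r.
have := @is_derive_0_is_cst _ D a 0 dD.
by rewrite /D add0r.
Qed.

Lemma segint_cvg (fn : nat -> R -> R) f (e : nat -> R) a b : a <= b ->
  (forall n, cont_on (fn n) a b) -> cont_on f a b ->
  (forall n x, a <= x <= b -> `|fn n x - f x| <= e n) -> e @ \oo --> 0 ->
  segint (fn n) a b @[n --> \oo] --> segint f a b.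
Proof.
move=> ab cfn cf fne e0; apply/cvgrPdist_le => d d0.
have e1 : e n * (b - a) @[n --> \oo] --> 0.
  by rewrite -(mul0r (b - a)); apply: cvgM => //; exact: cvg_cst.
have /cvgrPdist_le/(_ _ d0) := e1.
apply: filterS => n; rewrite sub0r normrN => h.
rewrite distrC -segintB//; apply: le_trans (le_trans (ler_norm _) h).
apply: segint_bound => //; first exact: cont_onB.
by move=> x; exact: fne.
Qed.

End SegmentIntegral.

(** * Goursat's theorem for closed forms *)

Section Goursat.
Variable R : realType.
Implicit Types (P Q : R -> R -> R) (a b c d x y : R).

(** Frechet differentiability with gradient [(p1, p2)], spelled out because Goursat's argument uses
    the error bound on a whole small rectangle around the point. *)
Definition has_grad P x y (p1 p2 : R) := forall e : R, 0 < e -> exists2 del : R, 0 < del &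
  forall h k : R, `|h| < del -> `|k| < del ->
    `|P (x + h) (y + k) - P x y - (p1 * h + p2 * k)| <= e * (`|h| + `|k|).

Lemma has_grad_cont P x y p1 p2 : has_grad P x y p1 p2 ->
  {for x, continuous (P^~ y)} /\ {for y, continuous (P x)}.
Proof.
move=> Pxy; have [del del0 H] := Pxy 1 ltr01.
pose K := `|p1| + `|p2| + 1.
have K0 : 0 < K by rewrite /K ltr_wpDl// addr_ge0.
have HH h k : `|h| < del -> `|k| < del -> `|P (x + h) (y + k) - P x y| <= K * (`|h| + `|k|).
  move=> hd kd; have := H h k hd kd; rewrite mul1r => /(le_trans (lerB_dist _ _)).
  rewrite lerBlDr => /le_trans; apply; rewrite /K.
  have h1 : `|p1 * h + p2 * k| <= `|p1| * `|h| + `|p2| * `|k|.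
    by rewrite -!normrM ler_normD.
  have := normr_ge0 h; have := normr_ge0 k; have := normr_ge0 p1; have := normr_ge0 p2.
  by move: h1; move: `|h| `|k| `|p1| `|p2| `|_ + _| => *; nra.
split; apply/cvgrPdist_le => e e0; near=> z; rewrite distrC.
- have zx : `|z - x| < Num.min del (e / K).
    by rewrite distrC; near: z; apply: cvgr_dist_lt => //; rewrite lt_min del0 divr_gt0.
  move: zx; rewrite lt_min => /andP[z1 z2].
  have := HH (z - x) 0 z1; rewrite normr0 del0 addr0 (addrC x) subrK addr0 => /(_ isT).
  by move=> /le_trans; apply; rewrite mulrC -ler_pdivlMr// ltW.
- have zx : `|z - y| < Num.min del (e / K).
    by rewrite distrC; near: z; apply: cvgr_dist_lt => //; rewrite lt_min del0 divr_gt0.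
  move: zx; rewrite lt_min => /andP[z1 z2].
  have := HH 0 (z - y); rewrite normr0 del0 add0r (addrC y) subrK addr0 => /(_ isT z1).
  by move=> /le_trans; apply; rewrite mulrC -ler_pdivlMr// ltW.
Unshelve. all: by end_near. Qed.

(** The integral of the form [P dx + Q dy] along the boundary of [[a, b] x [c, d]],
    counterclockwise. *)
Definition rectint P Q a b c d :=
  segint (fun x => P x c - P x d) a b + segint (fun y => Q b y - Q a y) c d.

Section Rectangle.
Variables (P Q : R -> R -> R) (a0 b0 c0 d0 : R).
(** The shared [s] expresses that [P dx + Q dy] is closed; the partial derivatives are only taken
    pointwise. *)
Hypothesis PQ : forall x y, a0 <= x <= b0 -> c0 <= y <= d0 ->
  exists p1 s q2, has_grad P x y p1 s /\ has_grad Q x y s q2.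

Let contP a b y : a0 <= a -> b <= b0 -> c0 <= y <= d0 -> cont_on (P^~ y) a b.
Proof.
move=> aa bb cy; apply: cont_on_in => x /andP[ax xb].
have [|p1 [s [q2 [/has_grad_cont[+ _] _]]]] := PQ (x := x) _ cy; last exact.
by rewrite (le_trans aa ax) (le_trans xb bb).
Qed.

Let contQ c d x : c0 <= c -> d <= d0 -> a0 <= x <= b0 -> cont_on (Q x) c d.
Proof.
move=> cc dd ax; apply: cont_on_in => y /andP[cy yd].
have [|p1 [s [q2 [_ /has_grad_cont[_ +]]]]] := PQ (y := y) ax; last exact.
by rewrite (le_trans cc cy) (le_trans yd dd).
Qed.

(** The inner edges are traversed twice, in opposite directions, and cancel. *)
Let rectint_split a b c d m n : a0 <= a -> a <= m -> m <= b -> b <= b0 ->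
  c0 <= c -> c <= n -> n <= d -> d <= d0 ->
  rectint P Q a b c d = rectint P Q a m c n + rectint P Q m b c n +
    rectint P Q a m n d + rectint P Q m b n d.
Proof.
move=> aa am mb bb cc cn nd dd; rewrite /rectint.
have ab := le_trans am mb; have cd := le_trans cn nd.
have inx x : a <= x -> x <= b -> a0 <= x <= b0.
  by move=> ax xb; rewrite (le_trans aa ax) (le_trans xb bb).
have iny y : c <= y -> y <= d -> c0 <= y <= d0.
  by move=> ax xb; rewrite (le_trans cc ax) (le_trans xb dd).
have SP a' b' y1 y2 : a <= a' -> b' <= b -> c <= y1 -> y1 <= d -> c <= y2 -> y2 <= d ->
  segint (fun x => P x y1 - P x y2) a' b' = segint (P^~ y1) a' b' - segint (P^~ y2) a' b'.
  move=> aa' bb' *; apply: segintB; apply: contP; rewrite ?iny//.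
  - exact: le_trans aa'.
  - exact: le_trans bb' bb.
  - exact: le_trans aa'.
  - exact: le_trans bb' bb.
have SQ a' b' y1 y2 : c <= a' -> b' <= d -> a <= y1 -> y1 <= b -> a <= y2 -> y2 <= b ->
  segint (fun x => Q y1 x - Q y2 x) a' b' = segint (Q y1) a' b' - segint (Q y2) a' b'.
  move=> aa' bb' *; apply: segintB; apply: contQ; rewrite ?inx//.
  - exact: le_trans aa'.
  - exact: le_trans bb' dd.
  - exact: le_trans aa'.
  - exact: le_trans bb' dd.
have CP y : c <= y -> y <= d -> segint (P^~ y) a b = segint (P^~ y) a m + segint (P^~ y) m b.
  by move=> *; apply: segint_chasles => //; apply: contP => //; exact: iny.
have CQ y : a <= y -> y <= b -> segint (Q y) c d = segint (Q y) c n + segint (Q y) n d.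
  by move=> *; apply: segint_chasles => //; apply: contQ => //; exact: inx.
rewrite !SP// !SQ// !CP// !CQ//; ring.
Qed.

(** The affine parts of [P] and [Q] contribute [s * (c - d) * (b - a)] and [s * (b - a) * (d - c)],
    which cancel by closedness. What remains is the error, of the order of the squared size of the
    rectangle. *)
Let rectint_local a b c d x y p1 s q2 e : a0 <= a -> a <= x -> x <= b -> b <= b0 ->
  c0 <= c -> c <= y -> y <= d -> d <= d0 -> 0 <= e ->
  (forall z t, a <= z <= b -> c <= t <= d ->
    `|P z t - P x y - (p1 * (z - x) + s * (t - y))| <= e * (`|z - x| + `|t - y|)) ->
  (forall z t, a <= z <= b -> c <= t <= d ->
    `|Q z t - Q x y - (s * (z - x) + q2 * (t - y))| <= e * (`|z - x| + `|t - y|)) ->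
  `|rectint P Q a b c d| <= 2 * e * ((b - a) + (d - c)) ^+ 2.
Proof.
move=> aa ax xb bb cc cy yd dd e0 HP HQ.
have ab := le_trans ax xb; have cd := le_trans cy yd.
have cst (k : R) u v : cont_on (fun=> k) u v by apply: cont_onT => z; exact: cvg_cst.
have HM z t : a <= z <= b -> c <= t <= d ->
    e * (`|z - x| + `|t - y|) <= e * ((b - a) + (d - c)).
  move=> /andP[az zb] /andP[ct td]; apply: ler_wpM2l => //; apply: lerD.
    by rewrite ler_norml; apply/andP; split; lra.
  by rewrite ler_norml; apply/andP; split; lra.
have aab : a <= a <= b by rewrite lexx.
have bab : a <= b <= b by rewrite lexx andbT.
have ccd : c <= c <= d by rewrite lexx.
have dcd : c <= d <= d by rewrite lexx andbT.
have c0c : c0 <= c <= d0 by rewrite cc (le_trans cd).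
have c0d : c0 <= d <= d0 by rewrite dd (le_trans cc).
have a0a : a0 <= a <= b0 by rewrite aa (le_trans ab).
have a0b : a0 <= b <= b0 by rewrite bb (le_trans aa).
pose M := 2 * (e * ((b - a) + (d - c))).
have cPP : cont_on (fun z => P z c - P z d) a b by apply: cont_onB; apply: contP.
have cQQ : cont_on (fun z => Q b z - Q a z) c d by apply: cont_onB; apply: contQ.
have B1 : `|segint (fun z => (P z c - P z d) - s * (c - d)) a b| <= M * (b - a).
  apply: segint_bound => //; first by apply: cont_onB.
  move=> z zab; have h1 := le_trans (HP z c zab ccd) (HM z c zab ccd).
  have h2 := le_trans (HP z d zab dcd) (HM z d zab dcd).
  have -> : P z c - P z d - s * (c - d) =
    (P z c - P x y - (p1 * (z - x) + s * (c - y))) -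
    (P z d - P x y - (p1 * (z - x) + s * (d - y))) by ring.
  by apply: le_trans (ler_normB _ _) _; rewrite /M mulr2n mulrDl mul1r lerD.
have B2 : `|segint (fun z => (Q b z - Q a z) - s * (b - a)) c d| <= M * (d - c).
  apply: segint_bound => //; first by apply: cont_onB.
  move=> z zcd; have h1 := le_trans (HQ b z bab zcd) (HM b z bab zcd).
  have h2 := le_trans (HQ a z aab zcd) (HM a z aab zcd).
  have -> : Q b z - Q a z - s * (b - a) =
    (Q b z - Q x y - (s * (b - x) + q2 * (z - y))) -
    (Q a z - Q x y - (s * (a - x) + q2 * (z - y))) by ring.
  by apply: le_trans (ler_normB _ _) _; rewrite /M mulr2n mulrDl mul1r lerD.
rewrite segintB// segint_cst// in B1; rewrite segintB// segint_cst// in B2.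
rewrite /rectint.
have -> : segint (fun z => P z c - P z d) a b + segint (fun z => Q b z - Q a z) c d =
  (segint (fun z => P z c - P z d) a b - s * (c - d) * (b - a)) +
  (segint (fun z => Q b z - Q a z) c d - s * (b - a) * (d - c)) by ring.
apply: le_trans (ler_normD _ _) _; apply: le_trans (lerD B1 B2) _.
by rewrite /M le_eqVlt; apply/orP; left; apply/eqP; ring.
Qed.

Let w n := (b0 - a0) / 2 ^+ n.
Let h n := (d0 - c0) / 2 ^+ n.
Let sub n (p : R * R) := rectint P Q p.1 (p.1 + w n) p.2 (p.2 + h n).
Let inside n (p : R * R) := [/\ a0 <= p.1, p.1 + w n <= b0, c0 <= p.2 & p.2 + h n <= d0].

Let wS n : w n = w n.+1 + w n.+1.
Proof.
by rewrite /w exprS; field; rewrite expf_neq0 ?andbT// ?expf_neq0// pnatr_eq0.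
Qed.

Let hS n : h n = h n.+1 + h n.+1.
Proof.
by rewrite /h exprS; field; rewrite expf_neq0 ?andbT// ?expf_neq0// pnatr_eq0.
Qed.

Hypotheses (ab0 : a0 <= b0) (cd0 : c0 <= d0).

Let w_ge0 n : 0 <= w n. Proof. by rewrite divr_ge0 ?subr_ge0// exprn_ge0. Qed.
Let h_ge0 n : 0 <= h n. Proof. by rewrite divr_ge0 ?subr_ge0// exprn_ge0. Qed.

(** By the triangle inequality one of the four pieces carries at least a quarter of the integral. *)
Let quarter n p : inside n p -> exists p', [/\ p.1 <= p'.1, p'.1 + w n.+1 <= p.1 + w n,
  p.2 <= p'.2, p'.2 + h n.+1 <= p.2 + h n & `|sub n p| <= 4 * `|sub n.+1 p'|].
Proof.
move=> [p1 p2 p3 p4].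
have w1 := w_ge0 n.+1; have h1 := h_ge0 n.+1.
pose A := sub n.+1 (p.1, p.2).
pose B := sub n.+1 (p.1 + w n.+1, p.2).
pose C := sub n.+1 (p.1, p.2 + h n.+1).
pose D := sub n.+1 (p.1 + w n.+1, p.2 + h n.+1).
have E : sub n p = A + B + C + D.
  have w2 : p.1 + w n.+1 + w n.+1 = p.1 + w n by rewrite (wS n) addrA.
  have h2 : p.2 + h n.+1 + h n.+1 = p.2 + h n by rewrite (hS n) addrA.
  rewrite /A /B /C /D /sub/= w2 h2.
  by apply: rectint_split; rewrite ?lerDl// -?w2 -?h2 lerDl.
have N : `|sub n p| <= `|A| + `|B| + `|C| + `|D|.
  rewrite E; apply: le_trans (ler_normD _ _) _; rewrite lerD2r.
  by apply: le_trans (ler_normD _ _) _; rewrite lerD2r ler_normD.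
have wn := wS n; have hn := hS n.
have [hA|hA] := leP `|sub n p| (4 * `|A|).
  by exists (p.1, p.2); split => //=; lra.
have [hB|hB] := leP `|sub n p| (4 * `|B|).
  by exists (p.1 + w n.+1, p.2); split => //=; lra.
have [hC|hC] := leP `|sub n p| (4 * `|C|).
  by exists (p.1, p.2 + h n.+1); split => //=; lra.
exists (p.1 + w n.+1, p.2 + h n.+1); split => //=; try lra.
Qed.

(** Repeated quartering yields nested rectangles with an integral of at least [k / 4 ^+ n], while
    the local estimate at their common point bounds it by a multiple of [e] times the squared size,
    which is also of order [4 ^- n]. A small [e] gives a contradiction. *)
Lemma goursat : rectint P Q a0 b0 c0 d0 = 0.
Proof.
apply/eqP; rewrite -normr_le0 leNgt; apply/negP => k0; set k := `|_| in k0.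
have /choice[f fP] : forall np : nat * (R * R), exists p' : R * R,
    inside np.1 np.2 -> [/\ np.2.1 <= p'.1, p'.1 + w np.1.+1 <= np.2.1 + w np.1,
  np.2.2 <= p'.2, p'.2 + h np.1.+1 <= np.2.2 + h np.1 & `|sub np.1 np.2| <= 4 * `|sub np.1.+1 p'|].
  move=> [n p]; have [/= H|H] := pselect (inside n p); last by exists p.
  by have [p' Hp'] := quarter H; exists p'.
pose s := fix s n := if n is m.+1 then f (m, s m) else (a0, c0).
have w0 : w 0%N = b0 - a0 by rewrite /w expr0 divr1.
have h0 : h 0%N = d0 - c0 by rewrite /h expr0 divr1.
have sin n : inside n (s n).
  elim: n => [|n IH]; first by split => //=; rewrite ?w0 ?h0; lra.
  have [/= s1 s2 s3 s4 _] := fP (n, s n) IH; have [t1 t2 t3 t4] := IH.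
  by split => /=; lra.
have sS n := fP (n, s n) (sin n).
have sk n : k <= 4 ^+ n * `|sub n (s n)|.
  elim: n => [|n IH]; first by rewrite expr0 mul1r /sub w0 h0/= !(addrC _ (_ - _)) !subrK.
  have [_ _ _ _ /= H] := sS n; apply: le_trans IH _.
  by rewrite exprSr -mulrA ler_pM2l// exprn_gt0.
have mono n m : (n <= m)%N -> [/\ (s n).1 <= (s m).1, (s m).1 + w m <= (s n).1 + w n,
    (s n).2 <= (s m).2 & (s m).2 + h m <= (s n).2 + h n].
  elim: m => [|m IH]; first by rewrite leqn0 => /eqP ->.
  rewrite leq_eqVlt => /predU1P[->//|]; rewrite ltnS => /IH[u1 u2 u3 u4].
  by have [/= v1 v2 v3 v4 _] := sS m; split => /=; lra.
(* Every left end lies below every right end, so the supremum of the left ends belongs to all the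
   intervals. *)
have cross n m : (s n).1 <= (s m).1 + w m /\ (s n).2 <= (s m).2 + h m.
  have [nm|/ltnW mn] := leqP n m.
    by have [u1 _ u3 _] := mono n m nm; have := w_ge0 m; have := h_ge0 m; split; lra.
  by have [_ u2 _ u4] := mono m n mn; have := w_ge0 n; have := h_ge0 n; split; lra.
pose x := sup (range (fun n => (s n).1)); pose y := sup (range (fun n => (s n).2)).
have xn n : (s n).1 <= x <= (s n).1 + w n.
  apply/andP; split.
    apply: ub_le_sup; last by exists n.
    by exists ((s 0%N).1 + w 0) => _ [m _ <-]; exact: (cross m 0%N).1.
  apply: ge_sup; first by exists (s 0%N).1, 0%N.
  by move=> _ [m _ <-]; exact: (cross m n).1.
have yn n : (s n).2 <= y <= (s n).2 + h n.
  apply/andP; split.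
    apply: ub_le_sup; last by exists n.
    by exists ((s 0%N).2 + h 0) => _ [m _ <-]; exact: (cross m 0%N).2.
  apply: ge_sup; first by exists (s 0%N).2, 0%N.
  by move=> _ [m _ <-]; exact: (cross m n).2.
have xin : a0 <= x <= b0 by have := xn 0%N; rewrite w0 /= addrC subrK.
have yin : c0 <= y <= d0 by have := yn 0%N; rewrite h0 /= addrC subrK.
have [p1 [t [q2 [HP HQ]]]] := PQ xin yin.
pose L := (b0 - a0) + (d0 - c0).
have L0 : 0 <= L by rewrite /L; lra.
(* The final bound becomes [2 * e * L ^+ 2], which is at most [k / 2]; the summand [1] covers
   [L = 0]. *)
pose e := k / (4 * (L ^+ 2 + 1)).
have L1 : 0 < L ^+ 2 + 1 by rewrite ltr_wpDl// sqr_ge0.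
have e0 : 0 < e by rewrite /e divr_gt0// mulr_gt0.
have [d1 d10 H1] := HP e e0; have [d2 d20 H2] := HQ e e0.
pose del := Num.min d1 d2.
have del0 : 0 < del by rewrite lt_min d10.
have [n Hn] : exists n, L / 2 ^+ n < del.
  have /cvgrPdist_lt/(_ _ del0) : L * (2^-1) ^+ n @[n --> \oo] --> 0.
    rewrite -(mulr0 L); apply: cvgM; first exact: cvg_cst.
    by apply: cvg_expr; rewrite ger0_norm; lra.
  by case=> n _ /(_ n (leqnn n))/=; rewrite sub0r normrN exprVn => /(le_lt_trans (ler_norm _)); exists n.
have wh : w n + h n = L / 2 ^+ n by rewrite /w /h /L -mulrDl.
have [wn hn] := (w_ge0 n, h_ge0 n).
have [/andP[x1 x2] /andP[y1 y2]] := (xn n, yn n).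
have [i1 i2 i3 i4] := sin n.
have small z u : (s n).1 <= z <= (s n).1 + w n -> (s n).2 <= u <= (s n).2 + h n ->
    [/\ `|z - x| < d1, `|u - y| < d1, `|z - x| < d2 & `|u - y| < d2].
  move=> /andP[z1 z2] /andP[u1 u2].
  have /andP[A1 A2] : (`|z - x| < d1) && (`|z - x| < d2).
    by rewrite -lt_min; apply: le_lt_trans Hn; rewrite -wh ler_norml; apply/andP; split; lra.
  have /andP[B1 B2] : (`|u - y| < d1) && (`|u - y| < d2).
    by rewrite -lt_min; apply: le_lt_trans Hn; rewrite -wh ler_norml; apply/andP; split; lra.
  by split.
have := @rectint_local (s n).1 ((s n).1 + w n) (s n).2 ((s n).2 + h n) x y p1 t q2 e
  i1 x1 x2 i2 i3 y1 y2 i4 (ltW e0).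
have -> : (s n).1 + w n - (s n).1 + ((s n).2 + h n - (s n).2) = w n + h n by ring.
rewrite wh -/(sub n (s n)) => H.
have {}H : `|sub n (s n)| <= 2 * e * (L / 2 ^+ n) ^+ 2.
  apply: H => z u zi ui; have [A1 A2 A3 A4] := small z u zi ui.
  - by have := H1 (z - x) (u - y) A1 A2; rewrite !(addrC _ (_ - _)) !subrK.
  - by have := H2 (z - x) (u - y) A3 A4; rewrite !(addrC _ (_ - _)) !subrK.
have := le_trans (sk n) (ler_wpM2l _ H); rewrite exprn_ge0// => /(_ isT).
have -> : 4 ^+ n * (2 * e * (L / 2 ^+ n) ^+ 2) = 2 * e * L ^+ 2.
  have -> : 4 = 2 ^+ 2 :> R by rewrite -natrX.
  rewrite -exprM mulnC exprM; field.
  by rewrite expf_neq0 ?andbT// ?expf_neq0// pnatr_eq0.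
have -> : 2 * e * L ^+ 2 = k / 2 * (L ^+ 2 / (L ^+ 2 + 1)).
  by rewrite /e; field; rewrite gt_eqF.
apply/negP; rewrite -ltNge; apply: (@le_lt_trans _ _ (k / 2)); last lra.
rewrite ler_piMr//; first by lra.
by rewrite ler_pdivrMr// mul1r lerDl.
Qed.

End Rectangle.

(** On the rectangle [[x1, x2] x [c, c + T]] the horizontal sides cancel by periodicity of [P], and
    Goursat's theorem equates the vertical ones. *)
Lemma period_const P Q c T x1 x2 : 0 <= T ->
  (forall x y, x1 <= x <= x2 -> P x (y + T) = P x y) ->
  (forall x y, x1 <= x <= x2 ->
    exists p1 s q2, has_grad P x y p1 s /\ has_grad Q x y s q2) ->
  x1 <= x2 -> segint (Q x1) c (c + T) = segint (Q x2) c (c + T).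
Proof.
move=> T0 pP PQ x12; have cT : c <= c + T by rewrite lerDl.
have /eqP := @goursat P Q x1 x2 c (c + T) (fun x y hx _ => PQ x y hx) x12 cT.
rewrite /rectint (@eq_segint _ _ (fun=> 0)); last by move=> x hx; rewrite pP// subrr.
rewrite segint_cst// mul0r add0r segintB; first by rewrite subr_eq0 => /eqP.
- apply: cont_on_in => y _.
  have [|p1 [s [q2 [_ /has_grad_cont[_ +]]]]] := PQ x2 y _; last exact.
  by rewrite x12 lexx.
- apply: cont_on_in => y _.
  have [|p1 [s [q2 [_ /has_grad_cont[_ +]]]]] := PQ x1 y _; last exact.
  by rewrite x12 lexx.
Qed.

End Goursat.

(** * Trigonometric series and the Poisson kernel *)

(** Comparison with a geometric series; the explicit distance to the limit is what makes later
    limits uniform in the angle. *)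
Lemma cvg_geo_dist (R : realType) (V : completeNormedModType R) (S : nat -> V) (C r : R) :
  0 <= r < 1 -> (forall n, `|S n.+1 - S n| <= C * r ^+ n) ->
  cvgn S /\ forall n, `|limn S - S n| <= C * r ^+ n / (1 - r).
Proof.
move=> /andP[r0 r1] H; have r1' : 0 < 1 - r by rewrite subr_gt0.
have C0 : 0 <= C by have := le_trans (normr_ge0 _) (H 0%N); rewrite expr0 mulr1.
have D n k : `|S (n + k)%N - S n| <= C * r ^+ n / (1 - r).
  (* With the factor [1 - r ^+ k] the bound is the exact geometric sum, so that the induction
     closes. *)
  suff : `|S (n + k)%N - S n| <= C * r ^+ n / (1 - r) * (1 - r ^+ k).
    move=> /le_trans; apply; rewrite ler_piMr//.
      by rewrite divr_ge0 ?(ltW r1')// mulr_ge0// exprn_ge0.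
    by rewrite gerBl exprn_ge0.
  elim: k => [|k IH]; first by rewrite addn0 subrr normr0 expr0 subrr mulr0.
  rewrite addnS; have -> : S (n + k).+1 - S n = (S (n + k).+1 - S (n + k)%N) + (S (n + k)%N - S n).
    by rewrite addrA subrK.
  apply: le_trans (ler_normD _ _) _; apply: le_trans (lerD (H _) IH) _.
  rewrite exprD exprS le_eqVlt; apply/orP; left; apply/eqP; field.
  by rewrite gt_eqF.
have e0 : C * r ^+ n / (1 - r) @[n --> \oo] --> 0.
  rewrite -(mul0r (1 - r)^-1) -(mulr0 C); apply: cvgM; last exact: cvg_cst.
  by apply: cvgM; [exact: cvg_cst|apply: cvg_expr; rewrite ger0_norm].
have cS : cvgn S.
  apply: cauchy_cvg; apply: cauchy_exP => e e_gt0.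
  have /cvgrPdist_lt/(_ _ e_gt0)[N _ HN] := e0.
  exists (S N); exists N => // m /= Nm.
  rewrite -ball_normE /= distrC -(subnKC Nm); apply: le_lt_trans (D _ _) _.
  by have := HN N (leqnn N); rewrite /= sub0r normrN => /(le_lt_trans (ler_norm _)).
split=> // n.
have cB : `|S k - S n| @[k --> \oo] --> `|limn S - S n|.
  by apply: cvg_norm; apply: cvgB => //; exact: cvg_cst.
rewrite -(cvg_lim _ cB)//; apply: limr_le; first by apply/cvg_ex; exists `|limn S - S n|.
by near=> k; rewrite -(@subnKC n k)//; near: k; exists n.
Unshelve. all: by end_near. Qed.

Section TrigSeries.
Variable R : realType.
Implicit Types (c d : nat -> R) (r t : R).

Lemma continuous_unif (fn : nat -> R -> R) (f : R -> R) (e : nat -> R) :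
  (forall n, continuous (fn n)) -> (forall n x, `|f x - fn n x| <= e n) ->
  e @ \oo --> 0 -> continuous f.
Proof.
move=> cfn H e0 x; apply/cvgrPdist_le => eps eps0.
have e3 : 0 < eps / 3 by lra.
have /cvgrPdist_lt/(_ _ e3)[N _ /(_ N (leqnn N))] := e0.
rewrite /= sub0r normrN => /(le_lt_trans (ler_norm _)) eN.
have /cvgrPdist_le/(_ _ e3) := cfn N x.
apply: filterS => y xy.
have -> : f x - f y = (f x - fn N x) + (fn N x - fn N y) - (f y - fn N y) by ring.
apply: le_trans (ler_normB _ _) _.
apply: le_trans (lerD (ler_normD _ _) (H N y)) _.
by have := H N x; lra.
Qed.

(** In polar coordinates [r], [t], the partial sums of a real harmonic function on the disc. Every
    real coordinate of a slice hyperholomorphic function on a slice has this form. *)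
Definition harm c d n r t :=
  \sum_(k < n) r ^+ k * (c k * cos (k%:R * t) + d k * sin (k%:R * t)).

Definition harms c d r t := limn (fun n => harm c d n r t).

Definition coef_bound c d (C : R) := forall k, `|c k| + `|d k| <= C.

Lemma harmS c d n r t : harm c d n.+1 r t =
  harm c d n r t + r ^+ n * (c n * cos (n%:R * t) + d n * sin (n%:R * t)).
Proof. by rewrite /harm big_ord_recr. Qed.

Lemma harm0 c d r t : harm c d 0 r t = 0.
Proof. by rewrite /harm big_ord0. Qed.

Lemma trig_bound (a b t : R) : `|a * cos t + b * sin t| <= `|a| + `|b|.
Proof.
apply: le_trans (ler_normD _ _) _; rewrite !normrM; apply: lerD.
  by apply: ler_piMr => //; exact: cos_max.
by apply: ler_piMr => //; exact: sin_max.
Qed.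

Lemma harm_step c d C r t n : 0 <= r -> coef_bound c d C ->
  `|harm c d n.+1 r t - harm c d n r t| <= C * r ^+ n.
Proof.
move=> r0 H; rewrite harmS addrAC subrr add0r normrM ger0_norm ?exprn_ge0//.
rewrite mulrC ler_wpM2r ?exprn_ge0//.
exact: le_trans (trig_bound _ _ _) (H n).
Qed.

Lemma harms_cvg c d C r t : 0 <= r < 1 -> coef_bound c d C ->
  harm c d n r t @[n --> \oo] --> harms c d r t.
Proof.
move=> r01 H; have r0 : 0 <= r by case/andP: r01.
exact: (@cvg_geo_dist R _ _ C r r01 (fun n => harm_step t n r0 H)).1.
Qed.

Lemma harms_dist c d C r t n : 0 <= r < 1 -> coef_bound c d C ->
  `|harms c d r t - harm c d n r t| <= C * r ^+ n / (1 - r).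
Proof.
move=> r01 H; have r0 : 0 <= r by case/andP: r01.
exact: (@cvg_geo_dist R _ _ C r r01 (fun n => harm_step t n r0 H)).2.
Qed.

Lemma geo_cvg0 (C r : R) : 0 <= r < 1 -> C * r ^+ n / (1 - r) @[n --> \oo] --> 0.
Proof.
move=> /andP[r0 r1]; rewrite -(mul0r (1 - r)^-1) -(mulr0 C); apply: cvgM; last exact: cvg_cst.
by apply: cvgM; [exact: cvg_cst|apply: cvg_expr; rewrite ger0_norm].
Qed.

Lemma cos_mul_continuous (k : R) : continuous (fun t : R => cos (k * t)).
Proof.
move=> t; apply: (@continuous_comp _ _ _ (fun x => k * x) cos).
  by apply: cvgM; [exact: cvg_cst|exact: cvg_id].
exact: continuous_cos.
Qed.

Lemma sin_mul_continuous (k : R) : continuous (fun t : R => sin (k * t)).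
Proof.
move=> t; apply: (@continuous_comp _ _ _ (fun x => k * x) sin).
  by apply: cvgM; [exact: cvg_cst|exact: cvg_id].
exact: continuous_sin.
Qed.

Lemma trig_continuous (a b k : R) : continuous (fun t : R => a * cos (k * t) + b * sin (k * t)).
Proof.
move=> t; apply: cvgD; (apply: cvgM; first exact: cvg_cst);
  [exact: cos_mul_continuous|exact: sin_mul_continuous].
Qed.

Lemma harm_continuous c d n r : continuous (harm c d n r).
Proof.
elim: n => [|n IH].
  rewrite (_ : harm c d 0 r = fun=> 0); last by apply/funext => t; rewrite harm0.
  by move=> t; exact: cvg_cst.
rewrite (_ : harm c d n.+1 r = fun t => harm c d n r t +
    r ^+ n * (c n * cos (n%:R * t) + d n * sin (n%:R * t))); last first.
  by apply/funext => t; rewrite harmS.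
move=> t; apply: cvgD; first exact: IH.
by apply: cvgM; [exact: cvg_cst|exact: trig_continuous].
Qed.

Lemma harms_continuous c d C r : 0 <= r < 1 -> coef_bound c d C ->
  continuous (harms c d r).
Proof.
move=> r01 H; apply: (@continuous_unif (fun n => harm c d n r) _ (fun n => C * r ^+ n / (1 - r))).
- by move=> n; exact: harm_continuous.
- by move=> n x; exact: harms_dist.
- exact: geo_cvg0.
Qed.

Lemma harm_rescale c d n s r t :
  harm (fun k => s ^+ k * c k) (fun k => s ^+ k * d k) n r t = harm c d n (s * r) t.
Proof. by rewrite /harm; apply: eq_bigr => k _; rewrite exprMn; ring. Qed.

Lemma harms_rescale c d s r t :
  harms (fun k => s ^+ k * c k) (fun k => s ^+ k * d k) r t = harms c d (s * r) t.
Proof.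
rewrite /harms; set f := (X in limn X); suff -> : f = fun n => harm c d n (s * r) t by [].
by apply/funext => n; rewrite /f harm_rescale.
Qed.

(** The head is zeroed instead of shifted away, so that the tail keeps its frequencies, its powers
    of [r] and its coefficient bound. *)
Definition tail_seq N c k := if (k < N)%N then 0 else c k.

Lemma tail_bound N c d C : coef_bound c d C -> coef_bound (tail_seq N c) (tail_seq N d) C.
Proof.
move=> H k; rewrite /tail_seq; case: ifP => _ //.
by rewrite normr0 addr0; apply: le_trans (H k); exact: addr_ge0.
Qed.

Lemma harm_tail N c d n r t : (N <= n)%N ->
  harm c d n r t = harm c d N r t + harm (tail_seq N c) (tail_seq N d) n r t.
Proof.
elim: n => [|n IH]; first by rewrite leqn0 => /eqP ->; rewrite !harm0 addr0.
rewrite leq_eqVlt => /predU1P[->|]; last first.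
  rewrite ltnS => Nn; rewrite !harmS IH// /tail_seq ltnNge Nn/= addrA; congr (_ + _).
rewrite [X in _ + X](_ : _ = 0) ?addr0// /harm big1// => k _.
by rewrite /tail_seq ltn_ord !mul0r addr0 mulr0.
Qed.

Lemma harms_tail N c d C r t : 0 <= r < 1 -> coef_bound c d C ->
  harms c d r t = harm c d N r t + harms (tail_seq N c) (tail_seq N d) r t.
Proof.
move=> r01 H; apply: cvg_lim => //.
have h : harm c d N r t + harm (tail_seq N c) (tail_seq N d) n r t @[n --> \oo] -->
    harm c d N r t + harms (tail_seq N c) (tail_seq N d) r t.
  by apply: cvgD; [exact: cvg_cst|apply: (@harms_cvg _ _ C) => //; exact: tail_bound].
apply: cvg_trans h; apply: near_eq_cvg; exists N => // n /= Nn.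
by rewrite (harm_tail c d r t Nn).
Qed.

Lemma twopi0 : 0 < 2 * pi :> R. Proof. by rewrite mulr_gt0 ?pi_gt0. Qed.

Lemma cos_mul_2pi k t : cos (k%:R * (t + 2 * pi)) = cos (k%:R * t) :> R.
Proof.
rewrite mulrDr (_ : k%:R * (2 * pi) = (pi *+ 2) *+ k); last by rewrite -[RHS]mulr_natl (mulr_natl pi 2).
by rewrite (periodicn (@cosD2pi R)).
Qed.

Lemma sin_mul_2pi k t : sin (k%:R * (t + 2 * pi)) = sin (k%:R * t) :> R.
Proof.
rewrite mulrDr (_ : k%:R * (2 * pi) = (pi *+ 2) *+ k); last by rewrite -[RHS]mulr_natl (mulr_natl pi 2).
by rewrite (periodicn (@sinD2pi R)).
Qed.

Lemma is_derive_cosM (k x : R) : is_derive x 1 (fun y => cos (k * y)) (- k * sin (k * x)).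
Proof.
have := @is_derive_comp_affine R cos (- sin (k * x + 0)) k 0 x (is_derive_cos _).
rewrite addr0 mulrN mulNr; congr is_derive; apply/funext => y; by rewrite addr0.
Qed.

Lemma is_derive_sinM (k x : R) : is_derive x 1 (fun y => sin (k * y)) (k * cos (k * x)).
Proof.
have := @is_derive_comp_affine R sin (cos (k * x + 0)) k 0 x (is_derive_sin _).
rewrite addr0; congr is_derive; apply/funext => y; by rewrite addr0.
Qed.

Lemma segint_trig (a b : R) (A B k : R) : a <= b -> k != 0 ->
  segint (fun t => A * cos (k * t) + B * sin (k * t)) a b =
  (A / k * sin (k * b) - B / k * cos (k * b)) - (A / k * sin (k * a) - B / k * cos (k * a)).
Proof.
move=> ab k0; apply: (@segint_FTC _ _ (fun t => A / k * sin (k * t) - B / k * cos (k * t))) => //.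
  by apply: cont_onT; exact: trig_continuous.
move=> x _; have -> : A * cos (k * x) + B * sin (k * x) =
  A / k * (k * cos (k * x)) - B / k * (- k * sin (k * x)) by field.
by apply: is_deriveB; apply: is_deriveZ; [exact: is_derive_sinM|exact: is_derive_cosM].
Qed.

Lemma segint_trig0 (a A B : R) k : (0 < k)%N ->
  segint (fun t => A * cos (k%:R * t) + B * sin (k%:R * t)) a (a + 2 * pi) = 0.
Proof.
move=> k0; rewrite segint_trig; last 2 first.
- by rewrite lerDl ltW// twopi0.
- by rewrite pnatr_eq0 -lt0n.
by rewrite cos_mul_2pi sin_mul_2pi subrr.
Qed.

(* The mean square over the circle of the [k]-th harmonic. *)
Definition wt c d k : R := if k == 0%N then c 0%N ^+ 2 else (c k ^+ 2 + d k ^+ 2) / 2.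

Lemma wt_ge0 c d k : 0 <= wt c d k.
Proof. by rewrite /wt; case: ifP => _; rewrite ?sqr_ge0// divr_ge0// addr_ge0// sqr_ge0. Qed.

Let term c d k t : R := c k * cos (k%:R * t) + d k * sin (k%:R * t).

Let term_prod c d m n t : (m <= n)%N -> term c d m t * term c d n t =
  ((c m * c n + d m * d n) / 2 * cos ((n - m)%:R * t) +
   (c m * d n - d m * c n) / 2 * sin ((n - m)%:R * t)) +
  ((c m * c n - d m * d n) / 2 * cos ((n + m)%:R * t) +
   (c m * d n + d m * c n) / 2 * sin ((n + m)%:R * t)).
Proof.
move=> mn; rewrite /term natrB// natrD.
rewrite (_ : (n%:R - m%:R) * t = n%:R * t - m%:R * t); last by ring.
rewrite (_ : (n%:R + m%:R) * t = n%:R * t + m%:R * t); last by ring.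
rewrite cosB cosD sinB sinD.
move: (cos _) (sin _) (cos _) (sin _) => *; by field.
Qed.

Let trig_cont a A B k := @cont_onT R _ a (a + 2 * pi) (@trig_continuous A B k).

Let term_orth a c d m n : (m <= n)%N ->
  segint (fun t => term c d m t * term c d n t) a (a + 2 * pi) =
  if m == n then 2 * pi * wt c d n else 0.
Proof.
move=> mn; under [X in segint X]funext do rewrite term_prod//.
rewrite segintD//.
have [->|nm] := eqVneq m n; last first.
  have {}mn : (m < n)%N by rewrite ltn_neqAle nm.
  by rewrite !segint_trig0 ?addr0// ?subn_gt0// addn_gt0 (leq_ltn_trans _ mn)// orbT.
rewrite subnn.
have -> : segint (fun t => (c n * c n + d n * d n) / 2 * cos (0%:R * t) +
  (c n * d n - d n * c n) / 2 * sin (0%:R * t)) a (a + 2 * pi) =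
  2 * pi * ((c n ^+ 2 + d n ^+ 2) / 2).
  under [X in segint X]funext do rewrite mul0r cos0 sin0 mulr1 mulr0 addr0.
  rewrite segint_cst ?lerDl ?ltW ?twopi0//; ring.
rewrite /wt; have [n0|n0] := eqVneq n 0%N; last by rewrite segint_trig0 ?addr0// addn_gt0 lt0n n0.
rewrite n0 addn0.
under [X in segint X]funext do rewrite mul0r cos0 sin0 mulr1 mulr0 addr0.
by rewrite segint_cst ?lerDl ?ltW ?twopi0//; field.
Qed.

Let term_continuous c d k : continuous (term c d k).
Proof. exact: trig_continuous. Qed.

(** By induction: the harmonic of index [n] is orthogonal to the sum of the earlier ones, so the
    squares add up. *)
Lemma parseval_fin c d n r a :
  segint (fun t => harm c d n r t ^+ 2) a (a + 2 * pi) =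
  2 * pi * \sum_(k < n) r ^+ k.*2 * wt c d k.
Proof.
have a2 : a <= a + 2 * pi by rewrite lerDl ltW// twopi0.
have cross N m : (N <= m)%N ->
    segint (fun t => harm c d N r t * term c d m t) a (a + 2 * pi) = 0.
  elim: N => [|N IH] Nm.
    under [X in segint X]funext do rewrite harm0 mul0r.
    by rewrite segint_cst// mul0r.
  under [X in segint X]funext do rewrite harmS mulrDl.
  rewrite segintD ?IH//; last first.
  - apply: cont_onT => t; apply: cvgM; last exact: term_continuous.
    by apply: cvgM; [exact: cvg_cst|exact: term_continuous].
  - by apply: cont_onT => t; apply: cvgM; [exact: harm_continuous|exact: term_continuous].
  - exact: ltnW.
  under [X in segint X]funext do rewrite -mulrA.
  rewrite segintZ; last first.
    by apply: cont_onT => t; apply: cvgM; exact: term_continuous.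
  by rewrite -/(term c d N _) term_orth ?(ltn_eqF Nm) ?mulr0 ?add0r// ltnW.
elim: n => [|n IH].
  under [X in segint X]funext do rewrite harm0 expr0n/=.
  by rewrite segint_cst// mul0r big_ord0 mulr0.
have E t : harm c d n.+1 r t ^+ 2 = harm c d n r t ^+ 2 +
    (2 * r ^+ n * (harm c d n r t * term c d n t) + r ^+ n.*2 * (term c d n t * term c d n t)).
  by rewrite harmS -/(term c d n t) -mul2n mulnC exprM; ring.
under [X in segint X]funext do rewrite E.
have c1 : continuous (fun t => harm c d n r t * term c d n t).
  by move=> t; apply: cvgM; [exact: harm_continuous|exact: term_continuous].
have c2 : continuous (fun t => term c d n t * term c d n t).
  by move=> t; apply: cvgM; exact: term_continuous.
have cZ (k : R) f : continuous f -> cont_on (fun x : R => k * f x : R) a (a + 2 * pi).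
  by move=> cf; apply: cont_onT => t; apply: cvgM; [exact: cvg_cst|exact: cf].
rewrite segintD; last 2 first.
- by apply: cont_onT => t; apply: cvgM; exact: harm_continuous.
- by apply: cont_onD; apply: cZ.
rewrite segintD; [|by apply: cZ..].
rewrite segintZ; last exact: cont_onT.
rewrite segintZ; last exact: cont_onT.
rewrite cross// term_orth// eqxx IH big_ord_recr/= mulrDr mulr0 add0r; ring.
Qed.

Lemma parseval c d C r a : 0 <= r < 1 -> coef_bound c d C ->
  2 * pi * (\sum_(k < n) r ^+ k.*2 * wt c d k) @[n --> \oo] -->
  segint (fun t => harms c d r t ^+ 2) a (a + 2 * pi).
Proof.
move=> r01 H; have C0 : 0 <= C by apply: le_trans (H 0%N); exact: addr_ge0.
have [r0 r1] := andP r01; have r1' : 0 < 1 - r by rewrite subr_gt0.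
under eq_fun do rewrite -(parseval_fin c d _ r a).
pose e n := C * r ^+ n / (1 - r).
(* A difference of squares is [(u - v) * (2 * v + (u - v))]; here [v] is the full sum, of size at
   most [C / (1 - r)]. *)
apply: (@segint_cvg R _ _ (fun n => e n * (2 * (C / (1 - r)) + e n))).
- by rewrite lerDl ltW// twopi0.
- by move=> n; apply: cont_onT => t; apply: cvgM; exact: harm_continuous.
- by apply: cont_onT => t; apply: cvgM; exact: harms_continuous H _.
- move=> n x _; have h1 := harms_dist x n r01 H; rewrite distrC in h1.
  have h2 := harms_dist x 0 r01 H; rewrite harm0 subr0 expr0 mulr1 in h2.
  have -> : harm c d n r x ^+ 2 - harms c d r x ^+ 2 =
    (harm c d n r x - harms c d r x) * (2 * harms c d r x + (harm c d n r x - harms c d r x)) by ring.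
  rewrite normrM; apply: ler_pM => //; apply: le_trans (ler_normD _ _) _.
  by apply: lerD => //; rewrite normrM ger0_norm// ler_pM2l.
- rewrite -(mul0r (2 * (C / (1 - r)) + 0)); apply: cvgM; first exact: geo_cvg0.
  by apply: cvgD; [exact: cvg_cst|exact: geo_cvg0].
Qed.

Lemma parseval_le c d C r a (W : R) : 0 <= r < 1 -> coef_bound c d C ->
  (forall n, \sum_(k < n) wt c d k <= W) ->
  segint (fun t => harms c d r t ^+ 2) a (a + 2 * pi) <= 2 * pi * W.
Proof.
move=> r01 H HW; have := parseval (a := a) r01 H => cv.
rewrite -(cvg_lim _ cv)//; apply: limr_le; first by apply/cvg_ex; eexists; exact: cv.
apply: nearW => n; rewrite ler_pM2l ?twopi0//; apply: le_trans (HW n).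
apply: ler_sum => k _; rewrite ler_piMl ?wt_ge0//.
by case/andP: r01 => r0 /ltW r1; rewrite exprn_ile1.
Qed.

End TrigSeries.

(** * The Poisson kernel and its maximal inequality *)

Section Poisson.
Variable R : realType.
Implicit Types (r t a b : R).

(** [pden r t] is the squared distance from [1] to [r exp (i t)], [pois] is the Poisson kernel, and
    [pker n] is the partial sum of degree [n] of its Fourier series. *)
Definition pden r t : R := 1 - 2 * r * cos t + r ^+ 2.
Definition pois r t : R := (1 - r ^+ 2) / pden r t.
Definition pker n r t : R := 1 + 2 * \sum_(k < n) r ^+ k.+1 * cos (k.+1%:R * t).

Lemma pden_ge r t : 0 <= r -> (1 - r) ^+ 2 <= pden r t.
Proof.
move=> r0; rewrite -subr_ge0 (_ : _ - _ = 2 * r * (1 - cos t)); last by rewrite /pden; ring.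
by rewrite mulr_ge0 ?mulr_ge0// subr_ge0 cos_le1.
Qed.

Lemma pden_gt0 r t : 0 <= r < 1 -> 0 < pden r t.
Proof.
move=> /andP[r0 r1]; apply: lt_le_trans (pden_ge t r0).
by rewrite exprn_gt0// subr_gt0.
Qed.

Lemma onem_sqr_ge0 r : 0 <= r < 1 -> 0 <= 1 - r ^+ 2.
Proof. by move=> /andP[r0 r1]; rewrite subr_ge0 exprn_ile1// ltW. Qed.

Lemma pois_ge0 r t : 0 <= r < 1 -> 0 <= pois r t.
Proof. by move=> r01; rewrite divr_ge0 ?onem_sqr_ge0// ltW// pden_gt0. Qed.

Lemma pois_le r t : 0 <= r < 1 -> pois r t <= (1 - r ^+ 2) / (1 - r) ^+ 2.
Proof.
move=> r01; have [r0 r1] := andP r01; rewrite ler_wpM2l ?onem_sqr_ge0// lef_pV2 ?pden_ge//.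
  by rewrite posrE pden_gt0.
by rewrite posrE exprn_gt0// subr_gt0.
Qed.

Lemma pkerS n r t :
  pker n.+1 r t = pker n r t + 2 * r ^+ n.+1 * cos (n.+1%:R * t).
Proof. by rewrite /pker big_ord_recr/= mulrDr addrA mulrA. Qed.

(** Multiplication by the denominator telescopes the Fourier sum; the two last terms are the
    remainder that [pker_dist] estimates. *)
Lemma pden_pker n r t : pden r t * pker n r t =
  1 - r ^+ 2 - 2 * r ^+ n.+1 * cos (n.+1%:R * t) + 2 * r ^+ n.+2 * cos (n%:R * t).
Proof.
elim: n => [|n IH].
  by rewrite /pker big_ord0 mul1r mul0r cos0 /pden; ring.
rewrite pkerS mulrDr IH /pden.
have -> : n.+2%:R * t = n.+1%:R * t + t by rewrite -addn1 natrD; ring.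
have -> : n%:R * t = n.+1%:R * t - t by rewrite -(addn1 n) natrD; ring.
rewrite cosB cosD !exprS; ring.
Qed.

Lemma pker_dist n r t : 0 <= r < 1 ->
  `|pker n r t - pois r t| <= 4 / (1 - r) * r ^+ n / (1 - r).
Proof.
move=> r01; have [r0 r1] := andP r01.
have p0 := pden_gt0 t r01.
have -> : pker n r t - pois r t =
  (- 2 * r ^+ n.+1 * cos (n.+1%:R * t) + 2 * r ^+ n.+2 * cos (n%:R * t)) / pden r t.
  apply: (mulfI (lt0r_neq0 p0)); rewrite mulrBr pden_pker /pois.
  by field; exact: lt0r_neq0.
rewrite normrM normfV (gtr0_norm p0) ler_pdivrMr//.
apply: le_trans (ler_normD _ _) _; rewrite !normrM normrN (ger0_norm (ltW (_ : 0 < 2)))//.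
rewrite !normrX (ger0_norm r0).
have rn : 0 <= r ^+ n by exact: exprn_ge0.
have c1 := cos_max (n.+1%:R * t); have c2 := cos_max (n%:R * t).
apply: (@le_trans _ _ (4 * r ^+ n)).
  rewrite !exprS.
  have h1 : 2 * (r * r ^+ n) * `|cos (n.+1%:R * t)| <= 2 * r ^+ n.
    rewrite -mulrA ler_pM2l// -[leRHS]mulr1 ler_pM// ?mulr_ge0//.
    by rewrite ler_piMl// ltW.
  have h2 : 2 * (r * (r * r ^+ n)) * `|cos (n%:R * t)| <= 2 * r ^+ n.
    rewrite -mulrA ler_pM2l// -[leRHS]mulr1 ler_pM// ?mulr_ge0//.
    rewrite mulrA ler_piMl// -expr2 exprn_ile1// ltW//.
  by lra.
have -> : 4 / (1 - r) * r ^+ n / (1 - r) = 4 * r ^+ n * ((1 - r) ^+ 2)^-1.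
  by field; rewrite subr_eq0 gt_eqF.
rewrite -(mulrA (4 * r ^+ n)); apply: ler_peMr; first by rewrite mulr_ge0.
rewrite mulrC ler_pdivlMr ?mul1r ?pden_ge//.
by rewrite exprn_gt0// subr_gt0.
Qed.

Lemma is_derive_pois r t : 0 <= r < 1 ->
  is_derive t 1 (pois r) (- ((1 - r ^+ 2) * (2 * r * sin t)) / pden r t ^+ 2).
Proof.
move=> r01; have p0 := lt0r_neq0 (pden_gt0 t r01).
have dd : is_derive t 1 (pden r) (2 * r * sin t).
  have dc : is_derive t 1 (fun t => 2 * r * cos t) (2 * r * - sin t).
    exact: (is_deriveZ (2 * r) (is_derive_cos t)).
  have -> : 2 * r * sin t = 0 - (2 * r) * (- sin t) + 0 by ring.
  exact: is_deriveD.
have -> : - ((1 - r ^+ 2) * (2 * r * sin t)) / pden r t ^+ 2 =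
  (1 - r ^+ 2) * (- (pden r t) ^- 2 *: (2 * r * sin t)).
  by rewrite /GRing.scale/=; field.
apply: (@is_deriveZ _ _ _ (fun t => (pden r t)^-1) (1 - r ^+ 2) t 1).
Qed.

Lemma pois_continuous r : 0 <= r < 1 -> continuous (pois r).
Proof.
move=> r01 t; have dt := is_derive_pois t r01.
by apply: differentiable_continuous; apply/derivable1_diffP; exact: (@ex_derive _ _ _ _ _ _ _ dt).
Qed.

Lemma poisB_continuous r t : 0 <= r < 1 -> continuous (fun y => pois r (y - t)).
Proof.
move=> r01 y; apply: (@continuous_comp _ _ _ (fun y => y - t) (pois r)); last exact: pois_continuous.
by apply: cvgB; [exact: cvg_id|exact: cvg_cst].
Qed.

Lemma cosB_continuous (k t : R) : continuous (fun y => cos (k * (y - t))).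
Proof.
move=> y; apply: (@continuous_comp _ _ _ (fun y => y - t) (fun z => cos (k * z))); last exact: cos_mul_continuous.
by apply: cvgB; [exact: cvg_id|exact: cvg_cst].
Qed.

Lemma pkerB_continuous n r t : continuous (fun y => pker n r (y - t)).
Proof.
elim: n => [|n IH].
  rewrite (_ : (fun _ => _) = fun=> 1); last by apply/funext => y; rewrite /pker big_ord0 mulr0 addr0.
  by move=> y; exact: cvg_cst.
rewrite (_ : (fun _ => _) = fun y => pker n r (y - t) + 2 * r ^+ n.+1 * cos (n.+1%:R * (y - t))).
  by move=> y; apply: cvgD; [exact: IH|apply: cvgM; [exact: cvg_cst|exact: cosB_continuous]].
by apply/funext => y; rewrite pkerS.
Qed.

Section Window.
Variables (a b t : R).
(** Orthogonality of the cosines only needs all sines to vanish at both ends. This covers the full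
    period around [t] and also the half period [[0, pi]] for [t = 0]. *)
Hypotheses (ab : a <= b) (sa : forall m, sin (m%:R * (a - t)) = 0)
  (sb : forall m, sin (m%:R * (b - t)) = 0).

Let cosint k : segint (fun y => cos (k%:R * (y - t))) a b = if k == 0%N then b - a else 0.
Proof.
case: k => [|k].
  under [X in segint X]funext do rewrite mul0r cos0.
  by rewrite segint_cst// mul1r.
have k0 : k.+1%:R != 0 :> R by rewrite pnatr_eq0.
have dF (x : R) : is_derive x 1 (fun y => k.+1%:R^-1 * sin (k.+1%:R * (y - t))) (cos (k.+1%:R * (x - t))).
  have -> : cos (k.+1%:R * (x - t)) = k.+1%:R^-1 * (k.+1%:R * cos (k.+1%:R * x + - (k.+1%:R * t))).
    by rewrite mulKf// mulrBr.
  apply: is_deriveZ.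
  have := @is_derive_comp_affine R sin _ k.+1%:R (- (k.+1%:R * t)) x (is_derive_sin _).
  by congr is_derive; apply/funext => y; rewrite mulrBr.
have cc := @cosB_continuous k.+1%:R t.
by rewrite (segint_FTC ab (cont_onT cc) (fun x _ => dF x)) sa sb subrr.
Qed.

Let cc_continuous (m n : R) : continuous (fun y => cos (m * (y - t)) * cos (n * (y - t))).
Proof. by move=> y; apply: cvgM; exact: cosB_continuous. Qed.

Lemma cos_orth m n : segint (fun y => cos (m%:R * (y - t)) * cos (n%:R * (y - t))) a b =
  if m == n then (if n == 0%N then b - a else (b - a) / 2) else 0.
Proof.
wlog mn : m n / (m <= n)%N.
  move=> H; have [/H //|/ltnW /H E] := leqP m n.
  transitivity (segint (fun y => cos (n%:R * (y - t)) * cos (m%:R * (y - t))) a b).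
    by apply: eq_segint => y _; rewrite mulrC.
  by rewrite E eq_sym; case: eqP => // ->.
have E y : cos (m%:R * (y - t)) * cos (n%:R * (y - t)) =
  2^-1 * cos ((n - m)%:R * (y - t)) + 2^-1 * cos ((n + m)%:R * (y - t)).
  by rewrite natrB// natrD (mulrBl (y - t)) (mulrDl n%:R) cosB cosD; field.
rewrite (eq_segint (fun y _ => E y)).
have cZ (k : R) (l : nat) : cont_on (fun y : R => k * cos (l%:R * (y - t)) : R) a b.
  by apply: cont_onT => y; apply: cvgM; [exact: cvg_cst|exact: cosB_continuous].
rewrite segintD// !segintZ; try by apply: cont_onT; exact: cosB_continuous.
rewrite !cosint subn_eq0 addn_eq0.
have [->|nm] := eqVneq m n.
  by rewrite leqnn andbb; case: eqP => _; field.
have {}mn : (m < n)%N by rewrite ltn_neqAle nm.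
by rewrite leqNgt mn /= (gtn_eqF (leq_ltn_trans (leq0n m) mn)) /= !mulr0 addr0.
Qed.

Lemma pker_mult N n r :
  segint (fun y => pker N r (y - t) * cos (n%:R * (y - t))) a b =
  (b - a) * (if (n <= N)%N then r ^+ n else 0).
Proof.
elim: N => [|N IH].
  rewrite (@eq_segint _ _ (fun y => cos (0%:R * (y - t)) * cos (n%:R * (y - t)))).
    by rewrite cos_orth leqn0 eq_sym; case: eqP => [->|_]; rewrite ?expr0 ?mulr1 ?mulr0.
  by move=> y _; rewrite /pker big_ord0 mul0r cos0 mulr0 addr0.
rewrite (@eq_segint _ _ (fun y => pker N r (y - t) * cos (n%:R * (y - t)) +
  2 * r ^+ N.+1 * (cos (N.+1%:R * (y - t)) * cos (n%:R * (y - t))))); last first.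
  by move=> y _; rewrite pkerS; ring.
rewrite segintD; last 2 first.
- by apply: cont_onT => y; apply: cvgM; [exact: pkerB_continuous|exact: cosB_continuous].
- by apply: cont_onT => y; apply: cvgM; [exact: cvg_cst|exact: cc_continuous].
rewrite IH segintZ; last exact: cont_onT.
rewrite cos_orth [(n <= N.+1)%N]leq_eqVlt ltnS (eq_sym n); have [<-|] := eqVneq N.+1 n.
  by rewrite orTb ltnn mulr0 add0r /=; field.
by rewrite mulr0 addr0.
Qed.

Lemma segint_pker_cvg r (U : R -> R) : 0 <= r < 1 -> continuous U ->
  segint (fun y => pker n r (y - t) * U y) a b @[n --> \oo] -->
  segint (fun y => pois r (y - t) * U y) a b.
Proof.
move=> r01 cU.
have [M HM] : exists M, forall x, a <= x <= b -> `|U x| <= M.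
  have [m _ Hm] := EVT_max ab (cont_on_norm (cont_onT cU)).
  by exists `|U m| => x xab; apply: Hm; rewrite in_itv.
apply: (@segint_cvg R _ _ (fun n => 4 / (1 - r) * r ^+ n / (1 - r) * M)) => //.
- by move=> n; apply: cont_onT => y; apply: cvgM; [exact: pkerB_continuous|exact: cU].
- by apply: cont_onT => y; apply: cvgM; [exact: poisB_continuous|exact: cU].
- move=> n x xab; rewrite -mulrBl normrM ler_pM//; first exact: pker_dist.
  exact: HM.
- by rewrite -(mul0r M); apply: cvgM; [exact: geo_cvg0|exact: cvg_cst].
Qed.

(** For [N >= n] the partial sum [pker N] already gives the exact value, so the sequence is
    eventually constant. *)
Lemma pois_mult n r : 0 <= r < 1 ->
  segint (fun y => pois r (y - t) * cos (n%:R * (y - t))) a b = (b - a) * r ^+ n.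
Proof.
move=> r01; have h := segint_pker_cvg r01 (@cosB_continuous n%:R t).
rewrite -(cvg_lim _ h)//; apply: cvg_lim => //.
have : (fun=> (b - a) * r ^+ n) @ \oo --> (b - a) * r ^+ n by exact: cvg_cst.
apply: cvg_trans; apply: near_eq_cvg; exists n => // N /= nN.
by rewrite pker_mult nN.
Qed.

Lemma pois_int r : 0 <= r < 1 -> segint (fun y => pois r (y - t)) a b = b - a.
Proof.
move=> r01; have := pois_mult 0 r01; rewrite expr0 mulr1 => <-.
by apply: eq_segint => y _; rewrite mul0r cos0 mulr1.
Qed.

End Window.

Lemma sin_mulpi m : sin (m%:R * pi) = 0 :> R.
Proof.
elim: m => [|m IH]; first by rewrite mul0r sin0.
by rewrite -addn1 natrD mulrDl mul1r sinDpi IH oppr0.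
Qed.

Section HalfWindow.

Let s0 m : sin (m%:R * (0 - 0)) = 0 :> R. Proof. by rewrite subrr mulr0 sin0. Qed.
Let spi m : sin (m%:R * (pi - 0)) = 0 :> R. Proof. by rewrite subr0 sin_mulpi. Qed.
Let p0 : 0 <= pi :> R. Proof. exact: pi_ge0. Qed.

Lemma pois_mult_half n r : 0 <= r < 1 ->
  segint (fun y => pois r y * cos (n%:R * y)) 0 pi = pi * r ^+ n.
Proof.
move=> r01; have := @pois_mult 0 pi 0 p0 s0 spi n r r01; rewrite subr0 => <-.
by apply: eq_segint => y _; rewrite subr0.
Qed.

Lemma pois_int_half r : 0 <= r < 1 -> segint (pois r) 0 pi = pi.
Proof.
move=> r01; have := pois_mult_half 0 r01; rewrite expr0 mulr1 => E; rewrite -[RHS]E.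
by apply: eq_segint => y _; rewrite mul0r cos0 mulr1.
Qed.

Lemma pois_harm c d N r rho theta : 0 <= r < 1 ->
  segint (fun s => pois r s * (harm c d N rho (theta + s) + harm c d N rho (theta - s))) 0 pi =
  2 * pi * harm c d N (r * rho) theta.
Proof.
move=> r01; elim: N => [|N IH].
  rewrite harm0 mulr0 (@eq_segint _ _ (fun=> 0)) ?segint_cst ?mul0r//.
  by move=> s _; rewrite !harm0 addr0 mulr0.
pose A := rho ^+ N * 2 * (c N * cos (N%:R * theta) + d N * sin (N%:R * theta)).
rewrite (@eq_segint _ _ (fun s => pois r s * (harm c d N rho (theta + s) + harm c d N rho (theta - s)) +
  A * (pois r s * cos (N%:R * s)))); last first.
  move=> s _; rewrite !harmS /A (mulrDr N%:R) (mulrBr N%:R) cosD cosB sinD sinB; ring.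
rewrite segintD; last 2 first.
- apply: cont_onT => s; apply: cvgM; first exact: pois_continuous.
  apply: cvgD.
    apply: (@continuous_comp _ _ _ (fun s => theta + s) (harm c d N rho)); last exact: harm_continuous.
    by apply: cvgD; [exact: cvg_cst|exact: cvg_id].
  apply: (@continuous_comp _ _ _ (fun s => theta - s) (harm c d N rho)); last exact: harm_continuous.
  by apply: cvgB; [exact: cvg_cst|exact: cvg_id].
- apply: cont_onT => s; apply: cvgM; first exact: cvg_cst.
  by apply: cvgM; [exact: pois_continuous|exact: cos_mul_continuous].
rewrite IH segintZ; last first.
  by apply: cont_onT => s; apply: cvgM; [exact: pois_continuous|exact: cos_mul_continuous].
by rewrite pois_mult_half// harmS /A exprMn; ring.
Qed.

Lemma comp_addl_continuous (g : R -> R) theta : continuous g -> continuous (fun s => g (theta + s)).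
Proof.
move=> cg s; apply: (@continuous_comp _ _ _ (fun s => theta + s) g); last exact: cg.
by apply: cvgD; [exact: cvg_cst|exact: cvg_id].
Qed.

Lemma comp_subl_continuous (g : R -> R) theta : continuous g -> continuous (fun s => g (theta - s)).
Proof.
move=> cg s; apply: (@continuous_comp _ _ _ (fun s => theta - s) g); last exact: cg.
by apply: cvgB; [exact: cvg_cst|exact: cvg_id].
Qed.

Lemma pois_harms c d C r rho theta : 0 <= r < 1 -> 0 <= rho < 1 -> coef_bound c d C ->
  segint (fun s => pois r s * (harms c d rho (theta + s) + harms c d rho (theta - s))) 0 pi =
  2 * pi * harms c d (r * rho) theta.
Proof.
move=> r01 rho01 H.
have rr : 0 <= r * rho < 1.
  have [[r0 r1] [q0 q1]] := (andP r01, andP rho01).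
  by rewrite mulr_ge0//= mulr_ilt1.
have l1 : 2 * pi * harm c d N (r * rho) theta @[N --> \oo] --> 2 * pi * harms c d (r * rho) theta.
  by apply: cvgM; [exact: cvg_cst|exact: harms_cvg H].
have h1 : harms c d rho = harms c d rho by [].
have ch := @harms_continuous R c d C rho rho01 H.
have chn n := @harm_continuous R c d n rho.
rewrite -(cvg_lim _ l1)//; apply/esym/cvg_lim => //.
under eq_fun do rewrite -pois_harm//.
pose B := (1 - r ^+ 2) / (1 - r) ^+ 2.
pose e n := C * rho ^+ n / (1 - rho).
apply: (@segint_cvg R _ _ (fun n => B * (e n + e n))) => //.
- move=> n; apply: cont_onT => s; apply: cvgM; first exact: pois_continuous.
  by apply: cvgD; [exact: comp_addl_continuous|exact: comp_subl_continuous].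
- apply: cont_onT => s; apply: cvgM; first exact: pois_continuous.
  by apply: cvgD; [exact: comp_addl_continuous|exact: comp_subl_continuous].
- move=> n s _; rewrite -mulrBr normrM ler_pM//.
    by rewrite ger0_norm ?pois_ge0// pois_le.
  rewrite opprD addrACA; apply: le_trans (ler_normD _ _) _.
  by apply: lerD; rewrite distrC; exact: harms_dist.
- rewrite -(mulr0 B) -[X in _ --> B * X]addr0; apply: cvgM; first exact: cvg_cst.
  by apply: cvgD; exact: geo_cvg0.
Qed.

(* With [A h] the integral of [g] over the interval of radius [h] around
   [theta], [2 M h - A h] is nonnegative and vanishes at [0]; integrating by
   parts against the decreasing kernel keeps the sign. *)
Lemma pois_maximal (g : R -> R) r theta (M : R) : 0 <= r < 1 -> continuous g ->
  (forall h, 0 <= h <= pi -> segint g (theta - h) (theta + h) <= 2 * h * M) ->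
  segint (fun s => pois r s * (g (theta + s) + g (theta - s))) 0 pi <= 2 * pi * M.
Proof.
move=> r01 cg HM; have [G dG] := ex_primitive cg.
have r0 : 0 <= r by case/andP: r01.
pose B h := 2 * M * h - (G (theta + h) - G (theta - h)).
pose B' h := 2 * M - (g (theta + h) + g (theta - h)).
have dB (h : R) : is_derive h 1 B (B' h).
  have d1 : is_derive h 1 (fun h => G (theta + h)) (g (theta + h)).
    have := @is_derive_comp_affine R G (g (1 * h + theta)) 1 theta h (dG _).
    rewrite !mul1r (addrC h); congr is_derive; apply/funext => y; by rewrite mul1r addrC.
  have d2 : is_derive h 1 (fun h => G (theta - h)) (- g (theta - h)).
    have := @is_derive_comp_affine R G (g (- 1 * h + theta)) (- 1) theta h (dG _).
    rewrite !mulN1r (addrC (- h)); congr is_derive; apply/funext => y; by rewrite mulN1r addrC.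
  have -> : B' h = 2 * M * 1 - (g (theta + h) - - g (theta - h)) by rewrite /B'; ring.
  exact: is_deriveB.
have B0 h : 0 <= h <= pi -> 0 <= B h.
  move=> hp; rewrite subr_ge0; have := HM h hp.
  have hh : theta - h <= theta + h by rewrite lerD2l; case/andP: hp => h0 _; rewrite (le_trans _ h0)// oppr_le0.
  by rewrite (segint_FTC hh (cont_onT cg) (fun x _ => dG x)) (mulrAC 2).
pose p' t := - ((1 - r ^+ 2) * (2 * r * sin t)) / pden r t ^+ 2.
have cpden : continuous (pden r).
  move=> s; apply: cvgD; last exact: cvg_cst.
  by apply: cvgB; [exact: cvg_cst|apply: cvgM; [exact: cvg_cst|exact: continuous_cos]].
have cp' : continuous p'.
  move=> s; apply: cvgM.
    apply: cvgN; apply: cvgM; first exact: cvg_cst.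
    by apply: cvgM; [exact: cvg_cst|exact: continuous_sin].
  apply: cvgV; first by rewrite expf_neq0// lt0r_neq0// pden_gt0.
  by apply: cvgM; exact: cpden.
have cB : continuous B by move=> h; exact: (is_derive_continuous (dB h)).
have cB' : continuous B'.
  move=> h; apply: cvgB; first exact: cvg_cst.
  by apply: cvgD; [exact: comp_addl_continuous|exact: comp_subl_continuous].
have cpois := pois_continuous r01.
have dP (h : R) : is_derive h 1 (fun h => pois r h * B h) (p' h * B h + pois r h * B' h).
  have -> : p' h * B h + pois r h * B' h = pois r h *: B' h + B h *: p' h.
    by rewrite /GRing.scale/=; ring.
  by apply: is_deriveM; exact: is_derive_pois.
have cpB : continuous (fun h => p' h * B h) by move=> h; apply: cvgM; [exact: cp'|exact: cB].
have cpB' : continuous (fun h => pois r h * B' h) by move=> h; apply: cvgM; [exact: cpois|exact: cB'].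
have FT := @segint_FTC R (fun h => p' h * B h + pois r h * B' h)
  (fun h => pois r h * B h) 0 pi p0 (cont_onD (cont_onT cpB) (cont_onT cpB')) (fun x _ => dP x).
rewrite segintD in FT; [|exact: cont_onT..].
have B00 : B 0 = 0 by rewrite /B addr0 subr0 subrr mulr0 subrr.
rewrite B00 mulr0 subr0 in FT.
have I1 : segint (fun h => p' h * B h) 0 pi <= 0.
  rewrite -oppr_ge0 -mulN1r -segintZ; last exact: cont_onT.
  apply: segint_ge0 => h hp; rewrite mulN1r -mulNr mulr_ge0 ?B0//.
  rewrite /p' mulNr opprK divr_ge0//; last by rewrite exprn_ge0// ltW// pden_gt0.
  by rewrite mulr_ge0 ?onem_sqr_ge0// mulr_ge0 ?mulr_ge0// sin_ge0_pi.
have I2 : 0 <= pois r pi * B pi by rewrite mulr_ge0 ?pois_ge0// B0// p0 lexx.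
have cgg : continuous (fun s => pois r s * (g (theta + s) + g (theta - s))).
  move=> s; apply: cvgM; first exact: cpois.
  by apply: cvgD; [exact: comp_addl_continuous|exact: comp_subl_continuous].
have E : segint (fun h => pois r h * B' h) 0 pi = 2 * M * pi -
    segint (fun s => pois r s * (g (theta + s) + g (theta - s))) 0 pi.
  rewrite -{2}(pois_int_half r01) -segintZ; last exact: cont_onT.
  rewrite -segintB; last 2 first.
  - by apply: cont_onT => s; apply: cvgM; [exact: cvg_cst|exact: cpois].
  - exact: cont_onT.
  by apply: eq_segint => s _; rewrite /B'; ring.
by rewrite E in FT; lra.
Qed.

(** The Poisson integral of [harms c d rho] is dominated by that of its absolute value, to which
    [pois_maximal] applies. The bound is free of [r]: averages on one circle control all smaller
    radii. *)
Lemma harms_maximal c d C r rho theta (M : R) : 0 <= r < 1 -> 0 <= rho < 1 -> coef_bound c d C ->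
  (forall h, 0 <= h <= pi ->
    segint (fun s => `|harms c d rho s|) (theta - h) (theta + h) <= 2 * h * M) ->
  `|harms c d (r * rho) theta| <= M.
Proof.
move=> r01 rho01 H HM.
have ch := @harms_continuous R c d C rho rho01 H.
have cn : continuous (fun s => `|harms c d rho s|) by move=> s; apply: cvg_norm; exact: ch.
have h2 := pois_maximal r01 cn HM.
rewrite -(ler_pM2l (twopi0 R)); apply: le_trans h2.
rewrite -[X in X * `|_|]gtr0_norm ?twopi0// -normrM -(pois_harms _ r01 rho01 H).
have c1 : continuous (fun s => pois r s * (harms c d rho (theta + s) + harms c d rho (theta - s))).
  move=> s; apply: cvgM; first exact: pois_continuous.
  by apply: cvgD; [exact: comp_addl_continuous|exact: comp_subl_continuous].
apply: le_trans (segint_norm (cont_onT c1)) _.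
apply: le_segint.
- exact: cont_on_norm (cont_onT c1).
- apply: cont_onT => s; apply: cvgM; first exact: pois_continuous.
  by apply: cvgD; [exact: (comp_addl_continuous cn)|exact: (comp_subl_continuous cn)].
- by move=> s _; rewrite normrM ger0_norm ?pois_ge0// ler_wpM2l ?pois_ge0// ler_normD.
Qed.

End HalfWindow.

End Poisson.

(** * Abel summation of a Fourier series *)

Section FourierSeries.
Variable R : realType.
Variables (U : R -> R) (t : R).
Hypothesis cU : continuous U.

Let a := t - pi.
Let b := t + pi.
Let ab : a <= b. Proof. by rewrite /a /b; have := pi_ge0 R; lra. Qed.
Let ba : b - a = 2 * pi. Proof. by rewrite /a /b; ring. Qed.
Let sa m : sin (m%:R * (a - t)) = 0 :> R.
Proof. by rewrite (_ : _ * _ = - (m%:R * pi)) ?sinN ?sin_mulpi ?oppr0// /a; ring. Qed.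
Let sb m : sin (m%:R * (b - t)) = 0 :> R.
Proof. by rewrite (_ : _ * _ = m%:R * pi) ?sin_mulpi// /b; ring. Qed.

Lemma cos_lt1_away (del x : R) : 0 < del -> del <= `|x| <= pi -> cos x <= cos (Num.min del pi).
Proof.
move=> d0 /andP[dx xp].
have im : Num.min del pi \in `[0, pi]%R.
  by rewrite in_itv/= le_min (ltW d0) pi_ge0 ge_min lexx orbT.
have ix : `|x| \in `[0, pi]%R by rewrite in_itv/= normr_ge0.
have -> : cos x = cos `|x|.
  by have [x0|x0] := leP 0 x; [rewrite ger0_norm|rewrite ltr0_norm// cosN].
by rewrite leNgt ltr_cos// -leNgt ge_min dx.
Qed.

(** Near [t] continuity gives [e]; away from [t] the function [1 - cos] is bounded below by a
    positive constant, and a large [K] absorbs the bound of [U]. *)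
Lemma korovkin_bound (e : R) : 0 < e -> exists2 K, 0 <= K & forall y, a <= y <= b ->
  `|U y - U t| <= e + K * (1 - cos (y - t)).
Proof.
move=> e0; have /cvgrPdist_le/(_ _ e0)[del /= del0 Hdel] := cU (x := t).
have [M HM] : exists M, forall y, a <= y <= b -> `|U y - U t| <= M.
  have cUt : continuous (fun y => U y - U t) by move=> y; apply: cvgB; [exact: cU|exact: cvg_cst].
  have [m _ Hm] := EVT_max ab (cont_on_norm (cont_onT cUt)).
  by exists `|U m - U t| => y yab; apply: Hm; rewrite in_itv.
have M0 : 0 <= M.
  apply: le_trans (HM t _) => //.
  by rewrite /a /b; have := pi_ge0 R; move=> ?; apply/andP; split; lra.
pose d' := Num.min del pi.
have d'0 : 0 < d' by rewrite lt_min del0 pi_gt0.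
have c1 : 0 < 1 - cos d'.
  rewrite subr_gt0 -cos0 ltr_cos// ?in_itv/= ?lexx ?pi_ge0//.
  by rewrite ltW// ge_min lexx orbT.
exists (M / (1 - cos d')); first by rewrite divr_ge0// ltW.
move=> y yab; have [yd|yd] := ltP `|y - t| del.
  have h : `|U y - U t| <= e by rewrite distrC; apply: Hdel; rewrite /ball_/= distrC.
  by apply: le_trans h _; rewrite lerDl mulr_ge0 ?divr_ge0 ?(ltW c1)// subr_ge0 cos_le1.
apply: le_trans (HM y yab) _; apply: ler_wpDl; first exact: ltW.
rewrite -mulrA ler_peMr// ler_pdivlMl// mulr1 lerD2l lerN2.
apply: cos_lt1_away => //; rewrite yd /=.
by move: yab; rewrite /a /b => /andP[? ?]; rewrite ler_norml; apply/andP; split; lra.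
Qed.

(** Korovkin's argument: the Poisson integral of the test function [1 - cos (y - t)] is exactly
    [2 * pi * (1 - r)], so that the concentration of the kernel at [t] needs no separate
    estimate. *)
Lemma korovkin (e : R) : 0 < e -> exists2 K, 0 <= K & forall r, 0 <= r < 1 ->
  `|segint (fun y => pois r (y - t) * U y) a b - 2 * pi * U t| <= 2 * pi * (e + K * (1 - r)).
Proof.
move=> e0; have [K K0 HK] := korovkin_bound e0; exists K => // r r01.
have cp := @poisB_continuous R r t r01.
have cc : continuous (fun y => pois r (y - t) * cos (y - t)).
  move=> y; apply: cvgM; first exact: cp.
  apply: (@continuous_comp _ _ _ (fun y => y - t) cos); last exact: continuous_cos.
  by apply: cvgB; [exact: cvg_id|exact: cvg_cst].
have cpU : continuous (fun y => pois r (y - t) * U y).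
  by move=> y; apply: cvgM; [exact: cp|exact: cU].
have Zc (k : R) (f : R -> R) : continuous f -> cont_on (fun y => k * f y) a b.
  by move=> cf; apply: cont_onT => y; apply: cvgM; [exact: cvg_cst|exact: cf].
have I0 : segint (fun y => pois r (y - t)) a b = 2 * pi by rewrite pois_int.
have I1 : segint (fun y => pois r (y - t) * cos (y - t)) a b = 2 * pi * r.
  have := pois_mult ab sa sb 1 r01; rewrite expr1 ba => <-.
  by apply: eq_segint => y _; rewrite mul1r.
have -> : segint (fun y => pois r (y - t) * U y) a b - 2 * pi * U t =
    segint (fun y => pois r (y - t) * U y - U t * pois r (y - t)) a b.
  rewrite segintB; [|exact: cont_onT|exact: Zc].
  by rewrite segintZ; [rewrite I0 mulrC|exact: cont_onT].
have cd : cont_on (fun y => pois r (y - t) * U y - U t * pois r (y - t)) a b.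
  by apply: cont_onB; [exact: cont_onT|exact: Zc].
apply: le_trans (segint_norm cd) _.
have -> : 2 * pi * (e + K * (1 - r)) =
    segint (fun y => (e + K) * pois r (y - t) - K * (pois r (y - t) * cos (y - t))) a b.
  rewrite segintB; [|exact: Zc|exact: Zc].
  rewrite (segintZ _ (cont_onT cp)) (segintZ _ (cont_onT cc)) I0 I1; ring.
apply: le_segint; [exact: cont_on_norm|by apply: cont_onB; exact: Zc|].
move=> y yab; rewrite (mulrC (U t)) -mulrBr normrM ger0_norm ?pois_ge0//.
have -> : (e + K) * pois r (y - t) - K * (pois r (y - t) * cos (y - t)) =
  pois r (y - t) * (e + K * (1 - cos (y - t))) by ring.
by rewrite ler_wpM2l ?pois_ge0// HK.
Qed.

Variables (al : nat -> R) (C s : R).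
Hypotheses (s01 : 0 <= s < 1) (alC : forall n, `|al n| <= C * s ^+ n).
Hypothesis Hal : forall n, segint (fun y => U y * cos (n%:R * (y - t))) a b =
  (if n == 0%N then 2 * pi else pi) * al n.

Let UC_continuous (n : nat) : continuous (fun y => U y * cos (n%:R * (y - t))).
Proof. by move=> y; apply: cvgM; [exact: cU|exact: cosB_continuous]. Qed.

Let pker_U n r : segint (fun y => pker n r (y - t) * U y) a b =
  2 * pi * \sum_(k < n.+1) r ^+ k * al k.
Proof.
elim: n => [|n IH].
  rewrite (@eq_segint _ _ (fun y => U y * cos (0%:R * (y - t)))).
    by rewrite Hal big_ord1 expr0 mul1r.
  by move=> y _; rewrite /pker big_ord0 mul0r cos0 mulr0 addr0 mul1r mulr1.
rewrite (@eq_segint _ _ (fun y => pker n r (y - t) * U y +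
  2 * r ^+ n.+1 * (U y * cos (n.+1%:R * (y - t))))); last first.
  by move=> y _; rewrite pkerS; ring.
rewrite segintD; last 2 first.
- by apply: cont_onT => y; apply: cvgM; [exact: pkerB_continuous|exact: cU].
- by apply: cont_onT => y; apply: cvgM; [exact: cvg_cst|exact: UC_continuous].
rewrite IH segintZ ?Hal; last exact: cont_onT.
by rewrite [in RHS]big_ord_recr/=; ring.
Qed.

Let sum_dist r : 0 <= r <= 1 -> cvgn (fun N => \sum_(k < N) r ^+ k * al k) /\
  forall N, `|limn (fun N => \sum_(k < N) r ^+ k * al k) - \sum_(k < N) r ^+ k * al k| <=
    C * s ^+ N / (1 - s).
Proof.
move=> /andP[r0 r1]; apply: (@cvg_geo_dist R R^o) => // n.
rewrite big_ord_recr/= addrAC subrr add0r normrM ger0_norm ?exprn_ge0//.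
by apply: le_trans (alC n); rewrite ler_piMl// exprn_ile1.
Qed.

Let pois_U r : 0 <= r < 1 -> segint (fun y => pois r (y - t) * U y) a b =
  2 * pi * limn (fun N => \sum_(k < N) r ^+ k * al k).
Proof.
move=> r01; have := segint_pker_cvg (t := t) ab r01 cU.
have r01' : 0 <= r <= 1 by case/andP: r01 => -> /ltW.
have [cv _] := sum_dist r01'.
have h : 2 * pi * (\sum_(k < n.+1) r ^+ k * al k) @[n --> \oo] -->
    2 * pi * limn (fun N => \sum_(k < N) r ^+ k * al k).
  apply: cvgM; first exact: cvg_cst.
  by have := cv; rewrite -(@cvg_shiftS _ (fun N => \sum_(k < N) r ^+ k * al k)).
under eq_fun do rewrite pker_U.
move=> h2; rewrite -(cvg_lim _ h)// -(cvg_lim _ h2)//.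
Qed.

(** Geometric decay makes the series converge at [r = 1] and uniformly in [r]. Its Abel means are
    Poisson integrals of [U], which tend to [U t], so the sum is [U t]. *)
Lemma fourier_series_cvg : \sum_(k < N) al k @[N --> \oo] --> U t.
Proof.
have o01 : (0 <= (1 : R)) && ((1 : R) <= 1) by rewrite ler01 lexx.
have [cv1 d1] := sum_dist o01.
set A := limn _ in d1.
have s1 N : \sum_(k < N) 1 ^+ k * al k = \sum_(k < N) al k.
  by apply: eq_bigr => k _; rewrite expr1n mul1r.
have hA : \sum_(k < N) al k @[N --> \oo] --> A.
  rewrite (_ : (fun N => \sum_(k < N) al k) = fun N => \sum_(k < N) 1 ^+ k * al k); last first.
    by apply/funext => N; rewrite s1.
  exact: cv1.
suff -> : U t = A by [].
apply/eqP; rewrite -subr_eq0 -normr_le0; apply/ler_addgt0Pr => e e0; rewrite add0r.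
(* Five errors: two from [korovkin], the tails at [r] and at [1], and the continuity in [r] of a
   finite sum. *)
have e5 : 0 < e / 5 by lra.
have /cvgrPdist_lt/(_ _ e5)[N _ /(_ N (leqnn N))] := geo_cvg0 C s01.
rewrite /= sub0r normrN => /(le_lt_trans (ler_norm _)) HN.
have [K K0 HK] := korovkin e5.
have fc : \sum_(k < N) r ^+ k * al k @[r --> (1 : R)] --> \sum_(k < N) 1 ^+ k * al k.
  elim: (N) => [|n IH].
    rewrite big_ord0 (_ : (fun r : R => _) = fun=> 0); first exact: cvg_cst.
    by apply/funext => r; rewrite big_ord0.
  rewrite big_ord_recr/= (_ : (fun r : R => _) = fun r => \sum_(k < n) r ^+ k * al k + r ^+ n * al n).
    by apply: cvgD => //; apply: cvgM; [exact: exprn_continuous|exact: cvg_cst].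
  by apply/funext => r; rewrite big_ord_recr.
have [r [r01 Kr Sr]] : exists r, [/\ 0 <= r < 1, K * (1 - r) <= e / 5 &
    `|\sum_(k < N) al k - \sum_(k < N) r ^+ k * al k| <= e / 5].
  have /cvgrPdist_le/(_ _ e5)[del /= del0 Hdel] := fc.
  pose m := Num.min (1 / 2) (Num.min (del / 2) (e / 5 / (K + 1))).
  have K1 : 0 < K + 1 by lra.
  have m0 : 0 < m by rewrite !lt_min !divr_gt0.
  have [m1 [m2 m3]] : m <= 1 / 2 /\ m <= del / 2 /\ m <= e / 5 / (K + 1).
    by rewrite /m !ge_min !lexx !orbT.
  exists (1 - m); split.
  - by apply/andP; split; lra.
  - have -> : 1 - (1 - m) = m by ring.
    apply: (@le_trans _ _ ((K + 1) * m)); first by rewrite ler_wpM2r ?lerDl// ltW.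
    by rewrite mulrC -ler_pdivlMr.
  - rewrite -s1; apply: Hdel; rewrite /ball_/= opprB addrC subrK gtr0_norm//; lra.
have r01' : 0 <= r <= 1 by case/andP: r01 => -> /ltW.
have [_ dr] := sum_dist r01'.
have := HK r r01; rewrite pois_U//.
set Ar := limn _ in dr *.
rewrite -mulrBr normrM gtr0_norm ?twopi0// ler_pM2l ?twopi0// => H1.
have := dr N; have := d1 N; rewrite s1 => H2 H3.
have -> : U t - A = - (Ar - U t) + (Ar - \sum_(k < N) r ^+ k * al k) -
  (\sum_(k < N) al k - \sum_(k < N) r ^+ k * al k) - (A - \sum_(k < N) al k) by ring.
apply: le_trans (ler_normB _ _) _.
apply: le_trans (lerD (ler_normB _ _) (lexx _)) _.
apply: le_trans (lerD (lerD (ler_normD _ _) (lexx _)) (lexx _)) _.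
rewrite normrN; lra.
Qed.

End FourierSeries.

(** * Radial limits of square summable trigonometric series *)

(** The weight [Num.sqrt z / Num.sqrt y] turns the right-hand side into the square of the sum of the
    roots; when [y] or [z] is zero, a limit in [e] replaces it. This recovers Minkowski's inequality
    from weighted inequalities, which can be integrated termwise. *)
Lemma sqrt_le_of_weighted (R : realType) (x y z : R) : 0 <= y -> 0 <= z ->
  (forall e : R, 0 < e -> x <= (1 + e) * y + (1 + e^-1) * z) ->
  Num.sqrt x <= Num.sqrt y + Num.sqrt z.
Proof.
move=> y0 z0 H.
have [sy sz] := (sqrtr_ge0 y, sqrtr_ge0 z).
rewrite -[leRHS]ger0_norm ?addr_ge0// -sqrtr_sqr; apply: ler_wsqrtr.
rewrite sqrrD !sqr_sqrtr//.
have [/eqP y00|yn0] := eqVneq y 0.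
  move: y00 => /eqP y00; rewrite y00 sqrtr0 mul0r mul0rn !add0r.
  apply/ler_addgt0Pr => e e0.
  have e1 : 0 < (z + 1) / e by rewrite divr_gt0// ltr_wpDl.
  apply: le_trans (H _ e1) _; rewrite y00 mulr0 add0r mulrDl mul1r lerD2l invf_div.
  by rewrite mulrAC ler_pdivrMr ?ltr_wpDl// ler_wpM2l ?(ltW e0)// lerDl.
have [/eqP z00|zn0] := eqVneq z 0.
  move: z00 => /eqP z00; rewrite z00 sqrtr0 mulr0 mul0rn !addr0.
  apply/ler_addgt0Pr => e e0.
  have e1 : 0 < e / (y + 1) by rewrite divr_gt0// ltr_wpDl.
  apply: le_trans (H _ e1) _; rewrite z00 mulr0 addr0 mulrDl mul1r lerD2l.
  by rewrite mulrAC ler_pdivrMr ?ltr_wpDl// ler_wpM2l ?(ltW e0)// lerDl.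
have y1 : 0 < Num.sqrt y by rewrite sqrtr_gt0 lt_neqAle eq_sym yn0.
have z1 : 0 < Num.sqrt z by rewrite sqrtr_gt0 lt_neqAle eq_sym zn0.
apply: le_trans (H (Num.sqrt z / Num.sqrt y) _) _; first by rewrite divr_gt0.
have {1}-> : y = Num.sqrt y ^+ 2 by rewrite sqr_sqrtr.
have {2}-> : z = Num.sqrt z ^+ 2 by rewrite sqr_sqrtr.
have -> : y = Num.sqrt y ^+ 2 by rewrite sqr_sqrtr.
have -> : z = Num.sqrt z ^+ 2 by rewrite sqr_sqrtr.
rewrite !sqrtr_sqr !ger0_norm// le_eqVlt; apply/orP; left; apply/eqP.
by field; rewrite !gt_eqF.
Qed.

Section Fatou.
Variable R : realType.
Local Notation mu := (@lebesgue_measure R).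
Implicit Types (c d : nat -> R).

Lemma fatou_ae (D : set R) (g : nat -> R -> R) (b : R -> R) (K : \bar R) :
  measurable D -> (forall n, measurable_fun setT (g n)) -> measurable_fun setT b ->
  mu.-negligible (D `&` [set x | ~ (g n x @[n --> \oo] --> b x)]) ->
  (forall n, \int[mu]_(x in D) (g n x ^+ 2)%:E <= K)%E ->
  (\int[mu]_(x in D) (b x ^+ 2)%:E <= K)%E.
Proof.
move=> mD mg mb [N [mN N0 HN]] HK.
have m2 (f : R -> R) (A : set R) : measurable_fun setT f -> measurable_fun A (EFin \o (fun x => f x ^+ 2)).
  move=> mf; apply/measurable_EFinP; apply: measurable_funX.
  by apply: measurable_funS mf.
have p2 (f : R -> R) x : (0 <= (f x ^+ 2)%:E)%E by rewrite lee_fin sqr_ge0.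
rewrite (ge0_negligible_integral mN mD (m2 _ _ mb) (fun x _ => p2 b x) N0).
have mDN : measurable (D `\` N) by exact: measurableD.
have := @fatou _ _ R mu (D `\` N) mDN (fun n x => (g n x ^+ 2)%:E)
  (fun n => m2 _ _ (mg n)) (fun n x _ => p2 (g n) x).
rewrite (_ : \int[mu]_(x in D `\` N) limn_einf _ = \int[mu]_(x in D `\` N) (b x ^+ 2)%:E)%E; last first.
  apply: eq_integral => x; rewrite inE => -[Dx Nx].
  have /contrapT H : ~ ~ (g n x @[n --> \oo] --> b x) by move=> H; apply: Nx; apply: HN.
  apply: (cvg_limn_einf_sup _).1; apply: cvg_EFin; first exact: nearW.
  exact: (cvgM H H).
move=> /le_trans; apply; rewrite limn_einf_lim; apply: lime_le; first exact: is_cvg_einfs.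
apply: nearW => n; apply: le_trans (HK n).
rewrite (ge0_negligible_integral mN mD (m2 _ _ (mg n)) (fun x _ => p2 (g n) x) N0).
by apply: ereal_inf_lbound; exists n => /=.
Qed.

Lemma onem_harmonic01 (n : nat) : 0 <= (1 - n.+1%:R^-1 : R) < 1.
Proof.
by rewrite subr_ge0 invf_le1 ?ler1n// gtrBl invr_gt0 ltr0n.
Qed.

Lemma cvg_onem_harmonic : 1 - n.+1%:R^-1 @[n --> \oo] --> (1 : R).
Proof.
rewrite -[X in _ --> X]subr0; apply: cvgB; first exact: cvg_cst.
exact: cvg_harmonic.
Qed.

Lemma cvg_left1_seq (u : R -> R) (l : R) : u r @[r --> 1^'-] --> l ->
  u (1 - n.+1%:R^-1) @[n --> \oo] --> l.
Proof.
move=> /cvg_at_leftP; apply; split; last exact: cvg_onem_harmonic.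
by move=> n; case/andP: (onem_harmonic01 n).
Qed.

(** * A weak type estimate for the radial maximal function *)

Section WeakMax.
Variables (c d : nat -> R) (C : R).
Hypothesis H : coef_bound c d C.

Definition exceed_set a (lam rho : R) : set R :=
  [set t | a <= t <= a + 2 * pi /\ exists2 s, 0 <= s < rho & lam < `|harms c d s t|].

(** For each radius the condition is open in the angle, so the uncountable union over the radii is
    open. *)
Lemma measurable_exceed_set a lam rho : rho <= 1 -> measurable (exceed_set a lam rho).
Proof.
move=> rho1.
have -> : exceed_set a lam rho = `[a, a + 2 * pi]%classic `&`
    \bigcup_(s in [set s | 0 <= s < rho]) [set t | lam < `|harms c d s t|].
  apply/seteqP; split => t /=; rewrite in_itv/=.
    by move=> [tI [s srho st]]; split => //; exists s.
  by move=> [tI [s srho st]]; split => //; exists s.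
apply: measurableI => //; apply: open_measurable; apply: bigcup_open => s /= /andP[s0 s1].
have s01 : 0 <= s < 1 by rewrite s0 (lt_le_trans s1).
have cn : continuous (fun t => `|harms c d s t|).
  by move=> t; apply: cvg_norm; exact: (harms_continuous s01 H).
have := @open_comp _ _ (fun t => `|harms c d s t|) [set y | lam < y].
by apply; [move=> t _; exact: cn|exact: open_gt].
Qed.

(** At a point of the set some window of half-width at most [pi] has a mean of [|harms c d rho|]
    above [lam], since otherwise [harms_maximal] would apply. The set thus lies in a superlevel set
    of the Hardy-Littlewood maximal function, with weak type constant 3; the L1 norm over two
    periods is at most [4 * pi * eta], whence [12 * pi]. *)
Lemma exceed_set_bound a lam rho (eta : R) : 0 < lam -> 0 < eta -> 0 <= rho < 1 ->
  (forall n, \sum_(k < n) wt c d k <= eta ^+ 2) ->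
  (mu (exceed_set a lam rho) <= (12 * pi * eta / lam)%:E)%E.
Proof.
move=> lam0 eta0 rho01 HW.
have p0 := pi_gt0 R.
pose g t := `|harms c d rho t|.
have ch := harms_continuous rho01 H.
have cg : continuous g by move=> t; apply: cvg_norm; exact: ch.
(* Windows of half-width at most [pi] around points of [[a, a + 2 * pi]] stay in this interval,
   which is made of two periods. *)
pose D : set R := `[a - pi, a + 3 * pi]%classic.
have mD : measurable D by exact: measurable_itv.
have iD : mu.-integrable D (EFin \o g) by apply: cont_on_integrable; exact: cont_onT.
have lD := integrable_locally_restrict mD iD.
have sub : exceed_set a lam rho `<=` [set t | lam%:E < HL_maximal (g \_ D) t]%E.
  move=> t [/andP[ta tb] [s /andP[s0 srho] lams]] /=.
  have [[h /andP[h0 hp] hh]|no] := pselect (exists2 h, 0 <= h <= pi & 2 * h * lam < segint g (t - h) (t + h)); last first.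
    have rho0 : 0 < rho by exact: le_lt_trans srho.
    have sr : 0 <= s / rho < 1 by rewrite divr_ge0 ?(ltW rho0)//= ltr_pdivrMr ?mul1r.
    have := @harms_maximal R c d C (s / rho) rho t lam sr rho01 H.
    rewrite divfK ?gt_eqF// leNgt lams => X; exfalso; suff : false by [].
    apply: X => h hp; rewrite leNgt; apply/negP => hh; apply: no; by exists h.
  have {}h0 : 0 < h.
    rewrite lt_neqAle h0 andbT; apply/negP => /eqP h00.
    by move: hh; rewrite -h00 subr0 addr0 segint_self mulr0 mul0r ltxx.
  apply: (@lt_le_trans _ _ (iavg (g \_ D) (ball t h))); last first.
    by apply: ereal_sup_ubound; exists h => //=; rewrite in_itv/= h0.
  rewrite iavg_restrict//; last by rewrite ball_itv; exact: measurable_itv.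
  have -> : D `&` ball t h = ball t h.
    apply/setIidPr => y; rewrite ball_itv /D /= !in_itv/= => /andP[y1 y2].
    by apply/andP; split; lra.
  rewrite lebesgue_measure_ball ?(ltW h0)// ball_itv.
  have -> : (\int[mu]_(y in `](t - h)%R, (t + h)%R[) `|g y|%:E = (segint g (t - h) (t + h))%:E)%E.
    rewrite -(integral_segint (cont_onT cg)) (@integral_itv_bndoo R (t - h) (t + h) (EFin \o g) true false).
      by apply: eq_integral => y _; rewrite /g normr_id.
    by apply/measurable_EFinP; apply: measurable_funS (continuous_measurable_fun cg).
  rewrite inver mulrn_eq0/= gt_eqF// -EFinM lte_fin.
  rewrite mulrC ltr_pdivlMr ?pmulrn_lgt0//.
  by move: hh; rewrite -(mulr_natl h); lra.
have mHL : measurable [set t | lam%:E < HL_maximal (g \_ D) t]%E.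
  rewrite -[X in measurable X]setTI; apply: emeasurable_fun_o_infty => //.
  exact: measurable_HL_maximal.
have mM : measurable (exceed_set a lam rho) by apply: measurable_exceed_set; case/andP: rho01 => _ /ltW.
have /andP[_ rho1] := rho01.
apply: le_trans (le_measure mu _ _ sub) _; [exact/mem_set|exact/mem_set|].
apply: le_trans (maximal_inequality lD lam0) _ => /=.
have -> : (\int[mu]_y `|((g \_ D) y)%:E| = (segint g (a - pi) (a + 3 * pi))%:E)%E.
  rewrite -(integral_segint (cont_onT cg)) [RHS]integral_mkcond.
  apply: eq_integral => y _; rewrite !patchE; case: ifPn => _; last by rewrite abse0.
  by rewrite /= /g normr_id.
have cg2 : continuous (fun t => harms c d rho t ^+ 2) by move=> t; apply: cvgM; exact: ch.
(* From L2 to L1 by integrating [y <= eta / 2 + y ^+ 2 / (2 * eta)]. *)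
have seg b : segint g b (b + 2 * pi) <= 2 * pi * eta.
  have -> : 2 * pi * eta = segint (fun=> eta / 2) b (b + 2 * pi) + 2^-1 / eta * (2 * pi * eta ^+ 2).
    by rewrite segint_cst ?lerDl ?ltW ?twopi0//; field; rewrite gt_eqF.
  apply: (@le_trans _ _ (segint (fun=> eta / 2) b (b + 2 * pi) + 2^-1 / eta * segint (fun t => harms c d rho t ^+ 2) b (b + 2 * pi))); last first.
    rewrite lerD2l ler_pM2l ?divr_gt0//; exact: parseval_le HW.
  have ccst (k : R) : continuous (fun _ : R => k) by move=> x; exact: cvg_cst.
  rewrite -segintZ; last exact: cont_onT.
  have cZ : continuous (fun x => 2^-1 / eta * harms c d rho x ^+ 2).
    by move=> x; apply: cvgM; [exact: cvg_cst|exact: cg2].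
  rewrite -segintD; [|exact: cont_onT|exact: cont_onT].
  apply: le_segint; [exact: cont_onT|by apply: cont_onD; exact: cont_onT|].
  move=> x _; rewrite /g -(real_normK (num_real (harms c d rho x))).
  move: `|_| => y; rewrite -subr_ge0.
  have -> : eta / 2 + 2^-1 / eta * y ^+ 2 - y = (y - eta) ^+ 2 * (2^-1 / eta).
    by field; rewrite gt_eqF.
  by rewrite mulr_ge0 ?sqr_ge0// divr_ge0// ltW.
have -> : segint g (a - pi) (a + 3 * pi) = segint g (a - pi) (a - pi + 2 * pi) + segint g (a + pi) (a + pi + 2 * pi).
  have -> : a - pi + 2 * pi = a + pi by ring.
  have -> : a + pi + 2 * pi = a + 3 * pi by ring.
  by apply: segint_chasles; [lra|lra|exact: cont_onT].
rewrite -EFinM lee_fin.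
have -> : 12 * pi * eta / lam = 3 / lam * (2 * pi * eta + 2 * pi * eta) by field; rewrite gt_eqF.
by rewrite ler_pM2l ?divr_gt0// lerD.
Qed.

(** The bound is independent of [rho] and the sets increase to [exceed_set a lam 1], so continuity
    of the measure applies. *)
Lemma exceed_set_bound1 a lam (eta : R) : 0 < lam -> 0 < eta ->
  (forall n, \sum_(k < n) wt c d k <= eta ^+ 2) ->
  (mu (exceed_set a lam 1) <= (12 * pi * eta / lam)%:E)%E.
Proof.
move=> lam0 eta0 HW.
pose rh (n : nat) : R := 1 - n.+1%:R^-1.
have E : exceed_set a lam 1 = \bigcup_n exceed_set a lam (rh n).
  apply/seteqP; split => t; last first.
    move=> [n _ [ta [s /andP[s0 sr] sl]]]; split => //; exists s => //.
    by rewrite s0 (lt_trans sr)//; case/andP: (onem_harmonic01 n).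
  move=> [ta [s /andP[s0 s1] sl]].
  have /cvgrPdist_lt/(_ (1 - s)) := cvg_onem_harmonic; rewrite subr_gt0 s1 => /(_ isT).
  move=> [n _ /(_ n (leqnn n))/= Hn]; exists n => //; split => //; exists s => //.
  rewrite s0 /rh /=; move: Hn; have /andP[_ r1] := onem_harmonic01 n.
  by rewrite gtr0_norm ?subr_gt0// => Hn2; move: Hn2 r1; move: (_^-1) => z; lra.
have mM n : measurable (exceed_set a lam (rh n)).
  by apply: measurable_exceed_set; apply: ltW; case/andP: (onem_harmonic01 n).
have mE : measurable (\bigcup_n exceed_set a lam (rh n)) by rewrite -E; exact: measurable_exceed_set.
have mono : {homo (fun n => exceed_set a lam (rh n)) : n m / (n <= m)%N >-> (n <= m)%O}.
  move=> n m nm; apply/subsetPset => t [ta [s /andP[s0 sr] sl]]; split => //; exists s => //.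
  rewrite s0 (lt_le_trans sr)// lerD2l lerN2 lef_pV2 ?posrE ?ltr0n//.
  by rewrite ler_nat ltnS.
have Hc := nondecreasing_cvg_mu (mu := mu) mM mE mono.
rewrite E -(cvg_lim _ Hc)//; apply: lime_le; first by apply/cvg_ex; eexists; exact: Hc.
by apply: nearW => n /=; apply: exceed_set_bound => //; exact: onem_harmonic01.
Qed.

End WeakMax.

End Fatou.

Lemma near_left1 (R : realType) : \forall r \near (1 : R)^'-, 0 <= r < 1.
Proof.
near=> r; apply/andP; split.
- by near: r; apply: nbhs_left_ge; exact: ltr01.
- by near: r; exact: nbhs_left_lt.
Unshelve. all: by end_near. Qed.

(** * Radial limits almost everywhere and the upper L2 bound *)

Section BoundaryL2.
Variable R : realType.
Local Notation mu := (@lebesgue_measure R).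
Variables (c d : nat -> R) (C W : R).
Hypotheses (H : coef_bound c d C) (HW : forall n, \sum_(k < n) wt c d k <= W).

Lemma wt_tail N k : (0 < N)%N ->
  wt (tail_seq N c) (tail_seq N d) k = if (k < N)%N then 0 else wt c d k.
Proof.
move=> N0; rewrite /wt /tail_seq; case: eqVneq => [->|_].
  by rewrite N0 expr0n.
by case: ifP => _ //; rewrite expr0n /= addr0 mul0r.
Qed.

Lemma wt_tail_small (e : R) : 0 < e -> exists2 N0, (0 < N0)%N & forall N, (N0 <= N)%N ->
  forall n, \sum_(k < n) wt (tail_seq N c) (tail_seq N d) k <= e.
Proof.
move=> e0; pose S n := \sum_(k < n) wt c d k.
have mS : {homo S : n m / (n <= m)%N >-> n <= m}.
  move=> n m /subnKC <-; rewrite /S big_split_ord/= lerDl.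
  by apply: sumr_ge0 => k _; exact: wt_ge0.
have cS : cvgn S.
  apply: nondecreasing_is_cvgn => //; exists W => _ [n _ <-]; exact: HW.
have /cvgrPdist_lt/(_ _ e0)[N1 _ HN1] := cS.
exists N1.+1 => // N N1N n.
have HL m : S m <= limn S by exact: nondecreasing_cvgn_le.
have N0 : (0 < N)%N by exact: leq_trans N1N.
have E m : S N + \sum_(k < N + m) wt (tail_seq N c) (tail_seq N d) k = S (N + m)%N.
  elim: m => [|m IH].
    rewrite addn0 [X in _ + X]big1 ?addr0// => k _; by rewrite wt_tail// ltn_ord.
  rewrite addnS [in LHS]big_ord_recr/= addrA IH /S [in RHS]big_ord_recr/= wt_tail//.
  by rewrite ltnNge leq_addr.
apply: (@le_trans _ _ (\sum_(k < N + n) wt (tail_seq N c) (tail_seq N d) k)).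
  rewrite addnC big_split_ord/= lerDl.
  by apply: sumr_ge0 => k _; exact: wt_ge0.
have h := HN1 N (ltnW N1N); rewrite /= in h.
have := E n; have := HL (N + n)%N; have := le_lt_trans (ler_norm _) h.
by move: (S _) (S _) (limn _) (\sum_(_ < _) _) => ? ? ? ?; lra.
Qed.

(** The first [N] terms form a polynomial in [r], and the tail stays below [lam j] for all radii
    unless the angle lies in [E N j]. As the square norm of the tail tends to 0, the weak type
    estimate makes the intersection over [N] a null set; off these sets the Cauchy criterion
    holds. *)
Lemma harms_ae a :
  mu.-negligible [set t | a <= t <= a + 2 * pi /\ ~ cvg (harms c d r t @[r --> 1^'-])].
Proof.
pose lam (j : nat) : R := j.+1%:R^-1.
have lam0 j : 0 < lam j by rewrite invr_gt0.
pose E N j := exceed_set (tail_seq N c) (tail_seq N d) a (lam j) 1.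
have tb N : coef_bound (tail_seq N c) (tail_seq N d) C by exact: tail_bound.
have mE N j : measurable (E N j) by apply: (measurable_exceed_set (tb N)).
have nE : mu.-negligible (\bigcup_j \bigcap_N E N j).
  apply: negligible_bigcup => j.
  exists (\bigcap_N E N j); split => //; first by apply: bigcapT_measurable => N; exact: mE.
  apply/eqP; rewrite eq_le measure_ge0 andbT; apply/lee_addgt0Pr => e e0; rewrite add0e.
  (* Chosen to make the weak type bound [12 * pi * eta / lam j] equal to [e]. *)
  pose eta := e * lam j / (12 * pi).
  have eta0 : 0 < eta by rewrite divr_gt0 ?mulr_gt0 ?pi_gt0.
  have [N _ HN] := wt_tail_small (exprn_gt0 2 eta0).
  have := exceed_set_bound1 (tb N) a (lam0 j) eta0 (HN N (leqnn N)).
  have -> : 12 * pi * eta / lam j = e.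
    rewrite /eta; have := lam0 j; move: (lam j) => l l0.
    by have := pi_gt0 R; move: pi => p p0; field; rewrite !gt_eqF.
  apply: le_trans; apply: le_measure.
  - by rewrite inE; apply: bigcapT_measurable => N'; exact: mE.
  - by rewrite inE; exact: mE.
  - exact: bigcap_inf.
apply: negligibleS nE => t [tI ncv]; apply: contrapT => nE; apply: ncv.
apply: cauchy_cvg; apply: cauchy_exP => e e0.
have e3 : 0 < e / 3 by lra.
have [j _ /(_ j (leqnn j))/=] := (cvgrPdist_lt _ _).1 (@cvg_harmonic R) _ e3.
rewrite sub0r normrN => /(le_lt_trans (ler_norm _)) hj.
have [N HN] : exists N, ~ E N j t.
  by apply/not_existsP => hN; apply: nE; exists j => // N _; apply: contrapT; exact: hN.
exists (harm c d N 1 t).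
have ctr : harm c d N r t @[r --> (1 : R)] --> harm c d N 1 t.
  elim: (N) => [|n IH].
    rewrite harm0 (_ : (fun r : R => _) = fun=> 0); first exact: cvg_cst.
    by apply/funext => r; rewrite harm0.
  rewrite harmS (_ : (fun r : R => _) = fun r => harm c d n r t +
    r ^+ n * (c n * cos (n%:R * t) + d n * sin (n%:R * t))).
    by apply: cvgD => //; apply: cvgM; [exact: exprn_continuous|exact: cvg_cst].
  by apply/funext => r; rewrite harmS.
have := (cvgrPdist_lt _ _).1 (cvg_at_left_filter ctr) _ e3.
rewrite /= => hnear; near=> r.
have r01 : 0 <= r < 1 by near: r; exact: near_left1.
rewrite -ball_normE /=; rewrite (harms_tail N t r01 H) opprD addrA.
have h1 : `|harm c d N 1 t - harm c d N r t| < e / 3 by near: r; exact: hnear.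
have h2 : `|harms (tail_seq N c) (tail_seq N d) r t| <= lam j.
  rewrite leNgt; apply/negP => hlt; apply: HN; split => //; by exists r.
apply: le_lt_trans (ler_normB _ _) _.
have h3 : lam j < e / 3 by exact: hj.
by move: h1 h2 h3; move: `|_| `|_| (lam j) => ? ? ?; lra.
Unshelve. all: by end_near. Qed.

Lemma harms_aeT : mu.-negligible [set t | ~ cvg (harms c d r t @[r --> 1^'-])].
Proof.
pose w (b : bool) n : R := if b then n%:R * (2 * pi) else - (n.+1%:R * (2 * pi)).
have : mu.-negligible (((\bigcup_n [set t | w true n <= t <= w true n + 2 * pi /\ ~ cvg (harms c d r t @[r --> 1^'-])]) `|` (\bigcup_n [set t | w false n <= t <= w false n + 2 * pi /\ ~ cvg (harms c d r t @[r --> 1^'-])]))).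
  by apply: negligibleU; apply: negligible_bigcup => n; exact: harms_ae.
have p2 := twopi0 R.
apply: negligibleS => t /= nc; have [t0|t0] := leP 0 t.
  left; exists (Num.truncn (t / (2 * pi))) => //=; split => //.
  have /andP[h1 h2] := truncn_itv (divr_ge0 t0 (ltW p2)).
  rewrite -ler_pdivlMr// h1/= -[X in _ + X]mul1r -mulrDl -ler_pdivrMr//.
  by rewrite natr1 ltW.
right; exists (Num.truncn (- t / (2 * pi))) => //=; split => //.
have nt : 0 <= - t by rewrite oppr_ge0 ltW.
have /andP[h1 h2] := truncn_itv (divr_ge0 nt (ltW p2)).
move: h1 h2; rewrite ler_pdivlMr// ltr_pdivrMr//; move: (Num.truncn _) => n.
rewrite (_ : n.+1%:R * (2 * pi) = n%:R * (2 * pi) + 2 * pi); last by rewrite -(natr1 n); ring.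
move: (n%:R * (2 * pi)) => y h1 h2; apply/andP; split; lra.
Qed.

Variable b : R -> R.
Hypotheses (mb : measurable_fun setT b)
  (Hb : forall t, cvg (harms c d r t @[r --> 1^'-]) -> harms c d r t @[r --> 1^'-] --> b t).

(** Fatou's lemma along the radii [1 - n.+1%:R^-1], with Parseval's formula on each circle. *)
Lemma boundary_sqr_le a :
  (\int[mu]_(t in `[a, (a + 2 * pi)%R]) (b t ^+ 2)%:E <= (2 * pi * W)%:E)%E.
Proof.
apply: (@fatou_ae R _ (fun n t => harms c d (1 - n.+1%:R^-1) t)) => //.
- move=> n; apply: continuous_measurable_fun.
  exact: (harms_continuous (onem_harmonic01 R n) H).
- apply: negligibleS (harms_ae a) => t [/=]; rewrite in_itv/= => tI nc; split => // cv.
  by apply: nc; apply: (cvg_left1_seq (u := fun r => harms c d r t)); exact: Hb.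
- move=> n; have cc := harms_continuous (onem_harmonic01 R n) H.
  rewrite (integral_segint (f := fun t => harms c d (1 - n.+1%:R^-1) t ^+ 2)).
    by rewrite lee_fin; apply: parseval_le HW => //; exact: onem_harmonic01.
  by apply: cont_onT => t; apply: cvgM; exact: cc.
Qed.

End BoundaryL2.

(** * The lower L2 bound *)

Section BoundaryL2Lower.
Variable R : realType.
Local Notation mu := (@lebesgue_measure R).
Variables (c d : nat -> R) (C W : R).
Hypotheses (H : coef_bound c d C) (HW : forall n, \sum_(k < n) wt c d k <= W).
Variable b : R -> R.
Hypotheses (mb : measurable_fun setT b)
  (Hb : forall t, cvg (harms c d r t @[r --> 1^'-]) -> harms c d r t @[r --> 1^'-] --> b t).

Lemma cvg_harm_left1 N t : harm c d N r t @[r --> 1^'-] --> harm c d N 1 t.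
Proof.
elim: N => [|n IH].
  rewrite harm0 (_ : (fun r : R => _) = fun=> 0); first exact: cvg_cst.
  by apply/funext => r; rewrite harm0.
rewrite harmS (_ : (fun r : R => _) = fun r => harm c d n r t +
  r ^+ n * (c n * cos (n%:R * t) + d n * sin (n%:R * t))).
  apply: cvgD => //; apply: cvgM; last exact: cvg_cst.
  by apply: cvg_at_left_filter; exact: exprn_continuous.
by apply/funext => r; rewrite harmS.
Qed.

Lemma boundary_tail N t :
  cvg (harms (tail_seq N c) (tail_seq N d) r t @[r --> 1^'-]) ->
  harms (tail_seq N c) (tail_seq N d) r t @[r --> 1^'-] --> b t - harm c d N 1 t.
Proof.
set T := fun r => harms _ _ r t => cT.
have near01 := near_left1 R.
have cv : cvg (harms c d r t @[r --> 1^'-]).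
  apply/cvg_ex; exists (harm c d N 1 t + lim (T r @[r --> 1^'-])).
  have h : harm c d N r t + T r @[r --> 1^'-] --> harm c d N 1 t + lim (T r @[r --> 1^'-]).
    by apply: cvgD => //; exact: cvg_harm_left1.
  apply: cvg_trans h; apply: near_eq_cvg; apply: filterS near01 => r r01.
  by rewrite (harms_tail N t r01 H).
have h : harms c d r t - harm c d N r t @[r --> 1^'-] --> b t - harm c d N 1 t.
  by apply: cvgB; [exact: Hb|exact: cvg_harm_left1].
apply: cvg_trans h; apply: near_eq_cvg; apply: filterS near01 => r r01.
by rewrite (harms_tail N t r01 H) addrAC subrr add0r.
Unshelve. all: by end_near. Qed.

(** Fatou's lemma only bounds from above. For the lower bound, the head [harm c d N 1] has an
    exactly known norm and differs from [b] by the boundary function of a tail, which the upper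
    bound makes arbitrarily small in L2. *)
Lemma boundary_sqr_ge a M :
  ((2 * pi * \sum_(k < M) wt c d k)%:E <= \int[mu]_(t in `[a, (a + 2 * pi)%R]) (b t ^+ 2)%:E)%E.
Proof.
have p2 := twopi0 R.
pose I (f : R -> R) := (\int[mu]_(t in `[a, (a + 2 * pi)%R]) (f t ^+ 2)%:E)%E.
have Ib := boundary_sqr_le H HW mb Hb a.
have I0 f : (0 <= I f)%E by apply: integral_ge0 => t _; rewrite lee_fin sqr_ge0.
have fb : I b \is a fin_num by rewrite ge0_fin_numE// (le_lt_trans Ib) ?ltry.
rewrite -/(I b) -(fineK fb) lee_fin.
have fB0 : 0 <= fine (I b) by exact: fine_ge0.
have S0 n : 0 <= \sum_(k < n) wt c d k by apply: sumr_ge0 => k _; exact: wt_ge0.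
rewrite -ler_sqrt//; apply/ler_addgt0Pr => e e0.
have e20 : 0 < e ^+ 2 / (2 * pi) by rewrite divr_gt0// exprn_gt0.
have [N0 N00 HN0] := wt_tail_small HW e20.
pose N := maxn N0 M.
have HN := HN0 N (leq_maxl _ _).
pose bN t := b t - harm c d N 1 t.
have mh : measurable_fun setT (harm c d N 1) by apply: continuous_measurable_fun; exact: harm_continuous.
have mbN : measurable_fun setT bN by exact: measurable_funB.
have tb : coef_bound (tail_seq N c) (tail_seq N d) C by exact: tail_bound.
have IbN := boundary_sqr_le tb HN mbN (@boundary_tail N) a.
rewrite -/(I bN) in IbN.
have fbN : I bN \is a fin_num by rewrite ge0_fin_numE// (le_lt_trans IbN) ?ltry.
have Ih : I (harm c d N 1) = (2 * pi * \sum_(k < N) wt c d k)%:E.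
  rewrite /I integral_segint; last by apply: cont_onT => t; apply: cvgM; exact: harm_continuous.
  rewrite parseval_fin; congr (_ * _)%:E; apply: eq_bigr => k _; by rewrite expr1n mul1r.
have m2 (k : R) (f : R -> R) : measurable_fun setT f ->
    measurable_fun `[a, (a + 2 * pi)%R] (EFin \o (fun x => k * f x ^+ 2)).
  move=> mf; apply/measurable_EFinP; apply: measurable_funM => //.
  by apply: measurable_funX; exact: measurable_funS mf.
have K (x : R) : 0 < x -> 2 * pi * \sum_(k < N) wt c d k <= (1 + x) * fine (I b) + (1 + x^-1) * fine (I bN).
  move=> x0; rewrite -lee_fin -Ih EFinD !EFinM !fineK//.
  have k1 : 0 <= 1 + x by lra.
  have k2 : 0 <= 1 + x^-1 by rewrite addr_ge0// invr_ge0 ltW.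
  have Z (k : R) (f : R -> R) : 0 <= k -> measurable_fun setT f ->
      (k%:E * I f = \int[mu]_(t in `[a, (a + 2 * pi)%R]) (k * f t ^+ 2)%:E)%E.
    move=> k0 mf; rewrite /I -ge0_integralZl_EFin//.
    - by move=> t _; rewrite lee_fin sqr_ge0.
    - by have := m2 1 _ mf; rewrite (_ : (fun x => 1 * f x ^+ 2) = fun x => f x ^+ 2)//; apply/funext => t; rewrite mul1r.
  rewrite !Z// -ge0_integralD//; last 4 first.
  - by move=> t _; rewrite lee_fin mulr_ge0// sqr_ge0.
  - exact: m2.
  - by move=> t _; rewrite lee_fin mulr_ge0// sqr_ge0.
  - exact: m2.
  rewrite -[leLHS]mul1e Z//; apply: ge0_le_integral => //.
  - by move=> t _; rewrite lee_fin mul1r sqr_ge0.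
  - exact: m2.
  - by apply: emeasurable_funD; exact: m2.
  move=> t _; rewrite -EFinD lee_fin /bN mul1r.
  move: (harm _ _ _ _ _) (b t) => h y.
  (* Here [h = y - (y - h)], and the gap in the weighted triangle inequality is a square. *)
  rewrite -subr_ge0 (_ : _ - _ = x^-1 * (x * y + (y - h)) ^+ 2); last by field; rewrite gt_eqF.
  by rewrite mulr_ge0 ?sqr_ge0// invr_ge0 ltW.
have fN0 : 0 <= fine (I bN) by exact: fine_ge0.
have := sqrt_le_of_weighted fB0 fN0 K.
have s1 : Num.sqrt (fine (I bN)) <= e.
  rewrite -[leRHS]ger0_norm ?(ltW e0)// -sqrtr_sqr ler_wsqrtr//.
  rewrite -lee_fin fineK//; apply: le_trans IbN _.
  by rewrite lee_fin mulrC divfK// gt_eqF.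
have s2 : Num.sqrt (2 * pi * \sum_(k < M) wt c d k) <= Num.sqrt (2 * pi * \sum_(k < N) wt c d k).
  rewrite ler_wsqrtr// ler_pM2l//.
  have /subnKC <- : (M <= N)%N by exact: leq_maxr.
  rewrite big_split_ord/= lerDl; apply: sumr_ge0 => k _; exact: wt_ge0.
move=> s3; apply: le_trans s2 _; apply: le_trans s3 _; by rewrite lerD2l.
Qed.

End BoundaryL2Lower.

(** * Quaternions and slices *)

Section QuatTheory.
Variable R : realType.
Implicit Types (x y z : quat R) (a b : R).

Definition qcoord (k : 'I_4) x : R :=
  if k == 0%N :> nat then q0 x else if k == 1%N :> nat then q1 x
  else if k == 2%N :> nat then q2 x else q3 x.

Lemma quat_ext x y : q0 x = q0 y -> q1 x = q1 y -> q2 x = q2 y -> q3 x = q3 y -> x = y.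
Proof. by case: x => ? ? ? ?; case: y => ? ? ? ? /= -> -> -> ->. Qed.

Lemma qcoord_ext x y : (forall k, qcoord k x = qcoord k y) -> x = y.
Proof.
move=> H; apply: quat_ext.
- exact: (H (@Ordinal 4 0 isT)).
- exact: (H (@Ordinal 4 1 isT)).
- exact: (H (@Ordinal 4 2 isT)).
- exact: (H (@Ordinal 4 3 isT)).
Qed.

Lemma qcoordD k x y : qcoord k (x + y) = qcoord k x + qcoord k y.
Proof. by rewrite /qcoord; do 3 case: ifP => _ //. Qed.

Lemma qcoordN k x : qcoord k (- x) = - qcoord k x.
Proof. by rewrite /qcoord; do 3 case: ifP => _ //. Qed.

Lemma qcoordB k x y : qcoord k (x - y) = qcoord k x - qcoord k y.
Proof. by rewrite qcoordD qcoordN. Qed.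

Lemma qcoordZ k a x : qcoord k (a *: x) = a * qcoord k x.
Proof. by rewrite /qcoord; do 3 case: ifP => _ //. Qed.

Lemma qcoord0 k : qcoord k 0 = 0.
Proof. by rewrite /qcoord; do 3 case: ifP => _ //. Qed.

Lemma qcoord_sum k n (F : 'I_n -> quat R) : qcoord k (\sum_(l < n) F l) = \sum_(l < n) qcoord k (F l).
Proof.
apply: (big_morph (qcoord k)); first exact: qcoordD.
exact: qcoord0.
Qed.

Lemma quat_norm_sq x : `|x| ^+ 2 = q0 x ^+ 2 + q1 x ^+ 2 + q2 x ^+ 2 + q3 x ^+ 2.
Proof. by rewrite quat_normE sqr_sqrtr// !addr_ge0 ?sqr_ge0. Qed.

Lemma quat_norm_sum x : `|x| ^+ 2 = \sum_k qcoord k x ^+ 2.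
Proof. by rewrite quat_norm_sq !big_ord_recl big_ord0 addr0 /= !addrA. Qed.

Lemma qcoord_le_norm k x : `|qcoord k x| <= `|x|.
Proof.
rewrite -(@ler_pXn2r _ 2)// ?nnegrE// quat_norm_sum real_normK ?num_real//.
by rewrite (bigD1 k)//= lerDl; apply: sumr_ge0 => l _; exact: sqr_ge0.
Qed.

Lemma norm_le_qcoord x : `|x| <= \sum_k `|qcoord k x|.
Proof.
have S0 : 0 <= \sum_k `|qcoord k x| by apply: sumr_ge0.
rewrite -(@ler_pXn2r _ 2)// ?nnegrE// quat_norm_sum !big_ord_recl !big_ord0 /=.
rewrite !addr0 -!(real_normK (num_real (qcoord _ _))).
have [h0 h1 h2 h3] : [/\ 0 <= `|qcoord ord0 x|, 0 <= `|qcoord (lift ord0 ord0) x|,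
   0 <= `|qcoord (lift ord0 (lift ord0 ord0)) x| & 0 <= `|qcoord (lift ord0 (lift ord0 (lift ord0 ord0))) x|] by [].
move: `|qcoord ord0 x| `|qcoord (lift ord0 ord0) x|
  `|qcoord (lift ord0 (lift ord0 ord0)) x| `|qcoord (lift ord0 (lift ord0 (lift ord0 ord0))) x| h0 h1 h2 h3.
by move=> u v w t *; rewrite -subr_ge0 (_ : _ - _ =
  2 * (u * v + u * w + u * t + v * w + v * t + w * t)); [rewrite mulr_ge0// !addr_ge0// mulr_ge0|ring].
Qed.

Lemma quat_normM x y : `|x * y| = `|x| * `|y|.
Proof.
apply/eqP; rewrite -(@eqrXn2 _ 2) ?mulr_ge0//.
by rewrite exprMn !quat_norm_sq /=; apply/eqP; ring.
Qed.

Lemma quat_norm1 : `|1 : quat R| = 1.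
Proof. by rewrite quat_normE /= expr1n !expr0n/= !addr0 sqrtr1. Qed.

Lemma quat_normX x n : `|x ^+ n| = `|x| ^+ n.
Proof.
elim: n => [|n IH]; first by rewrite !expr0 quat_norm1.
by rewrite !exprS quat_normM IH.
Qed.

Lemma quat_scaleAl a x y : a *: (x * y) = (a *: x) * y.
Proof. by apply: quat_ext => /=; ring. Qed.

Lemma quat_scaleAr a x y : a *: (x * y) = x * (a *: y).
Proof. by apply: quat_ext => /=; ring. Qed.

Definition quat_conj x := Quat (q0 x) (- q1 x) (- q2 x) (- q3 x).

Lemma quat_rinv x : x != 0 -> exists y, x * y = 1.
Proof.
move=> x0; have n0 : `|x| ^+ 2 != 0 by rewrite expf_neq0// normr_eq0.
exists ((`|x| ^- 2) *: quat_conj x); rewrite -quat_scaleAr.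
have -> : x * quat_conj x = (`|x| ^+ 2) *: (1 : quat R).
  by rewrite quat_norm_sq; apply: quat_ext => /=; ring.
by rewrite scalerA mulVf// scale1r.
Qed.

Lemma quat_cvgP (T : Type) (F : set_system T) {FF : Filter F} (f : T -> quat R) (l : quat R) :
  (f x @[x --> F] --> l) <-> forall k, qcoord k (f x) @[x --> F] --> qcoord k l.
Proof.
split=> [fl k|H].
  apply/cvgrPdist_le => e e0; near=> x; rewrite -qcoordB.
  apply: le_trans (qcoord_le_norm k _) _; near: x.
  exact: (cvgrPdist_le _ _).1 fl e e0.
apply/cvgrPdist_le => e e0; have e4 : 0 < e / 4 by lra.
near=> x; apply: le_trans (norm_le_qcoord _) _.
apply: (@le_trans _ _ (\sum_(k < 4) e / 4)); last first.
  by rewrite sumr_const card_ord -mulr_natr; lra.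
apply: ler_sum => k _; rewrite qcoordB; move: k; near: x.
by apply: filter_forall => k; exact: (cvgrPdist_le _ _).1 (H k) _ e4.
Unshelve. all: by end_near. Qed.

(** Limits are taken coordinatewise. The instance built from this makes the Cauchy criterion
    available for quaternionic sequences and series. *)
Lemma quat_complete (F : set_system (quat R)) : ProperFilter F -> cauchy F -> cvg F.
Proof.
move=> FF /cauchy_ballP cF.
have ck k : cvg (qcoord k x @[x --> F]).
  apply: cauchy_cvg; apply/cauchy_ballP => e e0.
  have {}H := cF e e0; case: H => -[/= A B] [FA FB] HAB.
  exists ((qcoord k @` A), (qcoord k @` B)) => /=.
    split; [apply: filterS FA => x Ax; by exists x|apply: filterS FB => x Bx; by exists x].
  move=> [u v] [/= [x Ax <-] [y By <-]].
  have := HAB (x, y) (conj Ax By); rewrite /= -!ball_normE /= -qcoordB.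
  exact: le_lt_trans (qcoord_le_norm k _).
pose l k := lim (qcoord k x @[x --> F]).
apply/cvg_ex; exists (Quat (l (@Ordinal 4 0 isT)) (l (@Ordinal 4 1 isT)) (l (@Ordinal 4 2 isT)) (l (@Ordinal 4 3 isT))).
suff : (id x @[x --> F] --> Quat (l (@Ordinal 4 0 isT)) (l (@Ordinal 4 1 isT)) (l (@Ordinal 4 2 isT)) (l (@Ordinal 4 3 isT))).
  by [].
apply/quat_cvgP => k.
have -> : qcoord k (Quat (l (@Ordinal 4 0 isT)) (l (@Ordinal 4 1 isT)) (l (@Ordinal 4 2 isT)) (l (@Ordinal 4 3 isT))) = l k.
  by case: k => -[|[|[|[|//]]]] kp; rewrite /qcoord /=; congr l; apply: val_inj.
exact: ck.
Qed.

HB.instance Definition _ := Uniform_isComplete.Build (quat R) quat_complete.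

Lemma quat_mull_cvg (T : Type) (F : set_system T) {FF : Filter F} (f : T -> quat R) (c l : quat R) :
  f x @[x --> F] --> l -> c * f x @[x --> F] --> c * l.
Proof.
move=> fl; apply/cvgrPdist_le => e e0.
have c1 : 0 < `|c| + 1 by rewrite ltr_wpDl.
near=> x; rewrite -mulrBr quat_normM mulrC.
have : `|l - f x| <= e / (`|c| + 1).
  by near: x; exact: (cvgrPdist_le _ _).1 fl (e / (`|c| + 1)) (divr_gt0 e0 c1).
rewrite ler_pdivlMr// => /(le_trans _); apply; by rewrite ler_wpM2l// lerDl.
Unshelve. all: by end_near. Qed.

Lemma quat_mulr_cvg (T : Type) (F : set_system T) {FF : Filter F} (f : T -> quat R) (c l : quat R) :
  f x @[x --> F] --> l -> f x * c @[x --> F] --> l * c.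
Proof.
move=> fl; apply/cvgrPdist_le => e e0.
have c1 : 0 < `|c| + 1 by rewrite ltr_wpDl.
near=> x; rewrite -mulrBl quat_normM.
have : `|l - f x| <= e / (`|c| + 1).
  by near: x; exact: (cvgrPdist_le _ _).1 fl (e / (`|c| + 1)) (divr_gt0 e0 c1).
rewrite ler_pdivlMr// => /(le_trans _); apply; by rewrite ler_wpM2l// lerDl.
Unshelve. all: by end_near. Qed.

Section Slices.
Variable i : quat R.
Hypothesis Si : imag_sphere i.

Lemma imag_sphere_sq : i * i = -1.
Proof.
have [i0 in1] := Si; have := quat_norm_sq i; rewrite in1 i0 expr1n expr0n/= add0r => E.
by apply: quat_ext; rewrite /= i0; [rewrite E; ring|ring|ring|ring].
Qed.

Lemma slice_ptM a b c d : slice_pt i a b * slice_pt i c d = slice_pt i (a * c - b * d) (a * d + b * c).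
Proof.
rewrite /slice_pt mulrDl !mulrDr -!quat_scaleAl -!quat_scaleAr !mul1r !mulr1 imag_sphere_sq.
by rewrite !scalerA scalerN scalerBl scalerDl -scaleNr; apply: quat_ext => /=; ring.
Qed.

Lemma slice_ptZ k a b : k *: slice_pt i a b = slice_pt i (k * a) (k * b).
Proof. by rewrite /slice_pt scalerDr !scalerA. Qed.

Lemma slice_pt1 : slice_pt i 1 0 = 1.
Proof. by rewrite /slice_pt scale1r scale0r addr0. Qed.

Lemma slice_pti : slice_pt i 0 1 = i.
Proof. by rewrite /slice_pt scale1r scale0r add0r. Qed.

Lemma slice_pt_norm a b : `|slice_pt i a b| ^+ 2 = a ^+ 2 + b ^+ 2.
Proof.
have [i0 in1] := Si; have := quat_norm_sq i; rewrite in1 i0 expr1n expr0n/= add0r => E.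
rewrite quat_norm_sq /= i0.
have -> : b ^+ 2 = b ^+ 2 * (q1 i ^+ 2 + q2 i ^+ 2 + q3 i ^+ 2) by rewrite -E mulr1.
by ring.
Qed.

Lemma slice_pt_norm_lt1 a b : (`|slice_pt i a b| < 1) <-> planar_disc a b.
Proof.
rewrite /planar_disc -slice_pt_norm; split.
  by move=> h; rewrite expr_lt1.
by rewrite expr_lt1.
Qed.

Lemma circle_pt_norm t : `|circle_pt i t| = 1.
Proof.
apply/eqP; rewrite -(@eqrXn2 _ 2)// expr1n /circle_pt slice_pt_norm.
by rewrite cos2Dsin2.
Qed.

(** De Moivre's formula in the slice of [i]. *)
Lemma circle_ptX r t n : (r *: circle_pt i t) ^+ n = r ^+ n *: circle_pt i (n%:R * t).
Proof.
rewrite /circle_pt; elim: n => [|n IH].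
  by rewrite !expr0 mul0r cos0 sin0 slice_pt1 scale1r.
rewrite exprS IH !slice_ptZ slice_ptM -(natr1 n) mulrDl mul1r exprS cosD sinD.
congr slice_pt; ring.
Qed.

Lemma imag_sphereN : imag_sphere (- i).
Proof. by have [i0 in1] := Si; split; [rewrite /= i0 oppr0|rewrite normrN]. Qed.

Lemma circle_ptN t : circle_pt (- i) t = circle_pt i (- t).
Proof. by rewrite /circle_pt /slice_pt cosN sinN scalerN scaleNr. Qed.

End Slices.

Definition e1 : quat R := Quat 0 1 0 0.

Lemma e1_sphere : imag_sphere e1.
Proof. by split => //; rewrite quat_normE /= expr0n /= expr1n !addr0 add0r sqrtr1. Qed.

Lemma slice_decomp x : exists i a b, [/\ imag_sphere i, 0 <= b & x = slice_pt i a b].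
Proof.
pose b := Num.sqrt (q1 x ^+ 2 + q2 x ^+ 2 + q3 x ^+ 2).
have S0 : 0 <= q1 x ^+ 2 + q2 x ^+ 2 + q3 x ^+ 2 by rewrite !addr_ge0 ?sqr_ge0.
have b0 : 0 <= b by exact: sqrtr_ge0.
have b2 : b ^+ 2 = q1 x ^+ 2 + q2 x ^+ 2 + q3 x ^+ 2 by rewrite sqr_sqrtr.
have [bz|bn] := eqVneq b 0.
  (* A real quaternion lies on every slice, so any unit will do. *)
  exists e1, (q0 x), 0; split => //; first exact: e1_sphere.
  move: b2; rewrite bz expr0n/= => E.
  have [h1 h2 h3] : [/\ q1 x ^+ 2 = 0, q2 x ^+ 2 = 0 & q3 x ^+ 2 = 0].
    by move: (sqr_ge0 (q1 x)) (sqr_ge0 (q2 x)) (sqr_ge0 (q3 x)) => *; split; lra.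
  move/eqP : h1; move/eqP : h2; move/eqP : h3; rewrite !sqrf_eq0 => /eqP h3 /eqP h2 /eqP h1.
  by apply: quat_ext; rewrite /= ?h1 ?h2 ?h3; ring.
pose j : quat R := Quat 0 (q1 x / b) (q2 x / b) (q3 x / b).
exists j, (q0 x), b; split => //.
  split => //; apply/eqP; rewrite -(@eqrXn2 _ 2)// expr1n quat_norm_sq /=; apply/eqP.
  rewrite expr0n/= add0r !exprMn -!mulrDl -b2 -exprMn divff// expr1n//.
by apply: quat_ext; rewrite /=; field.
Qed.

(* The values on one slice determine those on every other slice, since
   [slice_pt j A B] is the same left combination of [slice_pt i A B] and
   [slice_pt i A (-B)] for all real [A] and [B]. *)
Lemma slice_repr (i j : quat R) A B : imag_sphere i -> imag_sphere j ->
  slice_pt j A B = (2^-1 *: (1 - j * i)) * slice_pt i A B + (2^-1 *: (1 + j * i)) * slice_pt i A (- B).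
Proof.
move=> Si Sj; have si := imag_sphere_sq Si.
rewrite -!quat_scaleAl -scalerDr mulrBl mulrDl !mul1r.
rewrite /slice_pt !mulrDr -!quat_scaleAr !mulr1 -!mulrA si mulrN1.
by apply: quat_ext => /=; field.
Qed.

End QuatTheory.

(** * Quaternionic power series *)

Section PowerSeries.
Variable R : realType.
Implicit Types (x y z h : quat R) (a : nat -> quat R).

Definition psum a n x : quat R := \sum_(k < n) x ^+ k * a k.
Definition pser a x : quat R := limn (fun n => psum a n x).
(** Zero off the ball, in agreement with the representation of functions that
    [slice_hyperholomorphic] demands. *)
Definition pext a x : quat R := if `|x| < 1 then pser a x else 0.

(* The differential of [x ^+ k] at [x] in the direction [h]. *)
Fixpoint dmon k x h : quat R := if k is l.+1 then h * x ^+ l + x * dmon l x h else 0.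

Definition dsum a n x h : quat R := \sum_(k < n) dmon k x h * a k.
Definition dser a x h : quat R := limn (fun n => dsum a n x h).

Lemma dmon_linear k x (c : R) h h' : dmon k x (c *: h + h') = c *: dmon k x h + dmon k x h'.
Proof.
elim: k => [|k IH] /=; first by rewrite scaler0 addr0.
by rewrite IH mulrDl mulrDr -quat_scaleAl -quat_scaleAr scalerDr addrACA.
Qed.

(** A direction commuting with [x] can be pulled out on the left. Applied to the direction [i] at
    points of the slice of [i], this is the source of the Cauchy-Riemann equations. *)
Lemma dmon_comm k x h : x * h = h * x -> dmon k x h = h * dmon k x 1.
Proof.
move=> C; elim: k => [|k IH] /=; first by rewrite mulr0.
by rewrite IH mulrDr mul1r !mulrA C.
Qed.

Section Bounds.
Variables (rho : R) (x h : quat R).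
Hypotheses (rho0 : 0 < rho) (xr : `|x| <= rho) (xhr : `|x + h| <= rho).

(** Measuring [h] in units of [rho] makes all bounds below multiples of [rho ^+ k], with no shift of
    the exponent. *)
Let K := `|h| / rho.
Let K0 : 0 <= K. Proof. by rewrite divr_ge0// ltW. Qed.
Let hK : `|h| = rho * K. Proof. by rewrite /K mulrC divfK// gt_eqF. Qed.
Let rX n : 0 <= rho ^+ n. Proof. by rewrite exprn_ge0// ltW. Qed.
Let pX y n : `|y| <= rho -> `|y| ^+ n <= rho ^+ n.
Proof. by move=> yr; apply: lerXn2r => //; rewrite nnegrE// ltW. Qed.
Let rK0 : 0 <= rho * K. Proof. by rewrite mulr_ge0// ltW. Qed.

Lemma dmon_bound k : `|dmon k x h| <= k%:R * rho ^+ k * K.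
Proof.
elim: k => [|k IH] /=; first by rewrite normr0 !mul0r.
apply: le_trans (ler_normD _ _) _; rewrite !quat_normM quat_normX hK.
apply: (@le_trans _ _ (rho * K * rho ^+ k + rho * (k%:R * rho ^+ k * K))).
  by apply: lerD; [rewrite ler_wpM2l// pX|apply: ler_pM].
by rewrite -natr1 exprS le_eqVlt; apply/orP; left; apply/eqP; ring.
Qed.

Lemma pow_diff_bound k : `|(x + h) ^+ k - x ^+ k| <= k%:R * rho ^+ k * K.
Proof.
elim: k => [|k IH] /=; first by rewrite !expr0 subrr normr0 !mul0r.
have -> : (x + h) ^+ k.+1 - x ^+ k.+1 = h * (x + h) ^+ k + x * ((x + h) ^+ k - x ^+ k).
  by rewrite !exprS mulrDl mulrBr; apply: qcoord_ext => l; rewrite !(qcoordD, qcoordN); ring.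
apply: le_trans (ler_normD _ _) _; rewrite !quat_normM quat_normX hK.
apply: (@le_trans _ _ (rho * K * rho ^+ k + rho * (k%:R * rho ^+ k * K))).
  by apply: lerD; [rewrite ler_wpM2l// pX|apply: ler_pM].
by rewrite -natr1 exprS le_eqVlt; apply/orP; left; apply/eqP; ring.
Qed.

(** The remainder for [k + 1] is [x] times the one for [k] plus [h] times a first order difference;
    the latter adds at most [k] to the constant, and [k ^ 2 + k <= (k + 1) ^ 2]. *)
Lemma pow_rem_bound k :
  `|(x + h) ^+ k - x ^+ k - dmon k x h| <= k%:R ^+ 2 * rho ^+ k * K ^+ 2.
Proof.
elim: k => [|k IH] /=; first by rewrite !expr0 subrr subr0 normr0 expr0n/= !mul0r.
have -> : (x + h) ^+ k.+1 - x ^+ k.+1 - (h * x ^+ k + x * dmon k x h) =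
  x * ((x + h) ^+ k - x ^+ k - dmon k x h) + h * ((x + h) ^+ k - x ^+ k).
  rewrite !exprS mulrDl !mulrBr; apply: qcoord_ext => l; rewrite !(qcoordD, qcoordN); ring.
apply: le_trans (ler_normD _ _) _; rewrite !quat_normM hK.
have hb := pow_diff_bound k.
apply: (@le_trans _ _ (rho * (k%:R ^+ 2 * rho ^+ k * K ^+ 2) + rho * K * (k%:R * rho ^+ k * K))).
  by apply: lerD; [apply: ler_pM|rewrite ler_wpM2l].
rewrite -subr_ge0 (_ : _ - _ = (k%:R + 1) * (rho * rho ^+ k * K ^+ 2)); last by rewrite -(natr1 k) (exprS rho); ring.
by rewrite mulr_ge0 ?addr_ge0// mulr_ge0 ?sqr_ge0// mulr_ge0 ?(ltW rho0).
Qed.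

End Bounds.

(** The [k] terms [s ^+ j] with [j < k] are each at least [s ^+ k], whence
    [k s^k (1 - s) <= 1 - s^k]. *)
Lemma nat_geo_bound (s : R) k : 0 <= s < 1 -> k%:R * s ^+ k <= (1 - s)^-1.
Proof.
move=> /andP[s0 s1]; have s1' : 0 < 1 - s by rewrite subr_gt0.
rewrite -[leRHS]mul1r ler_pdivlMr//.
suff : k%:R * s ^+ k * (1 - s) <= 1 - s ^+ k.
  by move=> /le_trans; apply; rewrite gerBl exprn_ge0.
elim: k => [|k IH]; first by rewrite !mul0r expr0 subrr.
have sk : 0 <= s ^+ k.+1 <= 1 by rewrite exprn_ge0//= exprn_ile1// ltW.
have -> : k.+1%:R * s ^+ k.+1 * (1 - s) = s * (k%:R * s ^+ k * (1 - s)) + (1 - s) * s ^+ k.+1.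
  by rewrite -natr1 exprS; ring.
apply: le_trans (lerD (ler_wpM2l s0 IH) (lexx _)) _.
rewrite -subr_ge0 (_ : _ - _ = (1 - s) * (1 - s ^+ k.+1)); last by rewrite exprS; ring.
by rewrite mulr_ge0 ?(ltW s1')// subr_ge0; case/andP: sk.
Qed.

Lemma nat2_geo_bound (rho : R) : 0 <= rho < 1 ->
  exists K s, [/\ 0 <= s < 1, 0 <= K & forall k, k%:R ^+ 2 * rho ^+ k <= K * s ^+ k].
Proof.
(* With this [s], [rho <= s ^+ 3]: two factors [s ^+ k] absorb [k ^ 2], and the third remains for
   the summation. *)
move=> /andP[r0 r1]; pose s := (2 + rho) / 3.
have s01 : 0 <= s < 1 by rewrite /s; apply/andP; split; lra.
have [s0 s1] := andP s01.
exists ((1 - s)^-1 ^+ 2), s; split => //; first exact: sqr_ge0.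
move=> k; have rs : rho <= s ^+ 3.
  rewrite -subr_ge0 (_ : _ - _ = ((1 - rho) / 3) ^+ 2 * (3 - (1 - rho) / 3)); last by rewrite /s; field.
  by rewrite mulr_ge0 ?sqr_ge0//; lra.
have h : k%:R * s ^+ k <= (1 - s)^-1 by exact: nat_geo_bound.
apply: (@le_trans _ _ (k%:R ^+ 2 * (s ^+ 3) ^+ k)).
  by rewrite ler_wpM2l ?sqr_ge0// lerXn2r ?nnegrE// exprn_ge0.
have -> : k%:R ^+ 2 * (s ^+ 3) ^+ k = (k%:R * s ^+ k) ^+ 2 * s ^+ k.
  by rewrite -exprM mulnC exprM; ring.
rewrite ler_wpM2r ?exprn_ge0// lerXn2r ?nnegrE//.
- by rewrite mulr_ge0// exprn_ge0.
- by rewrite invr_ge0 subr_ge0 ltW.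
Qed.

Lemma nat1_geo_bound (rho : R) K s : 0 <= rho < 1 -> 
  (forall k, k%:R ^+ 2 * rho ^+ k <= K * s ^+ k) -> forall k, k%:R * rho ^+ k <= K * s ^+ k.
Proof.
move=> /andP[r0 r1] H k; apply: le_trans (H k); rewrite ler_wpM2r ?exprn_ge0// -natrX ler_nat.
by case: k => // k; rewrite -[leqLHS]muln1 leq_mul.
Qed.

Section Bounded.
Variables (a : nat -> quat R) (C : R).
Hypothesis aC : forall k, `|a k| <= C.

Let C0 : 0 <= C. Proof. exact: le_trans (aC 0%N). Qed.

Lemma psum_cvg x : `|x| < 1 -> psum a n x @[n --> \oo] --> pser a x.
Proof.
move=> x1; have x01 : 0 <= `|x| < 1 by rewrite normr_ge0.
apply: (@cvg_geo_dist R _ (fun n => psum a n x) C `|x| x01 _).1 => n.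
rewrite /psum big_ord_recr/= addrAC subrr add0r quat_normM quat_normX mulrC.
by rewrite ler_wpM2r// exprn_ge0.
Qed.

Lemma dsum_cvg x h : `|x| < 1 -> dsum a n x h @[n --> \oo] --> dser a x h.
Proof.
move=> x1; pose rho := (1 + `|x|) / 2.
have nx := normr_ge0 x.
have [r0 r1 xr] : [/\ 0 < rho, rho < 1 & `|x| <= rho] by rewrite /rho; split; lra.
have r01 : 0 <= rho < 1 by rewrite ltW.
have [K [s [s01 K0 HK]]] := nat2_geo_bound r01.
apply: (@cvg_geo_dist R _ (fun n => dsum a n x h) (C * K * (`|h| / rho)) s s01 _).1 => n.
rewrite /dsum big_ord_recr/= addrAC subrr add0r quat_normM.
have hh := dmon_bound h r0 xr n.
have h0 : 0 <= `|h| / rho by rewrite divr_ge0// ltW.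
have -> : C * K * (`|h| / rho) * s ^+ n = K * s ^+ n * (`|h| / rho) * C by ring.
apply: ler_pM => //; apply: le_trans hh _; rewrite ler_wpM2r//.
exact: nat1_geo_bound HK n.
Qed.

Lemma dser_linear x (c : R) h h' : `|x| < 1 ->
  dser a x (c *: h + h') = c *: dser a x h + dser a x h'.
Proof.
move=> x1; apply: cvg_lim => //.
have hh : c *: dsum a n x h + dsum a n x h' @[n --> \oo] --> c *: dser a x h + dser a x h'.
  by apply: cvgD; [apply: cvgZ; [exact: cvg_cst|exact: dsum_cvg]|exact: dsum_cvg].
apply: cvg_trans hh; apply: near_eq_cvg; apply: nearW => n.
rewrite /dsum scaler_sumr -big_split/=; apply: eq_bigr => k _.
by rewrite dmon_linear mulrDl quat_scaleAl.
Qed.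

Lemma dser_comm x h : `|x| < 1 -> x * h = h * x -> dser a x h = h * dser a x 1.
Proof.
move=> x1 xh; apply: cvg_lim => //.
have hh : h * dsum a n x 1 @[n --> \oo] --> h * dser a x 1.
  by apply: quat_mull_cvg; exact: dsum_cvg.
apply: cvg_trans hh; apply: near_eq_cvg; apply: nearW => n.
by rewrite /dsum mulr_sumr; apply: eq_bigr => k _; rewrite (dmon_comm _ xh) mulrA.
Qed.

(** The termwise bounds are summed at the radius [rho] halfway between [|x|] and 1. The quadratic
    remainder will give differentiability, and the linear bound the continuity of the
    differential. *)
Lemma pser_remainder x : `|x| < 1 -> exists2 M, 0 <= M & exists2 del, 0 < del &
  forall h, `|h| < del -> `|x + h| < 1 /\
    `|pser a (x + h) - pser a x - dser a x h| <= M * `|h| ^+ 2 /\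
    `|dser a x h| <= M * `|h|.
Proof.
move=> x1; pose rho := (1 + `|x|) / 2.
have nx := normr_ge0 x.
have [r0 r1 xr] : [/\ 0 < rho, rho < 1 & `|x| <= rho] by rewrite /rho; split; lra.
have r01 : 0 <= rho < 1 by rewrite ltW.
have [K [s [s01 K0 HK]]] := nat2_geo_bound r01.
have s1 : 0 < 1 - s by rewrite subr_gt0; case/andP: s01.
pose M1 := C * K / rho ^+ 2 / (1 - s); pose M2 := C * K / rho / (1 - s).
have M10 : 0 <= M1 by rewrite !divr_ge0 ?mulr_ge0// ?exprn_ge0// ltW.
have M20 : 0 <= M2 by rewrite !divr_ge0 ?mulr_ge0// ltW.
exists (M1 + M2); first by rewrite addr_ge0.
exists (rho - `|x|); first by rewrite subr_gt0 /rho; lra.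
move=> h hd; have xhr : `|x + h| <= rho by apply: le_trans (ler_normD _ _) _; lra.
have xh1 : `|x + h| < 1 by exact: le_lt_trans r1.
split => //; split.
  have cv : psum a n (x + h) - psum a n x - dsum a n x h @[n --> \oo] -->
      pser a (x + h) - pser a x - dser a x h.
    by apply: cvgB; [apply: cvgB|]; [exact: psum_cvg|exact: psum_cvg|exact: dsum_cvg].
  have st n : `|(psum a n.+1 (x + h) - psum a n.+1 x - dsum a n.+1 x h) -
      (psum a n (x + h) - psum a n x - dsum a n x h)| <= C * K * (`|h| / rho) ^+ 2 * s ^+ n.
    rewrite /psum /dsum !big_ord_recr/=.
    set A := \sum_(_ < _) _; set B := \sum_(_ < _) _; set D := \sum_(_ < _) _.
    have -> : A + (x + h) ^+ n * a n - (B + x ^+ n * a n) - (D + dmon n x h * a n) - (A - B - D) =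
      ((x + h) ^+ n - x ^+ n - dmon n x h) * a n.
      by rewrite !mulrBl; apply: qcoord_ext => l; rewrite !(qcoordD, qcoordN); ring.
    rewrite quat_normM; have hh := pow_rem_bound r0 xr xhr n.
    have -> : C * K * (`|h| / rho) ^+ 2 * s ^+ n = K * s ^+ n * (`|h| / rho) ^+ 2 * C by ring.
    by apply: ler_pM => //; apply: le_trans hh _; rewrite ler_wpM2r// sqr_ge0.
  have := (cvg_geo_dist s01 st).2 0%N.
  rewrite (cvg_lim _ cv)// /psum /dsum !big_ord0 !subr0 expr0 mulr1 => /le_trans; apply.
  rewrite mulrDl -[leLHS]addr0; apply: lerD; last by rewrite mulr_ge0// sqr_ge0.
  by rewrite /M1 le_eqVlt; apply/orP; left; apply/eqP; field; rewrite !gt_eqF.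
have st n : `|dsum a n.+1 x h - dsum a n x h| <= C * K * (`|h| / rho) * s ^+ n.
  rewrite /dsum big_ord_recr/= addrAC subrr add0r quat_normM.
  have hh := dmon_bound h r0 xr n.
  have h0 : 0 <= `|h| / rho by rewrite divr_ge0// ltW.
  have -> : C * K * (`|h| / rho) * s ^+ n = K * s ^+ n * (`|h| / rho) * C by ring.
  apply: ler_pM => //; apply: le_trans hh _; rewrite ler_wpM2r//.
  exact: nat1_geo_bound HK n.
have := (cvg_geo_dist s01 st).2 0%N.
rewrite /dser /dsum !big_ord0 !subr0 expr0 mulr1 => /le_trans; apply.
rewrite mulrDl -[leLHS]add0r; apply: lerD; first by rewrite mulr_ge0.
by rewrite /M2 le_eqVlt; apply/orP; left; apply/eqP; field; rewrite !gt_eqF.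
Qed.

Lemma pext_diff x : `|x| < 1 -> differentiable (pext a) x /\ ('d (pext a) x = dser a x :> (_ -> _)).
Proof.
move=> x1; have [M M0 [del del0 H]] := pser_remainder x1.
pose lm := GRing.isLinear.Build R (quat R) (quat R) *:%R (dser a x)
  (fun c u v => dser_linear c u v x1).
pose L : {linear quat R -> quat R} := HB.pack (dser a x) lm.
have LE : (L : quat R -> quat R) = dser a x by [].
have cL : continuous L.
  apply: (@bounded_linear_continuous _ _ _ L); apply/linear_boundedP.
  near=> r => y.
  have [->|y0] := eqVneq y 0; first by rewrite linear0 !normr0 mulr0.
  have ny : 0 < `|y| by rewrite normr_gt0.
  (* The bound is known for small vectors only; homogeneity carries it over to every [y]. *)
  pose t := del / 2 / `|y|.
  have t0 : 0 < t by rewrite !divr_gt0.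
  have ty : `|t *: y| = del / 2 by rewrite normrZ gtr0_norm// /t divfK// gt_eqF.
  have tyd : `|t *: y| < del by rewrite ty; lra.
  have [_ [_ ]] := H (t *: y) tyd.
  have -> : `|dser a x (t *: y)| = t * `|L y|.
    by rewrite -[dser a x]LE linearZ normrZ ger0_norm// ltW.
  have -> : `|t *: y| = t * `|y| by rewrite normrZ ger0_norm// ltW.
  rewrite mulrCA ler_pM2l// => /le_trans; apply.
  by rewrite ler_pM2r//; near: r; apply: nbhs_pinfty_ge; rewrite num_real.
have E : pext a \o shift x = cst (pext a x) + L +o_ 0 id.
  apply/eqaddoP => e e0; near=> h.
  have hd : `|h| < Num.min del (e / (M + 1)).
    near: h; apply: nbhs0_lt; rewrite lt_min del0 divr_gt0//; lra.
  move: hd; rewrite lt_min => /andP[hd he].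
  have [xh [h1 _]] := H h hd.
  have -> : (pext a \o shift x - (cst (pext a x) + L)) h = pext a (h + x) - (pext a x + dser a x h) by [].
  rewrite (addrC h) /pext xh x1 opprD addrA; apply: le_trans h1 _.
  rewrite expr2 mulrA ler_wpM2r//.
  apply: (@le_trans _ _ ((M + 1) * `|h|)); first by rewrite ler_wpM2r// lerDl.
  by rewrite mulrC -ler_pdivlMr ?ltr_wpDl// ltW.
have dE := diff_unique cL E.
by split => //; apply/diff_locallyP; rewrite dE.
Unshelve. all: by end_near. Qed.

End Bounded.
End PowerSeries.

(** * Power series on slices *)

Section SliceSeries.
Variable R : realType.
Implicit Types (x y z h i j : quat R) (a : nat -> quat R).

(** Real and imaginary parts of the [n]-th power of [A + iB]. They do not involve the unit [i],
    which is why power series fit together across slices. *)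
Fixpoint zpow (A B : R) n : R * R :=
  if n is m.+1 then (A * (zpow A B m).1 - B * (zpow A B m).2, A * (zpow A B m).2 + B * (zpow A B m).1)
  else (1, 0).

Lemma slice_ptX i A B n : imag_sphere i ->
  slice_pt i A B ^+ n = slice_pt i (zpow A B n).1 (zpow A B n).2.
Proof.
move=> Si; elim: n => [|n IH]; first by rewrite expr0 slice_pt1.
by rewrite exprS IH slice_ptM.
Qed.

Lemma zpowN A B n : zpow A (- B) n = ((zpow A B n).1, - (zpow A B n).2).
Proof.
elim: n => [|n IH] /=; first by rewrite oppr0.
by rewrite IH /=; congr pair; ring.
Qed.

Definition repr_fst i j : quat R := 2^-1 *: (1 - j * i).
Definition repr_snd i j : quat R := 2^-1 *: (1 + j * i).

(** Each power at [slice_pt j A B] is the same left combination of the powers at the two conjugate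
    points of the slice of [i]; the coefficients [a k] stand on the right and do not interfere. *)
Lemma psum_repr a n i j A B : imag_sphere i -> imag_sphere j ->
  psum a n (slice_pt j A B) =
  repr_fst i j * psum a n (slice_pt i A B) + repr_snd i j * psum a n (slice_pt i A (- B)).
Proof.
move=> Si Sj; rewrite /psum !mulr_sumr -big_split/=; apply: eq_bigr => k _.
by rewrite !slice_ptX// zpowN /= (slice_repr _ _ Si Sj) mulrDl -!mulrA.
Qed.

Section Bounded.
Variables (a : nat -> quat R) (C : R).
Hypothesis aC : forall k, `|a k| <= C.

Lemma planar_discN (A B : R) : planar_disc A B -> planar_disc A (- B).
Proof. by rewrite /planar_disc sqrrN. Qed.

Lemma pext_repr i j A B : imag_sphere i -> imag_sphere j -> planar_disc A B ->
  pext a (slice_pt j A B) =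
  repr_fst i j * pext a (slice_pt i A B) + repr_snd i j * pext a (slice_pt i A (- B)).
Proof.
move=> Si Sj AB; have ABN := planar_discN AB.
have [nj ni niN] : [/\ `|slice_pt j A B| < 1, `|slice_pt i A B| < 1 & `|slice_pt i A (- B)| < 1].
  by split; apply/slice_pt_norm_lt1.
rewrite /pext nj ni niN; apply: cvg_lim => //.
have hh : repr_fst i j * psum a n (slice_pt i A B) + repr_snd i j * psum a n (slice_pt i A (- B)) @[n --> \oo] -->
   repr_fst i j * pser a (slice_pt i A B) + repr_snd i j * pser a (slice_pt i A (- B)).
  by apply: cvgD; apply: quat_mull_cvg; apply: psum_cvg aC _ _.
apply: cvg_trans hh; apply: near_eq_cvg; apply: nearW => n.
by rewrite (psum_repr _ _ _ _ Si Sj).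
Qed.

Lemma is_derive_line (F : quat R -> quat R) (g : R -> quat R) (v : quat R) (s : R) :
  (forall h : R, g (h + s) = h *: v + g s) -> differentiable F (g s) ->
  is_derive s 1 (F \o g) ('d F (g s) v).
Proof.
move=> gE dF; have dv : derivable F (g s) v by exact: diff_derivable.
have E : (fun h : R => h^-1 *: (((F \o g) \o shift s) (h *: (1 : R)) - (F \o g) s)) =
    (fun h : R => h^-1 *: ((F \o shift (g s)) (h *: v) - F (g s))).
  apply/funext => h; congr (_ *: (_ - _)).
  by rewrite /= gE /GRing.scale/= mulr1.
apply: DeriveDef; first by rewrite /derivable E.
by rewrite -(deriveE v dF) /derive E.
Qed.

Lemma is_derive_qmull (c : quat R) (F : R -> quat R) (s : R) (l : quat R) :
  is_derive s 1 F l -> is_derive s 1 (fun t => c * F t) (c * l).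
Proof.
move=> [dF Fl].
have E : (fun h : R => h^-1 *: (((fun t => c * F t) \o shift s) (h *: (1 : R)) - c * F s)) =
    (fun h : R => c * (h^-1 *: ((F \o shift s) (h *: (1 : R)) - F s))).
  by apply/funext => h; rewrite /= -mulrBr quat_scaleAr.
have cv : c * (h^-1 *: ((F \o shift s) (h *: (1 : R)) - F s)) @[h --> 0^'] --> c * l.
  by apply: quat_mull_cvg; rewrite -Fl; exact: dF.
apply: DeriveDef; first by rewrite /derivable E; apply/cvg_ex; exists (c * l).
by rewrite /derive E; apply: cvg_lim.
Qed.

(** On the slice of [e1], [al] is the even part in [B] and [i * be] the odd part, so the parities
    hold by construction. The representation formula gives the other slices, and [dser_comm] the
    Cauchy-Riemann equations. *)
Lemma pext_slice_hyperholomorphic : slice_hyperholomorphic (pext a).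
Proof.
split.
- by move=> x x1; rewrite /pext ltNge x1.
- by move=> x x1; exact: (pext_diff aC x1).1.
have S1 := e1_sphere R.
pose i := e1 R.
pose F (A B : R) := pext a (slice_pt i A B).
pose al (A B : R) := 2^-1 *: (F A B + F A (- B)).
pose be (A B : R) := (- 2^-1) *: (i * (F A B - F A (- B))).
pose D (A B : R) := dser a (slice_pt i A B) 1.
have dA (A B : R) : planar_disc A B -> is_derive A 1 (F^~ B) (D A B).
  move=> AB; have n1 : `|slice_pt i A B| < 1 by exact/slice_pt_norm_lt1.
  have [df dE] := pext_diff aC n1.
  rewrite -[D A B]/(dser a (slice_pt i A B) 1) -dE.
  apply: (@is_derive_line (pext a) (fun A => slice_pt i A B)) => // h.
  by rewrite /slice_pt scalerDl addrA.
have dB (A B : R) : planar_disc A B -> is_derive B 1 (F A) (i * D A B).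
  move=> AB; have n1 : `|slice_pt i A B| < 1 by exact/slice_pt_norm_lt1.
  have [df dE] := pext_diff aC n1.
  have -> : i * D A B = 'd (pext a) (slice_pt i A B) i.
    rewrite dE; apply/esym/(dser_comm aC) => //.
    by rewrite /slice_pt mulrDl mulrDr -!quat_scaleAl -!quat_scaleAr mul1r mulr1.
  apply: (@is_derive_line (pext a) (fun B => slice_pt i A B)) => // h.
  by rewrite /slice_pt scalerDl addrCA.
have dBN (A B : R) : planar_disc A B -> is_derive B 1 (fun B => F A (- B)) (- (i * D A (- B))).
  move=> AB; have ABN := planar_discN AB.
  have n1 : `|slice_pt i A (- B)| < 1 by exact/slice_pt_norm_lt1.
  have [df dE] := pext_diff aC n1.
  have -> : - (i * D A (- B)) = 'd (pext a) (slice_pt i A (- B)) (- i).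
    rewrite linearN; congr (- _); rewrite dE; apply/esym/(dser_comm aC) => //.
    by rewrite /slice_pt mulrDl mulrDr -!quat_scaleAl -!quat_scaleAr mul1r mulr1.
  apply: (@is_derive_line (pext a) (fun B => slice_pt i A (- B))) => // h.
  by rewrite /slice_pt opprD scalerDl scalerN scaleNr addrCA.
have dalA A B : planar_disc A B -> is_derive A 1 (al^~ B) (2^-1 *: (D A B + D A (- B))).
  by move=> AB; exact: (is_deriveZ 2^-1 (is_deriveD (dA A B AB) (dA A (- B) (planar_discN AB)))).
have dalB A B : planar_disc A B -> is_derive B 1 (al A) (2^-1 *: (i * D A B - i * D A (- B))).
  by move=> AB; exact: (is_deriveZ 2^-1 (is_deriveD (dB A B AB) (dBN A B AB))).
have dbeA A B : planar_disc A B -> is_derive A 1 (be^~ B) ((- 2^-1) *: (i * (D A B - D A (- B)))).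
  move=> AB.
  exact: (is_deriveZ (- 2^-1) (is_derive_qmull i (is_deriveB (dA A B AB) (dA A (- B) (planar_discN AB))))).
have dbeB A B : planar_disc A B -> is_derive B 1 (be A) ((- 2^-1) *: (i * (i * D A B - - (i * D A (- B))))).
  move=> AB.
  exact: (is_deriveZ (- 2^-1) (is_derive_qmull i (is_deriveB (dB A B AB) (dBN A B AB)))).
exists al, be; split.
- move=> j A B Sj B0 AB; rewrite (pext_repr S1 Sj AB) -/(F A B) -/(F A (- B)) /al /be /repr_fst /repr_snd -/i.
  move: (F A B) (F A (- B)) => u v.
  rewrite -!quat_scaleAl -quat_scaleAr mulrBl mulrDl !mul1r mulrBr mulrBr !mulrA.
  move: (j * i * u) (j * i * v) => w z.
  by apply: qcoord_ext => l; rewrite !(qcoordZ, qcoordD, qcoordN); ring.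
- move=> A B AB; rewrite /al /be opprK; split; first by rewrite addrC.
  by rewrite -scalerN -mulrN opprB.
- move=> A B AB; split.
  + by have [] := dalA A B AB.
  + by have [] := dalB A B AB.
  + by have [] := dbeA A B AB.
  + by have [] := dbeB A B AB.
- move=> A B AB.
  have [_ E1] := dalA A B AB; have [_ E2] := dalB A B AB.
  have [_ E3] := dbeA A B AB; have [_ E4] := dbeB A B AB.
  split.
    apply: (etrans E1); apply: (etrans _ (esym E4)).
    by rewrite opprK -mulrDr mulrA (imag_sphere_sq S1) mulN1r scaleNr scalerN opprK.
  apply: (etrans E3); apply: (etrans _ (congr1 -%R (esym E2))).
  by rewrite -mulrBr scaleNr.
Qed.

(** By De Moivre's formula the cosine goes with [a m] and the sine with [i * a m]; this reduces
    quaternionic series on a circle to four real trigonometric series. *)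
Lemma qcoord_psum k n i (r t : R) : imag_sphere i ->
  qcoord k (psum a n (r *: circle_pt i t)) =
  harm (fun m => qcoord k (a m)) (fun m => qcoord k (i * a m)) n r t.
Proof.
move=> Si; rewrite /psum qcoord_sum /harm; apply: eq_bigr => m _.
rewrite circle_ptX// -quat_scaleAl qcoordZ /circle_pt /slice_pt mulrDl -!quat_scaleAl mul1r.
by rewrite qcoordD !qcoordZ; ring.
Qed.

Lemma qcoord_bound k i : imag_sphere i ->
  coef_bound (fun m => qcoord k (a m)) (fun m => qcoord k (i * a m)) (C + C).
Proof.
move=> [_ i1] m; apply: lerD; apply: le_trans (qcoord_le_norm _ _) _ => //.
by rewrite quat_normM i1 mul1r.
Qed.

Lemma circle_norm i (r t : R) : imag_sphere i -> 0 <= r -> `|r *: circle_pt i t| = r.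
Proof. by move=> Si r0; rewrite normrZ circle_pt_norm// mulr1 ger0_norm. Qed.

Lemma qcoord_pext k i (r t : R) : imag_sphere i -> 0 <= r < 1 ->
  qcoord k (pext a (r *: circle_pt i t)) =
  harms (fun m => qcoord k (a m)) (fun m => qcoord k (i * a m)) r t.
Proof.
move=> Si /andP[r0 r1]; have n1 : `|r *: circle_pt i t| < 1 by rewrite circle_norm.
rewrite /pext n1; apply/esym/cvg_lim => //.
have E : (fun n => harm (fun m => qcoord k (a m)) (fun m => qcoord k (i * a m)) n r t) =
    (fun n => qcoord k (psum a n (r *: circle_pt i t))).
  by apply/funext => n; rewrite qcoord_psum.
by rewrite E; move: (psum_cvg aC n1) => /quat_cvgP/(_ k).
Qed.

(** As [i] has norm 1, [a m] and [i * a m] contribute equally, which cancels the factor 1/2 in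
    [wt]. *)
Lemma sum_wt_qcoord i m : imag_sphere i ->
  \sum_k wt (fun m => qcoord k (a m)) (fun m => qcoord k (i * a m)) m = `|a m| ^+ 2.
Proof.
move=> [_ i1]; rewrite /wt; case: eqVneq => [->|_]; first by rewrite -quat_norm_sum.
have -> : \sum_k (qcoord k (a m) ^+ 2 + qcoord k (i * a m) ^+ 2) / 2 =
   (\sum_k qcoord k (a m) ^+ 2 + \sum_k qcoord k (i * a m) ^+ 2) / 2.
  by rewrite -mulr_suml big_split.
rewrite -!quat_norm_sum quat_normM i1 mul1r; move: (`|a m| ^+ 2) => w; lra.
Qed.

End Bounded.
End SliceSeries.

(** * Expansion of slice hyperholomorphic functions *)

Section Gradients.
Variable R : realType.
Implicit Types (P Q : R -> R -> R) (x y : R).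

(** Phrased with the differential, so that sums, products and composites follow from its calculus;
    [has_partials_has_grad] then gives the form needed for Goursat's theorem. *)
Definition has_partials P x y (p1 p2 : R) :=
  [/\ differentiable (fun p : R * R => P p.1 p.2) (x, y),
      'd (fun p : R * R => P p.1 p.2) (x, y) (1, 0) = p1 &
      'd (fun p : R * R => P p.1 p.2) (x, y) (0, 1) = p2].

Lemma has_partials_has_grad P x y p1 p2 : has_partials P x y p1 p2 -> has_grad P x y p1 p2.
Proof.
move=> [dP <- <-] e e0; have := diff_locally dP; set L := 'd _ _.
move=> /eqaddoP/(_ _ e0).
case/nbhs_norm0P => del /= del0 H; exists del => // h k hd kd.
have nhk : `|(h, k) : R * R| < del by rewrite prod_normE /= gt_max hd kd.
have := H (h, k) nhk; rewrite /= => H1.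
have LE : L (h, k) = L (1, 0) * h + L (0, 1) * k.
  have -> : (h, k) = h *: ((1, 0) : R * R) + k *: ((0, 1) : R * R).
    by congr pair; rewrite /= /GRing.scale /= ?mulr1 ?mulr0 ?addr0 ?add0r.
  by rewrite linearD !linearZ /= /GRing.scale /= mulrC (mulrC k).
rewrite -LE.
have -> : P (x + h) (y + k) - P x y - L (h, k) =
  ((fun p : R * R => P p.1 p.2) \o shift (x, y) - (cst (P x y) + L)) (h, k).
  by rewrite /= -[RHS]/(P (h + x) (k + y) - (P x y + L (h, k))) (addrC h) (addrC k) opprD addrA.
apply: le_trans H1 _; rewrite ler_wpM2l ?(ltW e0)//.
by rewrite prod_normE /= ge_max lerDl lerDr !normr_ge0.
Qed.

Lemma fst_continuous : continuous (@fst R R). Proof. by move=> p; exact: cvg_fst. Qed.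
Lemma snd_continuous : continuous (@snd R R). Proof. by move=> p; exact: cvg_snd. Qed.

Lemma has_partials_x (u : R -> R) x y (du : R) : is_derive x 1 u du -> has_partials (fun x _ => u x) x y du 0.
Proof.
move=> [du1 du2]; have dfst : differentiable (@fst R R) (x, y).
  exact: (linear_differentiable (f := [the {linear (R * R)%type -> R} of @fst R R]) _ fst_continuous).
have Df : 'd (@fst R R) (x, y) = @fst R R :> (_ -> _).
  exact: (diff_lin (f := [the {linear (R * R)%type -> R} of @fst R R]) _ fst_continuous).
have ddu : differentiable u ((@fst R R) (x, y)) by exact/derivable1_diffP.
have E : 'd (u \o @fst R R) (x, y) = 'd u x \o @fst R R :> (_ -> _).
  by rewrite (diff_comp dfst ddu) Df.
split; first exact: (differentiable_comp dfst ddu).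
  by rewrite -[LHS]/('d (u \o @fst R R) (x, y) (1, 0)) E /= -deriveE.
by rewrite -[LHS]/('d (u \o @fst R R) (x, y) (0, 1)) E /= linear0.
Qed.

Lemma has_partials_y (u : R -> R) x y (du : R) : is_derive y 1 u du -> has_partials (fun _ y => u y) x y 0 du.
Proof.
move=> [du1 du2]; have dsnd : differentiable (@snd R R) (x, y).
  exact: (linear_differentiable (f := [the {linear (R * R)%type -> R} of @snd R R]) _ snd_continuous).
have Df : 'd (@snd R R) (x, y) = @snd R R :> (_ -> _).
  exact: (diff_lin (f := [the {linear (R * R)%type -> R} of @snd R R]) _ snd_continuous).
have ddu : differentiable u ((@snd R R) (x, y)) by exact/derivable1_diffP.
have E : 'd (u \o @snd R R) (x, y) = 'd u y \o @snd R R :> (_ -> _).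
  by rewrite (diff_comp dsnd ddu) Df.
split; first exact: (differentiable_comp dsnd ddu).
  by rewrite -[LHS]/('d (u \o @snd R R) (x, y) (1, 0)) E /= linear0.
by rewrite -[LHS]/('d (u \o @snd R R) (x, y) (0, 1)) E /= -deriveE.
Qed.

Lemma has_partialsM P Q x y p1 p2 q1 q2 : has_partials P x y p1 p2 -> has_partials Q x y q1 q2 ->
  has_partials (fun x y => P x y * Q x y) x y (P x y * q1 + Q x y * p1) (P x y * q2 + Q x y * p2).
Proof.
move=> [dP <- <-] [dQ <- <-].
have E := diffM dP dQ.
split; first exact: (differentiableM dP dQ).
  exact: (congr1 (fun g => g (1, 0)) E).
exact: (congr1 (fun g => g (0, 1)) E).
Qed.

Lemma has_partialsD P Q x y p1 p2 q1 q2 : has_partials P x y p1 p2 -> has_partials Q x y q1 q2 ->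
  has_partials (fun x y => P x y + Q x y) x y (p1 + q1) (p2 + q2).
Proof.
move=> [dP <- <-] [dQ <- <-].
have E := diffD dP dQ.
split; first exact: (differentiableD dP dQ).
  exact: (congr1 (fun g => g (1, 0)) E).
exact: (congr1 (fun g => g (0, 1)) E).
Qed.

Lemma has_partialsN P x y p1 p2 : has_partials P x y p1 p2 -> has_partials (fun x y => - P x y) x y (- p1) (- p2).
Proof.
move=> [dP <- <-].
have E := diffN dP.
split; first exact: (differentiableN dP).
  exact: (congr1 (fun g => g (1, 0)) E).
exact: (congr1 (fun g => g (0, 1)) E).
Qed.

Lemma has_partials_eq P x y p1 p2 q1 q2 : has_partials P x y p1 p2 -> p1 = q1 -> p2 = q2 -> has_partials P x y q1 q2.
Proof. by move=> H <- <-. Qed.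

(** The exponential of [x + iy] in the slice of [i]: it maps [x < 0] onto the punctured disc,
    vertical lines onto circles, with period [2 * pi] in [y]. *)
Definition log_polar (i : quat R) x y : quat R :=
  slice_pt i (expR x * cos y) (expR x * sin y).

Lemma log_polarE i x y : log_polar i x y = expR x *: circle_pt i y.
Proof. by rewrite /log_polar -slice_ptZ. Qed.

(** Chain rule with [exp' = exp]: by the Cauchy-Riemann hypothesis the differential of [f] along the
    slice is right multiplication of the direction by [A], and the directions are [z] for [x] and
    [i * z] for [y]. *)
Lemma has_partials_log_polar (i : quat R) (f : quat R -> quat R) (T : {linear quat R -> R^o}) x y :
  imag_sphere i ->
  continuous T -> differentiable f (log_polar i x y) ->
  'd f (log_polar i x y) i = i * 'd f (log_polar i x y) 1 ->
  has_partials (fun x y => T (f (log_polar i x y))) x y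
    (T (log_polar i x y * 'd f (log_polar i x y) 1))
    (T (i * (log_polar i x y * 'd f (log_polar i x y) 1))).
Proof.
move=> Si cT df CR; set z := log_polar i x y in df CR *; set A := 'd f z 1 in CR *.
have g1 : has_partials (fun x y => expR x * cos y) x y (expR x * cos y) (- (expR x * sin y)).
  apply: has_partials_eq (has_partialsM (has_partials_x y (is_derive_expR x)) (has_partials_y x (is_derive_cos y))) _ _; ring.
have g2 : has_partials (fun x y => expR x * sin y) x y (expR x * sin y) (expR x * cos y).
  apply: has_partials_eq (has_partialsM (has_partials_x y (is_derive_expR x)) (has_partials_y x (is_derive_sin y))) _ _; ring.
have [d1 e11 e12] := g1; have [d2 e21 e22] := g2.
pose L p := log_polar i p.1 p.2.
have dL1 := differentiableZl (1 : quat R) d1; have dL2 := differentiableZl i d2.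
have dL : differentiable L (x, y) := differentiableD dL1 dL2.
have EL v : 'd L (x, y) v = 'd (fun p : R * R => expR p.1 * cos p.2) (x, y) v *: (1 : quat R)
   + 'd (fun p : R * R => expR p.1 * sin p.2) (x, y) v *: i.
  apply: (etrans (congr1 (fun g => g v) (diffD dL1 dL2))).
  by congr (_ + _); [exact: (congr1 (fun g => g v) (diffZl _ d1))|exact: (congr1 (fun g => g v) (diffZl _ d2))].
have dT w : differentiable T w by exact: linear_differentiable.
have DT w : 'd T w = T :> (_ -> _) by exact: diff_lin.
have dfL : differentiable (f \o L) (x, y) by exact: differentiable_comp.
have ET v : 'd (T \o (f \o L)) (x, y) v = T ('d f z ('d L (x, y) v)).
  apply: (etrans (congr1 (fun g => g v) (diff_comp dfL (dT _)))).
  apply: (etrans (congr1 (fun g => g _) (DT _))); congr (T _).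
  exact: (congr1 (fun g => g v) (diff_comp dL df)).
have Ef (s t : R) : 'd f z (slice_pt i s t) = slice_pt i s t * A.
  by rewrite /slice_pt linearD !linearZ CR mulrDl -!quat_scaleAl mul1r.
split; first exact: (differentiable_comp dfL (dT _)).
  rewrite -[LHS]/('d (T \o (f \o L)) (x, y) (1, 0)) ET EL e11 e21.
  by rewrite -[X in 'd f z X]/(slice_pt i _ _) Ef.
rewrite -[LHS]/('d (T \o (f \o L)) (x, y) (0, 1)) ET EL e12 e22.
rewrite -[X in 'd f z X]/(slice_pt i _ _) Ef mulrA; congr (T (_ * _)).
have -> : i * z = slice_pt i 0 1 * z by rewrite slice_pti.
by rewrite /z /log_polar slice_ptM//; congr slice_pt; ring.
Qed.

End Gradients.

(** * The Cauchy-Riemann equations on a slice *)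

Section SliceCauchyRiemann.
Variable R : realType.
Variable f : quat R -> quat R.
Hypothesis Hf : slice_hyperholomorphic f.

Lemma planar_disc_near (a b : R) : planar_disc a b ->
  (\forall a' \near a, planar_disc a' b) /\ (\forall b' \near b, planar_disc a b').
Proof.
move=> ab; split.
- have : (fun a' : R => a' ^+ 2 + b ^+ 2) @ a --> a ^+ 2 + b ^+ 2.
    by apply: cvgD; [exact: exprn_continuous|exact: cvg_cst].
  by move=> /cvgr_lt/(_ _ ab).
- have : (fun b' : R => a ^+ 2 + b' ^+ 2) @ b --> a ^+ 2 + b ^+ 2.
    by apply: cvgD; [exact: cvg_cst|exact: exprn_continuous].
  by move=> /cvgr_lt/(_ _ ab).
Qed.

(** Both directional derivatives are computed once through the differential of [f] and once through
    the partial derivatives of [al] and [be]. *)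
Lemma slice_cauchy_riemann (i : quat R) (a b : R) : imag_sphere i -> planar_disc a b ->
  'd f (slice_pt i a b) i = i * 'd f (slice_pt i a b) 1.
Proof.
move=> Si ab; have [_ df [al [be [Hal sym der CR]]]] := Hf.
(* The formula is given for [b' >= 0] only; the unit [- i] and the parities extend it, so that it
   can be differentiated across the real axis. *)
have E (a' b' : R) : planar_disc a' b' -> f (slice_pt i a' b') = al a' b' + i * be a' b'.
  move=> ab'; have [b0|b0] := leP 0 b'; first exact: Hal.
  have := Hal (- i) a' (- b') (imag_sphereN Si); rewrite oppr_ge0 (ltW b0) => /(_ isT (planar_discN ab')).
  have [-> ->] := sym a' b' ab'; rewrite mulrNN => <-.
  by rewrite /slice_pt scalerN scaleNr opprK.
have n1 : `|slice_pt i a b| < 1 by exact/(slice_pt_norm_lt1 Si).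
have dz := df _ n1; have [na nb] := planar_disc_near ab.
have [d1 d2 d3 d4] := der a b ab; have [CR1 CR2] := CR a b ab.
have A1 : is_derive a 1 (f \o (fun a => slice_pt i a b)) ('d f (slice_pt i a b) 1).
  by apply: (@is_derive_line R f (fun a => slice_pt i a b)) => // h; rewrite /slice_pt scalerDl addrA.
have A2 : is_derive b 1 (f \o (fun b => slice_pt i a b)) ('d f (slice_pt i a b) i).
  by apply: (@is_derive_line R f (fun b => slice_pt i a b)) => // h; rewrite /slice_pt scalerDl addrCA.
have B1 : is_derive a 1 (fun a => al a b + i * be a b) ('D_1 (al^~ b) a + i * 'D_1 (be^~ b) a).
  exact: (is_deriveD (derivableP d1) (is_derive_qmull i (derivableP d3))).
have B2 : is_derive b 1 (fun b => al a b + i * be a b) ('D_1 (al a) b + i * 'D_1 (be a) b).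
  exact: (is_deriveD (derivableP d2) (is_derive_qmull i (derivableP d4))).
have C1 : is_derive a 1 (fun a => al a b + i * be a b) ('d f (slice_pt i a b) 1).
  by apply: near_eq_is_derive A1; apply: filterS na => a' ab'; rewrite /= E.
have C2 : is_derive b 1 (fun b => al a b + i * be a b) ('d f (slice_pt i a b) i).
  by apply: near_eq_is_derive A2; apply: filterS nb => b' ab'; rewrite /= E.
have [_ b1] := B1; have [_ b2] := B2; have [_ c1] := C1; have [_ c2] := C2.
rewrite -c1 -c2 b1 b2 CR1 CR2 mulrDr mulrA (imag_sphere_sq Si) mulN1r opprK.
by rewrite addrC.
Qed.

End SliceCauchyRiemann.

(** * Fourier modes of a conjugate pair *)

Section HarmonicPair.
Variable R : realType.
Variables (U V : R -> R -> R).
(** [V] is a harmonic conjugate of [U] in the variable [x + iy] of the left half plane; [bUV] below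
    is boundedness near the centre of the disc, where [x] tends to minus infinity. *)
Hypothesis CR : forall x y, x < 0 -> exists u1 u2, has_partials U x y u1 u2 /\ has_partials V x y (- u2) u1.
Hypothesis pU : forall x y, U x (y + 2 * pi) = U x y.
Hypothesis pV : forall x y, V x (y + 2 * pi) = V x y.
Hypothesis bUV : exists M x0 : R, x0 < 0 /\ forall x y, x <= x0 -> `|U x y| <= M /\ `|V x y| <= M.

Lemma pairU_continuous (x : R) : x < 0 -> continuous (U x).
Proof.
by move=> x0 y; have [u1 [u2 [g _]]] := CR y x0; exact: (has_grad_cont (has_partials_has_grad g)).2.
Qed.

Lemma pairV_continuous (x : R) : x < 0 -> continuous (V x).
Proof.
by move=> x0 y; have [u1 [u2 [_ g]]] := CR y x0; exact: (has_grad_cont (has_partials_has_grad g)).2.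
Qed.

(** [X] and [Y] are the real and imaginary parts of [(U + iV) exp (- m (x + iy))], again a conjugate
    pair. Integration over a period extracts the mode [n] for [m = n] and the mode [- n] for
    [m = - n]. *)
Let X (m x y : R) := expR (- m * x) * (U x y * cos (m * y) + V x y * sin (m * y)).
Let Y (m x y : R) := expR (- m * x) * (V x y * cos (m * y) - U x y * sin (m * y)).

Let has_partials_exp (m x y : R) : has_partials (fun x _ => expR (- m * x)) x y (- m * expR (- m * x)) 0.
Proof.
apply: has_partials_x; have := @is_derive_comp_affine R expR _ (- m) 0 x (is_derive_expR _).
by rewrite addr0; congr is_derive; apply/funext => z; rewrite addr0.
Qed.

Let has_partials_cos (m x y : R) : has_partials (fun _ y => cos (m * y)) x y 0 (- m * sin (m * y)).
Proof. by apply: has_partials_y; exact: is_derive_cosM. Qed.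

Let has_partials_sin (m x y : R) : has_partials (fun _ y => sin (m * y)) x y 0 (m * cos (m * y)).
Proof. by apply: has_partials_y; exact: is_derive_sinM. Qed.

Let has_partialsXY m x y : x < 0 -> exists x1 x2, has_partials (X m) x y x1 x2 /\ has_partials (Y m) x y (- x2) x1.
Proof.
move=> x0; have [u1 [u2 [gU gV]]] := CR y x0.
have gX := has_partialsM (has_partials_exp m x y) (has_partialsD (has_partialsM gU (has_partials_cos m x y)) (has_partialsM gV (has_partials_sin m x y))).
have gY := has_partialsM (has_partials_exp m x y) (has_partialsD (has_partialsM gV (has_partials_cos m x y)) (has_partialsN (has_partialsM gU (has_partials_sin m x y)))).
eexists; eexists; split; first exact: gX.
by apply: has_partials_eq gY _ _; ring.
Qed.

(** The forms [Y dx + X dy] and [- X dx + Y dy] are closed, and [period_const] applies to both. *)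
Let XY_const m x1 x2 : x1 < 0 -> x2 < 0 ->
  (forall y, cos (m * (y + 2 * pi)) = cos (m * y)) ->
  (forall y, sin (m * (y + 2 * pi)) = sin (m * y)) ->
  segint (X m x1) 0 (0 + 2 * pi) = segint (X m x2) 0 (0 + 2 * pi) /\
  segint (Y m x1) 0 (0 + 2 * pi) = segint (Y m x2) 0 (0 + 2 * pi).
Proof.
move=> n1 n2 pc ps; wlog x12 : x1 x2 n1 n2 / x1 <= x2.
  move=> H; have [/H|/ltW/H] := leP x1 x2; first exact.
  by case=> // -> ->.
have p2 : 0 <= 2 * pi :> R by rewrite ltW// twopi0.
split.
- apply: (@period_const R (Y m) (X m) 0 (2 * pi) x1 x2 p2 _ _ x12).
  + by move=> x y _; rewrite /Y pU pV pc ps.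
  + move=> x y /andP[_ xx]; have [a1 [a2 [gX gY]]] := has_partialsXY m y (le_lt_trans xx n2).
    by exists (- a2), a1, a2; split; exact: has_partials_has_grad.
- apply: (@period_const R (fun x y => - X m x y) (Y m) 0 (2 * pi) x1 x2 p2 _ _ x12).
  + by move=> x y _; rewrite /X pU pV pc ps.
  + move=> x y /andP[_ xx]; have [a1 [a2 [gX gY]]] := has_partialsXY m y (le_lt_trans xx n2).
    by exists (- a1), (- a2), a1; split; apply: has_partials_has_grad => //; exact: has_partialsN.
Qed.

Definition cos_coef (W : R -> R -> R) (n : nat) x := segint (fun y => W x y * cos (n%:R * y)) 0 (2 * pi).
Definition sin_coef (W : R -> R -> R) (n : nat) x := segint (fun y => W x y * sin (n%:R * y)) 0 (2 * pi).

Let cUc n x : x < 0 -> continuous (fun y => U x y * cos (n%:R * y)).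
Proof. by move=> x0 y; apply: cvgM; [exact: pairU_continuous|exact: cos_mul_continuous]. Qed.
Let cUs n x : x < 0 -> continuous (fun y => U x y * sin (n%:R * y)).
Proof. by move=> x0 y; apply: cvgM; [exact: pairU_continuous|exact: sin_mul_continuous]. Qed.
Let cVc n x : x < 0 -> continuous (fun y => V x y * cos (n%:R * y)).
Proof. by move=> x0 y; apply: cvgM; [exact: pairV_continuous|exact: cos_mul_continuous]. Qed.
Let cVs n x : x < 0 -> continuous (fun y => V x y * sin (n%:R * y)).
Proof. by move=> x0 y; apply: cvgM; [exact: pairV_continuous|exact: sin_mul_continuous]. Qed.

Let addcont (g h : R -> R) : continuous g -> continuous h -> continuous (fun y => g y + h y).
Proof. by move=> cg ch y; apply: cvgD; [exact: cg|exact: ch]. Qed.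
Let subcont (g h : R -> R) : continuous g -> continuous h -> continuous (fun y => g y - h y).
Proof. by move=> cg ch y; apply: cvgB; [exact: cg|exact: ch]. Qed.

Let XY_pos n x : x < 0 ->
  segint (X n%:R x) 0 (0 + 2 * pi) = expR (- n%:R * x) * (cos_coef U n x + sin_coef V n x) /\
  segint (Y n%:R x) 0 (0 + 2 * pi) = expR (- n%:R * x) * (cos_coef V n x - sin_coef U n x).
Proof.
move=> x0; rewrite add0r; split.
- rewrite segintZ; first by rewrite segintD//; apply: cont_onT; [exact: cUc|exact: cVs].
  by apply: cont_onT; apply: addcont; [exact: cUc|exact: cVs].
- rewrite segintZ; first by rewrite segintB//; apply: cont_onT; [exact: cVc|exact: cUs].
  by apply: cont_onT; apply: subcont; [exact: cVc|exact: cUs].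
Qed.

Let XY_neg n x : x < 0 ->
  segint (X (- n%:R) x) 0 (0 + 2 * pi) = expR (n%:R * x) * (cos_coef U n x - sin_coef V n x) /\
  segint (Y (- n%:R) x) 0 (0 + 2 * pi) = expR (n%:R * x) * (cos_coef V n x + sin_coef U n x).
Proof.
move=> x0; rewrite add0r; split.
- rewrite (@eq_segint _ _ (fun y => expR (n%:R * x) * (U x y * cos (n%:R * y) - V x y * sin (n%:R * y)))).
    rewrite segintZ; first by rewrite segintB//; apply: cont_onT; [exact: cUc|exact: cVs].
    by apply: cont_onT; apply: subcont; [exact: cUc|exact: cVs].
  by move=> y _; rewrite /X opprK mulNr cosN sinN mulrN.
- rewrite (@eq_segint _ _ (fun y => expR (n%:R * x) * (V x y * cos (n%:R * y) + U x y * sin (n%:R * y)))).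
    rewrite segintZ; first by rewrite segintD//; apply: cont_onT; [exact: cVc|exact: cUs].
    by apply: cont_onT; apply: addcont; [exact: cVc|exact: cUs].
  by move=> y _; rewrite /Y opprK mulNr cosN sinN mulrN opprK.
Qed.

Let p2 : 0 <= 2 * pi :> R. Proof. by rewrite ltW// twopi0. Qed.

Let coef_bounds : exists M x0 : R, [/\ x0 < 0, 0 <= M & forall n x, x <= x0 ->
  [/\ `|cos_coef U n x| <= M, `|sin_coef U n x| <= M, `|cos_coef V n x| <= M & `|sin_coef V n x| <= M]].
Proof.
have [M [x0 [x00 HM]]] := bUV; exists (M * (2 * pi - 0)), x0; split => //.
  rewrite subr0 mulr_ge0//; have [+ _] := HM x0 0 (lexx _); exact: le_trans.
move=> n x xx0; have x0' := le_lt_trans xx0 x00.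
have K1 y : `|cos (n%:R * y)| <= 1 by exact: cos_max.
have K2 y : `|sin (n%:R * y)| <= 1 by exact: sin_max.
have Mb (w e : R) : `|w| <= M -> `|e| <= 1 -> `|w * e| <= M.
  by move=> hw he; rewrite normrM -[leRHS]mulr1; apply: ler_pM.
split; apply: segint_bound => //.
- exact/cont_onT/cUc.
- by move=> y _; apply: Mb => //; exact: (HM x y xx0).1.
- exact/cont_onT/cUs.
- by move=> y _; apply: Mb => //; exact: (HM x y xx0).1.
- exact/cont_onT/cVc.
- by move=> y _; apply: Mb => //; exact: (HM x y xx0).2.
- exact/cont_onT/cVs.
- by move=> y _; apply: Mb => //; exact: (HM x y xx0).2.
Qed.

(* A negative Fourier mode would grow like [exp (- n x)] towards the origin,
   where the pair is bounded. *)
Let vanish n (g : R -> R) (M x0 : R) : (0 < n)%N -> x0 < 0 -> 0 <= M ->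
  (forall x, x <= x0 -> `|g x| <= M) ->
  (forall x1 x2, x1 < 0 -> x2 < 0 -> expR (n%:R * x1) * g x1 = expR (n%:R * x2) * g x2) ->
  forall x, x < 0 -> g x = 0.
Proof.
move=> n0 x00 M0 gM gc x xn.
suff : expR (n%:R * x) * g x = 0 by move/eqP; rewrite mulf_eq0 gt_eqF ?expR_gt0//= => /eqP.
apply/eqP; rewrite -normr_le0; apply/ler_addgt0Pr => e e0; rewrite add0r.
pose z := Num.min x0 (ln (e / (M + 1))).
have M1 : 0 < M + 1 by lra.
have zx0 : z <= x0 by rewrite ge_min lexx.
have z0 : z < 0 by exact: le_lt_trans x00.
rewrite (gc x z xn z0) normrM gtr0_norm ?expR_gt0//.
apply: (@le_trans _ _ (expR z * M)).
  apply: ler_pM => //; last exact: gM.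
  rewrite ler_expR -[leRHS]mul1r; apply: ler_wnM2r; first exact: ltW.
  by rewrite ler1n.
apply: (@le_trans _ _ (e / (M + 1) * (M + 1))); last by rewrite divfK// gt_eqF.
apply: ler_pM => //; last by rewrite lerDl.
rewrite -[leRHS](@lnK R); last by rewrite posrE divr_gt0.
by rewrite ler_expR ge_min lexx orbT.
Qed.

(** The vanishing of the mode [- n] gives [cos_coef U = sin_coef V] and [sin_coef U = - cos_coef V].
    The invariance of the mode [n], which involves [cos_coef U + sin_coef V], thereby becomes one of
    [cos_coef U] alone. *)
Lemma pair_coefs n : 
  (forall x1 x2, x1 < 0 -> x2 < 0 ->
     expR (- n%:R * x1) * cos_coef U n x1 = expR (- n%:R * x2) * cos_coef U n x2) /\
  ((0 < n)%N -> forall x, x < 0 -> sin_coef U n x = - cos_coef V n x).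
Proof.
have cp y : cos (n%:R * (y + 2 * pi)) = cos (n%:R * y) :> R by exact: cos_mul_2pi.
have sp y : sin (n%:R * (y + 2 * pi)) = sin (n%:R * y) :> R by exact: sin_mul_2pi.
have cn y : cos (- n%:R * (y + 2 * pi)) = cos (- n%:R * y) :> R by rewrite !mulNr !cosN cp.
have sn y : sin (- n%:R * (y + 2 * pi)) = sin (- n%:R * y) :> R by rewrite !mulNr !sinN sp.
have [M [x0 [x00 M0 HM]]] := coef_bounds.
have P1 x1 x2 : x1 < 0 -> x2 < 0 -> expR (- n%:R * x1) * (cos_coef U n x1 + sin_coef V n x1) =
   expR (- n%:R * x2) * (cos_coef U n x2 + sin_coef V n x2).
  by move=> n1 n2; have [E _] := XY_const n1 n2 cp sp; rewrite -(XY_pos n n1).1 -(XY_pos n n2).1.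
have [->|n0] := posnP n.
  split => // x1 x2 n1 n2; have := XY_const n1 n2 (cos_mul_2pi 0) (sin_mul_2pi 0).
  have S0 x : sin_coef V 0 x = 0.
    rewrite /sin_coef (@eq_segint _ _ (fun=> 0)) ?segint_cst ?mul0r//.
    by move=> y _; rewrite mul0r sin0 mulr0.
  by rewrite (XY_pos 0 n1).1 (XY_pos 0 n2).1 !S0 !addr0 => -[].
have Z1 : forall x, x < 0 -> cos_coef U n x - sin_coef V n x = 0.
  apply: (@vanish n _ (M + M) x0 n0 x00); first by rewrite addr_ge0.
    move=> x xx; have [h1 h2 h3 h4] := HM n x xx; apply: le_trans (ler_normB _ _) _; exact: lerD.
  by move=> x1 x2 n1 n2; have [E _] := XY_const n1 n2 cn sn; rewrite -(XY_neg n n1).1 -(XY_neg n n2).1.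
have Z2 : forall x, x < 0 -> cos_coef V n x + sin_coef U n x = 0.
  apply: (@vanish n _ (M + M) x0 n0 x00); first by rewrite addr_ge0.
    move=> x xx; have [h1 h2 h3 h4] := HM n x xx; apply: le_trans (ler_normD _ _) _; exact: lerD.
  by move=> x1 x2 n1 n2; have [_ E] := XY_const n1 n2 cn sn; rewrite -(XY_neg n n1).2 -(XY_neg n n2).2.
split.
  move=> x1 x2 n1 n2; have := P1 x1 x2 n1 n2.
  have := Z1 x1 n1; have := Z1 x2 n2.
  move=> /eqP; rewrite subr_eq0 => /eqP <- /eqP; rewrite subr_eq0 => /eqP <-.
  move: (expR _) (expR _) (cos_coef _ _ _) (cos_coef _ _ _) => u v y z E; lra.
by move=> _ x xn; have /eqP := Z2 x xn; rewrite addrC addr_eq0 => /eqP.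
Qed.

End HarmonicPair.

(** * Coefficients of a slice hyperholomorphic function *)

Section SliceExpansion.
Variable R : realType.

Let qcoord_linear k (c : quat R) : linear (fun v : quat R => qcoord k (c * v) : R^o).
Proof. by move=> s u v /=; rewrite mulrDr -quat_scaleAr qcoordD qcoordZ. Qed.

Definition qcoordl k (c : quat R) : {linear quat R -> R^o} :=
  HB.pack (fun v : quat R => qcoord k (c * v) : R^o)
   (GRing.isLinear.Build R (quat R) R^o *:%R (fun v : quat R => qcoord k (c * v) : R^o) (qcoord_linear k c)).

Lemma qcoordlE k c v : qcoordl k c v = qcoord k (c * v). Proof. by []. Qed.

Lemma qcoordl_continuous k c : continuous (qcoordl k c).
Proof.
apply: (@bounded_linear_continuous _ _ _ (qcoordl k c)); apply/linear_boundedP.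
near=> r => v; rewrite qcoordlE; apply: le_trans (qcoord_le_norm _ _) _.
by rewrite quat_normM ler_wpM2r//; near: r; apply: nbhs_pinfty_ge; rewrite num_real.
Unshelve. all: by end_near. Qed.

Definition quat_of (g : 'I_4 -> R) : quat R :=
  Quat (g (@Ordinal 4 0 isT)) (g (@Ordinal 4 1 isT)) (g (@Ordinal 4 2 isT)) (g (@Ordinal 4 3 isT)).

Lemma qcoord_of k g : qcoord k (quat_of g) = g k.
Proof. by case: k => -[|[|[|[|//]]]] kp; rewrite /qcoord /=; congr g; apply: val_inj. Qed.

(** Multiplication by [- e1] permutes the coordinates up to sign, so the conjugate [V k] is a signed
    coordinate of [f] itself, and its cosine coefficients are already known. *)
Lemma qcoord_e1 k : exists (s : R) l, forall v, qcoord k (- e1 R * v) = s * qcoord l v.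
Proof.
case: k => -[|[|[|[|//]]]] kp; rewrite /qcoord /=.
- by exists 1, (@Ordinal 4 1 isT) => v /=; rewrite /qcoord /=; ring.
- by exists (- 1), (@Ordinal 4 0 isT) => v /=; rewrite /qcoord /=; ring.
- by exists 1, (@Ordinal 4 3 isT) => v /=; rewrite /qcoord /=; ring.
- by exists (- 1), (@Ordinal 4 2 isT) => v /=; rewrite /qcoord /=; ring.
Qed.

Variable f : quat R -> quat R.
Hypothesis Hf : slice_hyperholomorphic f.

Let i := e1 R.
Let Si : imag_sphere i := e1_sphere R.

Let z_lt1 x y : x < 0 -> `|log_polar i x y| < 1.
Proof.
move=> x0; rewrite log_polarE normrZ (circle_pt_norm Si) mulr1 gtr0_norm ?expR_gt0//.
by rewrite expR_lt1.
Qed.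

(** On the slice, multiplication of [f] by [- i] turns each real coordinate into its harmonic
    conjugate. *)
Let U k x y := qcoord k (f (log_polar i x y)).
Let V k x y := qcoord k (- i * f (log_polar i x y)).

Let CR k x y : x < 0 -> exists u1 u2, has_partials (U k) x y u1 u2 /\ has_partials (V k) x y (- u2) u1.
Proof.
move=> x0; have z1 := z_lt1 y x0; have [_ df _] := Hf.
have dz := df _ z1.
have cr : 'd f (log_polar i x y) i = i * 'd f (log_polar i x y) 1.
  by apply: slice_cauchy_riemann => //; apply/(slice_pt_norm_lt1 Si).
have g1 := has_partials_log_polar Si (@qcoordl_continuous k 1) dz cr.
have g2 := has_partials_log_polar Si (@qcoordl_continuous k (- i)) dz cr.
move: g1 g2; set A := log_polar i x y * _ => g1 g2.
exists (qcoord k A), (qcoord k (i * A)); split.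
  have -> : U k = (fun x y => qcoordl k 1 (f (log_polar i x y))).
    by apply/funext => s; apply/funext => t; rewrite qcoordlE mul1r.
  by apply: has_partials_eq g1 _ _; rewrite qcoordlE mul1r.
apply: has_partials_eq g2 _ _; rewrite qcoordlE ?mulNr ?qcoordN//.
by rewrite mulrA (imag_sphere_sq Si) mulN1r qcoordN opprK.
Qed.

Let log_polar_per x y : log_polar i x (y + 2 * pi) = log_polar i x y.
Proof.
have := cos_mul_2pi 1 y; have := sin_mul_2pi 1 y; rewrite !mul1r => s c.
by rewrite /log_polar c s.
Qed.

Let pU k x y : U k x (y + 2 * pi) = U k x y. Proof. by rewrite /U log_polar_per. Qed.
Let pV k x y : V k x (y + 2 * pi) = V k x y. Proof. by rewrite /V log_polar_per. Qed.

Let bUV k : exists M x0 : R, x0 < 0 /\ forall x y, x <= x0 -> `|U k x y| <= M /\ `|V k x y| <= M.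
Proof.
have [_ df _] := Hf.
have d0 : differentiable f 0 by apply: df; rewrite normr0.
have /cvgrPdist_lt/(_ _ ltr01) := differentiable_continuous d0.
move=> /nbhs_norm0P[del /= del0 H].
pose x0 := Num.min (-1) (ln (del / 2)).
have x00 : x0 < 0 by rewrite gt_min ltrN10.
exists (`|f 0| + 1), x0; split => // x y xx.
have nz : `|log_polar i x y| < del.
  rewrite log_polarE normrZ (circle_pt_norm Si) mulr1 gtr0_norm ?expR_gt0//.
  apply: (@le_lt_trans _ _ (del / 2)); last by lra.
  rewrite -[leRHS](@lnK R) ?posrE ?divr_gt0// ler_expR.
  by apply: le_trans xx _; rewrite ge_min lexx orbT.
have fz : `|f (log_polar i x y)| <= `|f 0| + 1.
  have := H _ nz => /= h; have -> : f (log_polar i x y) = f 0 - (f 0 - f (log_polar i x y)) by rewrite opprB addrC subrK.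
  by apply: le_trans (ler_normB _ _) _; rewrite lerD2l ltW.
split; apply: le_trans (qcoord_le_norm _ _) _ => //.
by rewrite quat_normM normrN; have [_ ->] := Si; rewrite mul1r.
Qed.

(** The integral of the square of [cos (n%:R * y)] over a period. *)
Let w (n : nat) : R := if n == 0%N then 2 * pi else pi.
Let w_gt0 n : 0 < w n. Proof. by rewrite /w; case: ifP; rewrite ?twopi0 ?pi_gt0. Qed.
Let w_ge n : pi <= w n.
Proof. by rewrite /w; case: ifP => // _; have := pi_gt0 R; lra. Qed.

(** Read off on the line [x = - 1], the circle of radius [exp (- 1)]; by [pair_coefs] any other
    circle gives the same value. *)
Let a (n : nat) : quat R := quat_of (fun k => (w n)^-1 * (expR n%:R * cos_coef (U k) n (- 1))).

Let cos_coefE k n x : x < 0 -> cos_coef (U k) n x = w n * expR (n%:R * x) * qcoord k (a n).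
Proof.
move=> x0; have [H _] := pair_coefs (@CR k) (@pU k) (@pV k) (bUV k) n.
have := H x (-1) x0 (ltrN10 _); rewrite mulrNN mulr1 => E.
have e1 : expR (n%:R * x) * expR (- n%:R * x) = 1 by rewrite -expRD mulNr subrr expR0.
have w0 : w n != 0 by rewrite gt_eqF.
rewrite /a qcoord_of -E.
move: (cos_coef (U k) n x) (expR (n%:R * x)) (expR (- n%:R * x)) (w n) e1 w0 => Y p q W pq W0.
have -> : W * p * (W^-1 * (q * Y)) = (W / W) * (p * q) * Y by ring.
rewrite pq.
rewrite (divff W0).
rewrite mulr1.
by rewrite mul1r.
Qed.

Let sin_coefE k n x : (0 < n)%N -> x < 0 -> sin_coef (U k) n x = w n * expR (n%:R * x) * qcoord k (i * a n).
Proof.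
move=> n0 x0; have [_ H] := pair_coefs (@CR k) (@pU k) (@pV k) (bUV k) n.
rewrite (H n0 x x0); have [s [l E]] := qcoord_e1 k.
have -> : qcoord k (i * a n) = - (s * qcoord l (a n)) by rewrite -E mulNr qcoordN opprK.
rewrite mulrN; congr (- _); rewrite mulrCA -cos_coefE//.
rewrite /cos_coef -segintZ; last first.
  apply: cont_onT => y; apply: cvgM; last exact: cos_mul_continuous.
  exact: (pairU_continuous (@CR l) x0).
by apply: eq_segint => y _; rewrite /V E mulrA.
Qed.

(** Cauchy's estimate on the circle of radius [rho]: the integral is at most [2 * pi * M k] and
    [w n >= pi], whence the factor 2. *)
Let coef_growth (rho : R) : 0 < rho < 1 -> exists C, forall n, `|a n| * rho ^+ n <= C.
Proof.
move=> /andP[r0 r1]; pose x := ln rho.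
have x0 : x < 0 by rewrite -(ln1 R) ltr_ln ?posrE.
have ex : expR x = rho by rewrite lnK ?posrE.
have p2 : 0 <= 2 * pi :> R by rewrite ltW// twopi0.
have HM k : exists m, forall y, 0 <= y <= 2 * pi -> `|U k x y| <= m.
  have cU := @pairU_continuous R _ _ (@CR k) x x0.
  have [m _ Hm] := EVT_max p2 (cont_on_norm (cont_onT cU)).
  by exists `|U k x m| => y yab; apply: Hm; rewrite in_itv.
have {HM} [M HM] := choice HM.
exists (\sum_k (2 * M k)) => n.
have rn : 0 <= rho ^+ n by rewrite exprn_ge0// ltW.
apply: le_trans (ler_wpM2r rn (norm_le_qcoord _)) _.
rewrite mulr_suml; apply: ler_sum => k _.
have cU : continuous (U k x) by exact: (pairU_continuous (@CR k) x0).
have b : `|cos_coef (U k) n x| <= M k * (2 * pi - 0).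
  apply: segint_bound => //.
    by apply: cont_onT => y; apply: cvgM; [exact: cU|exact: cos_mul_continuous].
  move=> y yab; rewrite normrM -[leRHS]mulr1; apply: ler_pM => //; [exact: HM|exact: cos_max].
move: b; rewrite cos_coefE// expRM_natl ex !normrM (gtr0_norm (w_gt0 n)) (ger0_norm rn) subr0 => b.
have p := pi_gt0 R.
rewrite -(ler_pM2l p); apply: le_trans (_ : w n * rho ^+ n * `|qcoord k (a n)| <= _).
  by rewrite -mulrA mulrC -mulrA mulrC (mulrC (rho ^+ n)) !mulrA ler_wpM2r// ler_wpM2r.
by apply: le_trans b _; rewrite le_eqVlt; apply/orP; left; apply/eqP; ring.
Qed.

(** A growth bound at a radius [rho] between [r] and 1 makes the terms decay like [(r / rho) ^+ n],
    as [fourier_series_cvg] requires. The angle is measured from [t], and periodicity moves the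
    integrals back to [[0, 2 * pi]]. The centre [r = 0] is out of reach of the logarithm. *)
Lemma slice_expansion : exists a : nat -> quat R,
  (forall rho : R, 0 < rho < 1 -> exists C, forall n, `|a n| * rho ^+ n <= C) /\
  (forall k (r t : R), 0 < r < 1 ->
    harm (fun m => qcoord k (a m)) (fun m => qcoord k (e1 R * a m)) n r t @[n --> \oo] -->
    qcoord k (f (r *: circle_pt (e1 R) t))).
Proof.
exists a; split=> [|k r t /andP[r0 r1]]; first exact: coef_growth.
pose x := ln r; have x0 : x < 0 by rewrite -(ln1 R) ltr_ln ?posrE.
have ex : expR x = r by rewrite lnK ?posrE.
have -> : qcoord k (f (r *: circle_pt (e1 R) t)) = U k x t by rewrite /U log_polarE ex.
pose rho := (1 + r) / 2.
have [q0 q1] : 0 < rho /\ r < rho by rewrite /rho; split; lra.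
have rho1 : 0 < rho < 1 by rewrite q0 /rho; lra.
have [C HC] := coef_growth rho1.
have cU : continuous (U k x) by exact: (pairU_continuous (@CR k) x0).
pose al n := r ^+ n * (qcoord k (a n) * cos (n%:R * t) + qcoord k (i * a n) * sin (n%:R * t)).
have s01 : 0 <= r / rho < 1 by rewrite divr_ge0 ?(ltW r0) ?(ltW q0)//= ltr_pdivrMr ?mul1r.
have alC n : `|al n| <= (C + C) * (r / rho) ^+ n.
  have rn : 0 <= r ^+ n by rewrite exprn_ge0// ltW.
  have an : `|a n| <= C / rho ^+ n by rewrite ler_pdivlMr ?exprn_gt0.
  rewrite /al normrM (ger0_norm rn).
  have -> : (C + C) * (r / rho) ^+ n = r ^+ n * (C / rho ^+ n + C / rho ^+ n).
    by rewrite expr_div_n; ring.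
  apply: ler_wpM2l => //; apply: le_trans (trig_bound _ _ _) _; apply: lerD.
    exact: le_trans (qcoord_le_norm _ _) an.
  apply: le_trans (qcoord_le_norm _ _) _; rewrite quat_normM; have [_ ->] := Si.
  by rewrite mul1r.
apply: (@fourier_series_cvg R (U k x) t cU al (C + C) (r / rho) s01 alC) => n.
have p2 : 0 <= 2 * pi :> R by rewrite ltW// twopi0.
have cc : continuous (fun y => U k x y * cos (n%:R * y)).
  by move=> y; apply: cvgM; [exact: cU|exact: cos_mul_continuous].
have cs : continuous (fun y => U k x y * sin (n%:R * y)).
  by move=> y; apply: cvgM; [exact: cU|exact: sin_mul_continuous].
have -> : t + pi = (t - pi) + 2 * pi by ring.
have zc (z : R) (g : R -> R) : continuous g -> continuous (fun y => z * g y).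
  by move=> cg y; apply: cvgM; [exact: cvg_cst|exact: cg].
rewrite (@eq_segint _ _ (fun y => cos (n%:R * t) * (U k x y * cos (n%:R * y)) +
   sin (n%:R * t) * (U k x y * sin (n%:R * y)))); last first.
  by move=> y _; rewrite mulrBr cosB; ring.
rewrite segintD; [|exact/cont_onT/zc|exact/cont_onT/zc].
rewrite !segintZ; [|exact: cont_onT|exact: cont_onT].
rewrite !segint_periodic//; last 2 first.
- by move=> y; rewrite pU sin_mul_2pi.
- by move=> y; rewrite pU cos_mul_2pi.
rewrite -/(cos_coef (U k) n x) -/(sin_coef (U k) n x) cos_coefE// -/(w n) /al expRM_natl ex.
have [->|n0] := posnP n; first by rewrite mul0r sin0 cos0; ring.
by rewrite sin_coefE// expRM_natl ex; ring.
Qed.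

End SliceExpansion.

(** * The Hardy space *)

Lemma segint_sum (R : realType) (I : Type) (s : seq I) (F : I -> R -> R) (a b : R) :
  (forall k, continuous (F k)) ->
  segint (fun x => \sum_(k <- s) F k x) a b = \sum_(k <- s) segint (F k) a b.
Proof.
move=> cF; elim: s => [|k s IH].
  rewrite big_nil (@eq_segint _ _ (fun=> 0)) => [|x _]; last by rewrite big_nil.
  by rewrite /segint /Rintegral integral0.
rewrite big_cons -IH (@eq_segint _ _ (fun x => F k x + \sum_(l <- s) F l x)); last first.
  by move=> x _; rewrite big_cons.
rewrite segintD//; first exact: cont_onT.
apply: cont_onT; elim: s {IH} => [|l s IH] x.
  by under eq_fun do rewrite big_nil; exact: cvg_cst.
by under eq_fun do rewrite big_cons; apply: cvgD; [exact: cF|exact: IH].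
Qed.

Lemma cvg_sumr (R : realType) (T : Type) (F : set_system T) {FF : Filter F} (I : Type)
    (s : seq I) (u : I -> T -> R) (l : I -> R) :
  (forall k, u k x @[x --> F] --> l k) ->
  \sum_(k <- s) u k x @[x --> F] --> \sum_(k <- s) l k.
Proof.
move=> H; elim: s => [|k s IH].
  by under eq_fun do rewrite big_nil; rewrite big_nil; exact: cvg_cst.
by under eq_fun do rewrite big_cons; rewrite big_cons; apply: cvgD; [exact: H|exact: IH].
Qed.

(** In the extended reals an unbounded function tends to [+oo], so the limit exists in all cases. *)
Lemma nondecreasing_left1_cvg (R : realType) (v : R -> R) :
  (forall r s, 0 < r -> r <= s -> s < 1 -> v r <= v s) ->
  cvg ((v r)%:E @[r --> 1^'-]) /\
  forall r, 0 < r < 1 -> ((v r)%:E <= lim ((v r)%:E @[r --> 1^'-]))%E.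
Proof.
move=> H; have cv : cvg ((v r)%:E @[r --> 1^'-]).
  have [[M HM]|/forallNP nb] := pselect (exists M, forall r, 0 < r < 1 -> v r <= M).
    have : cvg (v r @[r --> 1^'-]).
      apply: nondecreasing_at_left_is_cvgr.
        near=> x; have x0 : 0 < x by near: x; apply: nbhs_left_gt; exact: ltr01.
        move=> y z; rewrite !in_itv/= => /andP[xy _] /andP[_ z1] yz; apply: H => //.
        exact: lt_trans xy.
      near=> x; have x0 : 0 < x by near: x; apply: nbhs_left_gt; exact: ltr01.
      exists M => z /= [y]; rewrite in_itv/= => /andP[xy y1] <-.
      by apply: HM; rewrite y1 andbT; exact: lt_trans xy.
    move=> cv; apply/cvg_ex; exists (lim (v r @[r --> 1^'-]))%:E.
    by apply: cvg_EFin; [exact: nearW|exact: cv].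
  apply/cvg_ex; exists +oo%E; apply/cvgeyPge => A.
  have /existsNP[r /not_implyP[/andP[r0 r1] /negP]] := nb A; rewrite -ltNge => Ar.
  near=> s; have rs : r <= s by near: s; exact: nbhs_left_ge.
  have s1 : s < 1 by near: s; exact: nbhs_left_lt.
  by rewrite lee_fin; apply: le_trans (ltW Ar) _; apply: H.
split=> // r /andP[r0 r1]; apply: lime_ge => //; near=> s.
have rs : r <= s by near: s; exact: nbhs_left_ge.
have s1 : s < 1 by near: s; exact: nbhs_left_lt.
by rewrite lee_fin; apply: H.
Unshelve. all: by end_near. Qed.

Section SquareMean.
Variable R : realType.
Implicit Types (f : quat R -> quat R) (a : nat -> quat R) (i : quat R).

(** Convergence in the open disc, which is all that is known before the Hardy norm is used. *)
Definition coef_growth a :=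
  forall rho : R, 0 < rho < 1 -> exists C, forall n, `|a n| * rho ^+ n <= C.

Definition expands a f i := forall k (r t : R), 0 < r < 1 ->
  qcoord k (f (r *: circle_pt i t)) =
  harms (fun m => qcoord k (a m)) (fun m => qcoord k (i * a m)) r t.

Definition sqmean f i (r : R) := segint (fun t => `|f (r *: circle_pt i t)| ^+ 2) 0 (2 * pi).

Lemma bounded_coef_growth a (C : R) : (forall k, `|a k| <= C) -> coef_growth a.
Proof.
move=> aC rho /andP[r0 r1]; exists C => n; rewrite -[leRHS]mulr1; apply: ler_pM => //.
  by rewrite exprn_ge0// ltW.
by rewrite exprn_ile1// ltW.
Qed.

Lemma expands_pext a (C : R) i : (forall k, `|a k| <= C) -> imag_sphere i ->
  expands a (pext a) i.
Proof. by move=> aC Si k r t /andP[r0 r1]; apply: qcoord_pext => //; rewrite (ltW r0). Qed.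

Section Expansion.
Variables (a : nat -> quat R) (f : quat R -> quat R) (i : quat R).
Hypotheses (Si : imag_sphere i) (ga : coef_growth a) (fa : expands a f i).

(** Moving a factor [rho ^+ m] into the coefficients makes them bounded, at the radius [r / rho];
    the results for bounded coefficients then apply. *)
Let rescaled (r : R) : 0 < r < 1 -> exists b (s C : R), [/\ 0 <= s < 1,
  forall k, `|b k| <= C, forall k t, qcoord k (f (r *: circle_pt i t)) =
    harms (fun m => qcoord k (b m)) (fun m => qcoord k (i * b m)) s t &
  forall m, s ^+ m.*2 * `|b m| ^+ 2 = r ^+ m.*2 * `|a m| ^+ 2].
Proof.
move=> r01; have /andP[r0 r1] := r01; pose rho := (1 + r) / 2.
have rho1 : 0 < rho < 1 by rewrite /rho; apply/andP; split; lra.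
have /andP[p0 p1] := rho1.
have rr : r < rho by rewrite /rho; lra.
have [C HC] := ga rho1.
exists (fun m => rho ^+ m *: a m), (r / rho), C; split.
- by rewrite divr_ge0 ?(ltW r0) ?(ltW p0)//= ltr_pdivrMr ?mul1r.
- by move=> k; rewrite normrZ ger0_norm 1?mulrC// exprn_ge0// ltW.
- move=> k t; rewrite fa//.
  have -> : (fun m => qcoord k (rho ^+ m *: a m)) = (fun m => rho ^+ m * qcoord k (a m)).
    by apply/funext => m; rewrite qcoordZ.
  have -> : (fun m => qcoord k (i * (rho ^+ m *: a m))) = (fun m => rho ^+ m * qcoord k (i * a m)).
    by apply/funext => m; rewrite -quat_scaleAr qcoordZ.
  by rewrite harms_rescale mulrC divfK// gt_eqF.
- move=> m; have rm : 0 <= rho ^+ m by rewrite exprn_ge0// ltW.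
  rewrite normrZ (ger0_norm rm) (exprMn _ (rho ^+ m)) -(exprM rho) muln2.
  by rewrite mulrA -exprMn divfK// gt_eqF.
Qed.

Let norm_sq_sum (r t : R) : `|f (r *: circle_pt i t)| ^+ 2 =
  \sum_k qcoord k (f (r *: circle_pt i t)) ^+ 2.
Proof. exact: quat_norm_sum. Qed.

Lemma qcoord_circle_continuous k (r : R) : 0 < r < 1 ->
  continuous (fun t => qcoord k (f (r *: circle_pt i t))).
Proof.
move=> /rescaled[b [s [C [s01 bC E _]]]].
under eq_fun do rewrite E; exact: (harms_continuous s01 (qcoord_bound bC k Si)).
Qed.

Lemma norm_sq_circle_continuous (r : R) : 0 < r < 1 ->
  continuous (fun t => `|f (r *: circle_pt i t)| ^+ 2).
Proof.
move=> r01 t; under eq_fun do rewrite norm_sq_sum !big_ord_recl big_ord0.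
have cq k : qcoord k (f (r *: circle_pt i t)) ^+ 2 @[t --> t] --> qcoord k (f (r *: circle_pt i t)) ^+ 2.
  by rewrite expr2; under eq_fun do rewrite expr2; apply: cvgM; exact: qcoord_circle_continuous.
do ![apply: cvgD; first exact: cq]; exact: cvg_cst.
Qed.

Lemma sqmean_cvg (r : R) : 0 < r < 1 ->
  2 * pi * (\sum_(k < n) r ^+ k.*2 * `|a k| ^+ 2) @[n --> \oo] --> sqmean f i r.
Proof.
move=> r01; have [b [s [C [s01 bC E EM]]]] := rescaled r01.
have -> : sqmean f i r = \sum_k segint (fun t =>
    harms (fun m => qcoord k (b m)) (fun m => qcoord k (i * b m)) s t ^+ 2) 0 (0 + 2 * pi).
  rewrite add0r -segint_sum; last first.
    move=> k t; under eq_fun do rewrite expr2.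
    by apply: cvgM; exact: (harms_continuous s01 (qcoord_bound bC k Si)).
  by apply: eq_segint => t _; rewrite norm_sq_sum; apply: eq_bigr => k _; rewrite E.
have -> : (fun n => 2 * pi * (\sum_(k < n) r ^+ k.*2 * `|a k| ^+ 2)) = (fun n =>
   \sum_l 2 * pi * (\sum_(k < n) s ^+ k.*2 * wt (fun m => qcoord l (b m)) (fun m => qcoord l (i * b m)) k)).
  apply/funext => n; rewrite -mulr_sumr exchange_big/=; congr (_ * _).
  by apply: eq_bigr => k _; rewrite -mulr_sumr sum_wt_qcoord// EM.
by apply: cvg_sumr => k; exact: (parseval s01 (qcoord_bound bC k Si)).
Qed.

Lemma sqmean_ge (r : R) n : 0 < r < 1 ->
  2 * pi * (\sum_(k < n) r ^+ k.*2 * `|a k| ^+ 2) <= sqmean f i r.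
Proof.
move=> r01; have /andP[r0 _] := r01; have cv := sqmean_cvg r01.
rewrite -(cvg_lim _ cv)//; apply: limr_ge; first by apply/cvg_ex; exists (sqmean f i r).
near=> m; rewrite ler_pM2l ?twopi0//.
have /subnKC <- : (n <= m)%N by near: m; exact: nbhs_infty_ge.
rewrite big_split_ord/= lerDl; apply: sumr_ge0 => k kP.
by rewrite mulr_ge0 ?exprn_ge0 ?(ltW r0).
Unshelve. all: by end_near. Qed.

Lemma sqmean_le (r W : R) : 0 < r < 1 ->
  (forall n, 2 * pi * (\sum_(k < n) r ^+ k.*2 * `|a k| ^+ 2) <= W) -> sqmean f i r <= W.
Proof.
move=> r01 H; have cv := sqmean_cvg r01.
rewrite -(cvg_lim _ cv)//; apply: limr_le; last exact: nearW.
by apply/cvg_ex; exists (sqmean f i r).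
Qed.

Lemma sqmean_mono (r s : R) : 0 < r -> r <= s -> s < 1 -> sqmean f i r <= sqmean f i s.
Proof.
move=> r0 rs s1; have s0 := lt_le_trans r0 rs.
apply: sqmean_le => [|n]; first by rewrite r0 (le_lt_trans rs).
apply: le_trans (sqmean_ge n _); last by rewrite s0.
rewrite ler_pM2l ?twopi0//; apply: ler_sum => k _; rewrite ler_wpM2r//.
by rewrite lerXn2r// ?nnegrE ltW.
Qed.

Lemma circle_meanE (r : R) : 0 < r < 1 ->
  circle_mean 2 f i r = (((2 * pi)^-1 * sqmean f i r) `^ 2^-1)%:E.
Proof.
move=> r01; rewrite /circle_mean.
under eq_integral => t _ do rewrite powR_mulrn//.
by rewrite integral_segint//; apply: cont_onT; exact: norm_sq_circle_continuous.
Qed.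

Lemma sqmean_ge0 (r : R) : 0 <= sqmean f i r.
Proof. by apply: segint_ge0. Qed.

Let p2 : 0 <= (2 * pi)^-1 :> R. Proof. by rewrite invr_ge0 ltW// twopi0. Qed.

(** By Parseval's formula the square means increase with the radius; hence the limit in the Hardy
    norm exists and dominates every mean. *)
Lemma circle_mean_lim : cvg (circle_mean 2 f i r @[r --> 1^'-]) /\
  forall r, 0 < r < 1 -> (circle_mean 2 f i r <= lim (circle_mean 2 f i r @[r --> 1^'-]))%E.
Proof.
pose v r := ((2 * pi)^-1 * sqmean f i r) `^ 2^-1.
have vm : forall r s, 0 < r -> r <= s -> s < 1 -> v r <= v s.
  move=> r s r0 rs s1; apply: ge0_ler_powR; rewrite ?nnegrE ?mulr_ge0 ?sqmean_ge0//.
  by rewrite ler_wpM2l// sqmean_mono.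
have [cv H] := nondecreasing_left1_cvg vm.
have E : \forall r \near 1^'-, (v r)%:E = circle_mean 2 f i r.
  near=> r; rewrite circle_meanE//; apply/andP; split; near: r.
    by apply: nbhs_left_gt; exact: ltr01.
  exact: nbhs_left_lt.
have cv2 : circle_mean 2 f i r @[r --> 1^'-] --> lim ((v r)%:E @[r --> 1^'-]).
  by apply: cvg_trans cv; apply: near_eq_cvg.
split; first by apply/cvg_ex; eexists; exact: cv2.
by move=> r r01; rewrite (cvg_lim _ cv2)// circle_meanE//; exact: H.
Unshelve. all: by end_near. Qed.

Lemma circle_mean_sum_bound (B : R) n :
  (lim (circle_mean 2 f i r @[r --> 1^'-]) <= B%:E)%E -> \sum_(k < n) `|a k| ^+ 2 <= B ^+ 2.
Proof.
move=> HB; have cv : \sum_(k < n) r ^+ k.*2 * `|a k| ^+ 2 @[r --> 1^'-] --> \sum_(k < n) `|a k| ^+ 2.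
  have -> : \sum_(k < n) `|a k| ^+ 2 = \sum_(k < n) 1 ^+ k.*2 * `|a k| ^+ 2.
    by apply: eq_bigr => k _; rewrite expr1n mul1r.
  apply: cvg_sumr => k; apply: cvgM; last exact: cvg_cst.
  by apply: cvg_at_left_filter; exact: exprn_continuous.
rewrite -(cvg_lim _ cv)//; apply: limr_le; first by apply/cvg_ex; eexists; exact: cv.
near=> r.
have r01 : 0 < r < 1.
  apply/andP; split; near: r; last exact: nbhs_left_lt.
  by apply: nbhs_left_gt; exact: ltr01.
have := le_trans (circle_mean_lim.2 r r01) HB; rewrite circle_meanE// lee_fin => h.
have m0 : 0 <= (2 * pi)^-1 * sqmean f i r by rewrite mulr_ge0// sqmean_ge0.
have {}h : (2 * pi)^-1 * sqmean f i r <= B ^+ 2.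
  rewrite -[leLHS](sqr_sqrtr m0) -powR12_sqrt//.
  by rewrite lerXn2r ?nnegrE ?powR_ge0//; exact: le_trans (powR_ge0 _ _) h.
apply: le_trans h; rewrite mulrC ler_pdivlMr ?twopi0// mulrC; exact: sqmean_ge.
Unshelve. all: by end_near. Qed.

Lemma circle_mean_bound (W : R) : 0 <= W -> (forall n, \sum_(k < n) `|a k| ^+ 2 <= W) ->
  (lim (circle_mean 2 f i r @[r --> 1^'-]) <= (W `^ 2^-1)%:E)%E.
Proof.
move=> W0 H; apply: lime_le; first exact: circle_mean_lim.1.
near=> r.
have r01 : 0 < r < 1.
  apply/andP; split; near: r; last exact: nbhs_left_lt.
  by apply: nbhs_left_gt; exact: ltr01.
have /andP[r0 r1] := r01.
rewrite circle_meanE// lee_fin; apply: ge0_ler_powR; rewrite ?nnegrE ?mulr_ge0 ?sqmean_ge0//.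
rewrite mulrC ler_pdivrMr ?twopi0// mulrC; apply: sqmean_le => // n.
rewrite ler_pM2l ?twopi0//; apply: le_trans (H n); apply: ler_sum => k _.
by rewrite ler_piMl// exprn_ile1// ltW.
Unshelve. all: by end_near. Qed.

End Expansion.
End SquareMean.

(** * H^2 as the space of square summable series *)

Section HardyCharacterization.
Variable R : realType.
Implicit Types (f : quat R -> quat R) (a : nat -> quat R) (i j : quat R).

Definition square_summable a := exists W : R, forall n, \sum_(k < n) `|a k| ^+ 2 <= W.

Lemma term_le_sum a (W : R) k : (forall n, \sum_(k < n) `|a k| ^+ 2 <= W) -> `|a k| ^+ 2 <= W.
Proof.
move=> H; apply: le_trans (H k.+1); rewrite big_ord_recr/= lerDr.
by apply: sumr_ge0 => l _; exact: sqr_ge0.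
Qed.

Lemma square_summable_bounded a (W : R) :
  (forall n, \sum_(k < n) `|a k| ^+ 2 <= W) -> forall k, `|a k| <= W + 1.
Proof.
move=> H k; apply: le_trans (_ : `|a k| ^+ 2 + 1 <= _); last by rewrite lerD2r; exact: term_le_sum.
by move: `|a k| => x; nra.
Qed.

Lemma polar_coordinates (A B : R) : exists r t : R, [/\ 0 <= r, A = r * cos t & B = r * sin t].
Proof.
pose r := Num.sqrt (A ^+ 2 + B ^+ 2).
have r2 : r ^+ 2 = A ^+ 2 + B ^+ 2 by rewrite sqr_sqrtr// addr_ge0// sqr_ge0.
have [r0|r0] := eqVneq r 0.
  exists 0, 0; rewrite !mul0r; move: r2; rewrite r0 expr0n/= => /esym/eqP.
  by rewrite paddr_eq0 ?sqr_ge0// !sqrf_eq0 => /andP[/eqP-> /eqP->].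
have rp : 0 < r by rewrite lt_neqAle eq_sym r0 sqrtr_ge0.
have Ar : -1 <= A / r <= 1.
  rewrite -ler_norml normrM normfV (gtr0_norm rp) ler_pdivrMr// mul1r.
  by rewrite -(@ler_pXn2r _ 2) ?nnegrE ?(ltW rp) ?normr_ge0// r2 real_normK ?num_real// lerDl sqr_ge0.
have s2 : 1 - (A / r) ^+ 2 = (`|B| / r) ^+ 2.
  rewrite !exprMn real_normK ?num_real// !exprVn r2.
  have : A ^+ 2 + B ^+ 2 != 0 by rewrite -r2 expf_neq0.
  by move=> h; field.
have cA : r * cos (acos (A / r)) = A by rewrite acosK// mulrC divfK.
have sB : r * sin (acos (A / r)) = `|B|.
  by rewrite sin_acos// s2 sqrtr_sqr ger0_norm ?divr_ge0 ?(ltW rp)// mulrC divfK.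
have [B0|B0] := leP 0 B.
  by exists r, (acos (A / r)); rewrite cA sB ger0_norm// ltW.
by exists r, (- acos (A / r)); rewrite cosN sinN cA mulrN sB ltr0_norm// opprK ltW.
Qed.

Lemma slice_ptN i (A B : R) : slice_pt (- i) A B = slice_pt i A (- B).
Proof. by rewrite /slice_pt scalerN scaleNr. Qed.

Lemma slice_hyperholomorphic_repr f i j (A B : R) : slice_hyperholomorphic f ->
  imag_sphere i -> imag_sphere j -> 0 <= B -> planar_disc A B ->
  f (slice_pt j A B) =
  repr_fst i j * f (slice_pt i A B) + repr_snd i j * f (slice_pt i A (- B)).
Proof.
move=> [_ _ [al [be [E _ _ _]]]] Si Sj B0 AB; have si := imag_sphere_sq Si.
rewrite -slice_ptN E// E// (E _ _ _ (imag_sphereN Si))//.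
move: (al A B) (be A B) => u v.
have h : j * i * (i * v) = - (j * v) by rewrite mulrA -(mulrA j) si mulrN1 mulNr.
rewrite /repr_fst /repr_snd -!quat_scaleAl !mulrDl !mulrDr !mul1r !(mulNr, mulrN) h.
by apply: qcoord_ext => k; rewrite !(qcoordD, qcoordZ, qcoordN); field.
Qed.

(** The expansion determines [f] on circles of positive radius; the value at the centre follows by
    continuity along a radius. *)
Lemma expands_slice f a (C : R) i (A B : R) : slice_hyperholomorphic f ->
  (forall k, `|a k| <= C) -> imag_sphere i -> expands a f i -> planar_disc A B ->
  f (slice_pt i A B) = pext a (slice_pt i A B).
Proof.
move=> [_ df _] aC Si fa AB; have ea := expands_pext aC Si.
have E (r t : R) : 0 < r < 1 -> f (r *: circle_pt i t) = pext a (r *: circle_pt i t).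
  by move=> r01; apply: qcoord_ext => k; rewrite fa// ea.
have [r [t [r0 AE BE]]] := polar_coordinates A B.
have r1 : r < 1.
  rewrite -(@expr_lt1 _ 2)//; move: AB; rewrite /planar_disc AE BE !exprMn -mulrDr.
  by rewrite cos2Dsin2 mulr1.
rewrite AE BE -slice_ptZ -/(circle_pt i t).
move: r0; rewrite le_eqVlt => /predU1P[r0|r0]; last by apply: E; rewrite r0.
have cz (g : quat R -> quat R) : differentiable g 0 ->
    g (s *: circle_pt i t) @[s --> (0 : R)^'+] --> g 0.
  move=> dg; have cs : s *: circle_pt i t @[s --> (0 : R)^'+] --> (0 : quat R).
    rewrite -[X in _ --> X](scale0r (circle_pt i t)).
    apply: cvgZ; last exact: cvg_cst.
    by apply: cvg_at_right_filter; exact: cvg_id.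
  exact: (cvg_comp _ _ cs (differentiable_continuous dg)).
have n0 : `|0 : quat R| < 1 by rewrite normr0.
have c1 := cz _ (df _ n0); have c2 := cz _ (pext_diff aC n0).1.
rewrite -r0 scale0r -(cvg_lim _ c1)//; apply: cvg_lim => //; apply: cvg_trans c2; apply: near_eq_cvg.
near=> s; rewrite E//; apply/andP; split; near: s; first exact: nbhs_right_gt.
by apply: nbhs_right_lt.
Unshelve. all: by end_near. Qed.

Lemma hardyP f : hardy 2 f <-> exists a, square_summable a /\ f = pext a.
Proof.
split=> [[Hf hn]|[a [[W HW] ->]]]; last first.
  have aC := square_summable_bounded HW; split; first exact: pext_slice_hyperholomorphic aC.
  have W0 : 0 <= W by have := HW 0%N; rewrite big_ord0.
  apply: le_lt_trans (ltry (W `^ 2^-1)); apply: ge_ereal_sup => _ [i Si <-].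
  exact: (circle_mean_bound Si (bounded_coef_growth aC) (expands_pext aC Si) W0 HW).
have [a [ga H]] := slice_expansion Hf.
have Si := e1_sphere R.
have fa : expands a f (e1 R) by move=> k r t r01; apply/esym/cvg_lim => //; exact: H.
pose L := lim (circle_mean 2 f (e1 R) r @[r --> 1^'-]).
have Lh : (L <= hardy_norm 2 f)%E by apply: ereal_sup_ubound; exists (e1 R).
have L0 : (0 <= L)%E.
  have h : (0 < 2^-1 :> R) && (2^-1 < 1 :> R) by apply/andP; split; lra.
  apply: le_trans ((circle_mean_lim Si ga fa).2 _ h).
  by rewrite (circle_meanE Si ga fa h) lee_fin powR_ge0.
have hf : hardy_norm 2 f \is a fin_num by rewrite ge0_fin_numE// (le_trans L0).
pose B := fine (hardy_norm 2 f).
have HW n : \sum_(k < n) `|a k| ^+ 2 <= B ^+ 2.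
  by apply: (circle_mean_sum_bound Si ga fa); rewrite fineK.
exists a; split; first by exists (B ^+ 2).
have aC := square_summable_bounded HW.
apply/funext => x; have [x1|x1] := ltP `|x| 1; last first.
  by have [-> //] := Hf; rewrite /pext ltNge x1.
have [j [b [c [Sj c0 xE]]]] := slice_decomp x.
have bc : planar_disc b c by apply/(slice_pt_norm_lt1 Sj); rewrite -xE.
rewrite xE (slice_hyperholomorphic_repr Hf Si Sj c0 bc) (pext_repr aC Si Sj bc).
by rewrite !(expands_slice Hf aC Si fa)//; exact: planar_discN.
Qed.

End HardyCharacterization.

(** * Boundary values and mean oscillation *)

Section RadialLimit.
Variables (R : realType) (h : R -> R -> R).
Hypothesis hc : forall r, 0 <= r < 1 -> continuous (h r).

(** The angles at which the values at radii above [1 - m.+1%:R^-1] differ by at most [n.+1%:R^-1]: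
    Cauchy's criterion. The complement is a union of open sets, so the uncountably many radii do no
    harm to measurability. *)
Let cauchy_set n m : set R := ~` \bigcup_(p in [set p : R * R |
    (1 - m.+1%:R^-1 < p.1 < 1) /\ (1 - m.+1%:R^-1 < p.2 < 1)])
  [set t | n.+1%:R^-1 < `|h p.1 t - h p.2 t|].

Let measurable_cauchy_set n m : measurable (cauchy_set n m).
Proof.
apply: measurableC; apply: open_measurable; apply: bigcup_open => -[r s] /= [/andP[r0 r1] /andP[s0 s1]].
have mp : 0 <= 1 - m.+1%:R^-1 :> R by rewrite subr_ge0 invf_le1// ler1n.
have cn : continuous (fun t => `|h r t - h s t|).
  move=> t; apply: cvg_norm; apply: cvgB; apply: hc; rewrite ?r1 ?s1 andbT; apply: (le_trans mp);
  exact: ltW.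
have := @open_comp _ _ (fun t => `|h r t - h s t|) [set y | n.+1%:R^-1 < y].
by apply; [move=> t _; exact: cn|exact: open_gt].
Qed.

Lemma radial_cvgE : [set t | cvg (h r t @[r --> 1^'-])] = \bigcap_n \bigcup_m cauchy_set n m.
Proof.
apply/seteqP; split => t /=.
  move=> /cvg_ex[/= l hl] n _.
  have n0 : 0 < n.+1%:R^-1 / 2 :> R by rewrite divr_gt0.
  have /cvgrPdist_le/(_ _ n0)[e /= e0 He] := hl.
  exists (Num.truncn e^-1) => // -[[r s] /= [/andP[r0 r1] /andP[s0 s1]]].
  have me : (Num.truncn e^-1).+1%:R^-1 < e.
    by rewrite -[ltRHS]invrK ltf_pV2 ?posrE ?invr_gt0// truncnS_gt.
  have hh u : 1 - (Num.truncn e^-1).+1%:R^-1 < u -> u < 1 -> `|l - h u t| <= n.+1%:R^-1 / 2.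
    move=> u0 u1; apply: He => //=; rewrite gtr0_norm ?subr_gt0//.
    by rewrite ltrBlDl -ltrBlDr; apply: lt_trans u0; rewrite ltrD2l ltrN2.
  apply/negP; rewrite -leNgt; have -> : h r t - h s t = (l - h s t) - (l - h r t) by ring.
  apply: le_trans (ler_normB _ _) _.
  by have := lerD (hh s s0 s1) (hh r r0 r1); rewrite -splitr.
move=> H; apply: cauchy_cvg; apply: cauchy_exP => e e0.
have [m _ Hm] := H (Num.truncn e^-1) I.
pose r0 : R := 1 - m.+2%:R^-1.
have r01 : 1 - m.+1%:R^-1 < r0 < 1.
  apply/andP; split; last by rewrite /r0 ltrBlDr ltrDl invr_gt0.
  by rewrite ltrD2l ltrN2 ltf_pV2 ?posrE// ltr_nat.
exists (h r0 t).
suff : \forall r \near 1^'-, ball (h r0 t) e (h r t) by [].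
near=> r.
have rr0 : 1 - m.+1%:R^-1 < r.
  by near: r; apply: nbhs_left_gt; rewrite ltrBlDr ltrDl invr_gt0.
have rr1 : r < 1 by near: r; exact: nbhs_left_lt.
rewrite -ball_normE /=.
have me : (Num.truncn e^-1).+1%:R^-1 < e.
  by rewrite -[ltRHS]invrK ltf_pV2 ?posrE ?invr_gt0// truncnS_gt.
apply: le_lt_trans me; rewrite leNgt; apply/negP => hlt.
by apply: Hm; exists (r0, r) => //=; rewrite r01 rr0 rr1.
Unshelve. all: by end_near. Qed.

Lemma measurable_radial_cvg : measurable [set t | cvg (h r t @[r --> 1^'-])].
Proof.
rewrite radial_cvgE; apply: bigcapT_measurable => n; apply: bigcupT_measurable => m.
exact: measurable_cauchy_set.
Qed.

Lemma measurable_if_asbool (C : set R) (g : R -> R) (c : R) : measurable C ->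
  measurable_fun setT g -> measurable_fun setT (fun t => if `[< C t >] then g t else c).
Proof.
move=> mC mg; apply: measurable_fun_ifT => //.
apply: (measurable_fun_bool true); rewrite setTI.
rewrite (_ : _ @^-1` _ = C)//; apply/seteqP; split => t /=; first by move/asboolP.
by move/asboolP.
Qed.

Lemma measurable_radial_lim : measurable_fun setT (fun t => lim (h r t @[r --> 1^'-])).
Proof.
pose C := [set t | cvg (h r t @[r --> 1^'-])].
(* [point] is the value of [lim] where the limit does not exist, so this sequence converges to [lim]
   at every angle. *)
apply: (@measurable_fun_cvg _ _ _ setT (fun n t => if `[< C t >] then h (1 - n.+1%:R^-1) t else point)).
  move=> n; apply: measurable_if_asbool; first exact: measurable_radial_cvg.
  by apply: continuous_measurable_fun; apply: hc; exact: onem_harmonic01.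
move=> t _; case: asboolP => Ct; last by rewrite dvgP//; exact: cvg_cst.
by apply: (cvg_left1_seq (u := fun r => h r t)).
Qed.

End RadialLimit.

Section BoundaryValues.
Variable R : realType.
Local Notation mu := (@lebesgue_measure R).
Variables (a : nat -> quat R) (W : R) (i : quat R).
Hypotheses (HW : forall n, \sum_(k < n) `|a k| ^+ 2 <= W) (Si : imag_sphere i).

Let aC := square_summable_bounded HW.
Let c (k : 'I_4) m := qcoord k (a m).
Let d (k : 'I_4) m := qcoord k (i * a m).
Let bd k := qcoord_bound aC k Si.
Let h k r t := harms (c k) (d k) r t.
Let hc k r : 0 <= r < 1 -> continuous (h k r).
Proof. by move=> r01; exact: (harms_continuous r01 (bd k)). Qed.

Let Wk k n : \sum_(m < n) wt (c k) (d k) m <= W.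
Proof.
apply: le_trans (HW n); apply: ler_sum => m _; rewrite -(sum_wt_qcoord a m Si).
by rewrite (bigD1 k)//= lerDl; apply: sumr_ge0 => l _; exact: wt_ge0.
Qed.

Let b k t := lim (h k r t @[r --> 1^'-]).
Let mb k : measurable_fun setT (b k). Proof. exact: (measurable_radial_lim (@hc k)). Qed.
Let Hb k t : cvg (harms (c k) (d k) r t @[r --> 1^'-]) -> harms (c k) (d k) r t @[r --> 1^'-] --> b k t.
Proof. by []. Qed.

Let f := pext a.
Let bv := boundary_value f i.

Let coord_eq k t : \forall r \near 1^'-, h k r t = qcoord k (f (r *: circle_pt i t)).
Proof. by apply: filterS (near_left1 R) => r r01; rewrite (qcoord_pext aC). Qed.

Let cvg_coord t : (forall k, cvg (h k r t @[r --> 1^'-])) ->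
  f (r *: circle_pt i t) @[r --> 1^'-] --> quat_of (fun k => b k t).
Proof.
move=> H; apply/quat_cvgP => k; rewrite qcoord_of.
have hk : h k r t @[r --> 1^'-] --> b k t by exact: H.
by apply: cvg_trans hk; apply: near_eq_cvg; exact: coord_eq.
Qed.

Let cvg_iff t : cvg (f (r *: circle_pt i t) @[r --> 1^'-]) <-> forall k, cvg (h k r t @[r --> 1^'-]).
Proof.
split=> [/cvg_ex[/= l fl] k|H]; last first.
  by apply/cvg_ex; exists (quat_of (fun k => b k t)); exact: cvg_coord.
move: fl => /quat_cvgP/(_ k) fk; apply/cvg_ex; exists (qcoord k l).
apply: cvg_trans fk; apply: near_eq_cvg.
by apply: filterS (coord_eq k t) => r ->.
Qed.

Let C := \bigcap_(k : 'I_4) [set t | cvg (h k r t @[r --> 1^'-])].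

(* Off the set of convergence [lim] is the fixed element [point], so that the
   boundary value is measurable everywhere. *)
Let qcoord_bv k t : qcoord k (bv t) = if `[< C t >] then b k t else qcoord k point.
Proof.
case: asboolP => Ct.
  rewrite /bv /boundary_value (cvg_lim _ (@cvg_coord t _))// ?qcoord_of// => l.
  exact: (Ct l I).
rewrite /bv /boundary_value dvgP// => /cvg_iff H.
by apply: Ct => l _; exact: H.
Qed.

Let mC : measurable C.
Proof.
apply: fin_bigcap_measurable => //= k _; exact: (measurable_radial_cvg (@hc k)).
Qed.

Lemma measurable_boundary_value k : measurable_fun setT (fun t => qcoord k (boundary_value (pext a) i t)).
Proof. by under eq_fun do rewrite qcoord_bv; exact: measurable_if_asbool. Qed.

Lemma boundary_value_ae : mu.-negligible
  [set t | ~ (pext a (r *: circle_pt i t) @[r --> 1^'-] --> boundary_value (pext a) i t)].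
Proof.
have : mu.-negligible (\bigcup_n [set t | exists k : 'I_4, k = n :> nat /\
    ~ cvg (harms (c k) (d k) r t @[r --> 1^'-])]).
  apply: negligible_bigcup => n; have [n4|n4] := ltnP n 4.
    apply: negligibleS (harms_aeT (bd (Ordinal n4)) (Wk (Ordinal n4))) => t /= [k [kn]].
    by rewrite (_ : k = Ordinal n4)//; exact: val_inj.
  by apply: negligibleS (negligible_set0 mu) => t /= [k [kn]]; move: (ltn_ord k); rewrite kn ltnNge n4.
apply: negligibleS => t /= nc; apply: contrapT => H; apply: nc.
have /cvg_iff : forall k, cvg (h k r t @[r --> 1^'-]).
  by move=> k; apply: contrapT => nk; apply: H; exists k => //; exists k.
by [].
Qed.

Let nC : mu.-negligible (~` C).
Proof.
apply: negligibleS boundary_value_ae => t /= nC cv; apply: nC => k _.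
by apply: (cvg_iff t).1; apply/cvg_ex; eexists; exact: cv.
Qed.

Let int_coord k (D : set R) : measurable D ->
  (\int[mu]_(t in D) (qcoord k (bv t) ^+ 2)%:E = \int[mu]_(t in D) (b k t ^+ 2)%:E)%E.
Proof.
move=> mD; apply: ge0_ae_eq_integral => //.
- by apply/measurable_EFinP; apply: measurable_funX; apply: measurable_funS (measurable_boundary_value k).
- by apply/measurable_EFinP; apply: measurable_funX; apply: measurable_funS (mb k).
- by move=> t _; rewrite lee_fin sqr_ge0.
- by move=> t _; rewrite lee_fin sqr_ge0.
apply: negligibleS nC => t /=; apply: contra_not => Ct _.
by rewrite qcoord_bv; case: asboolP.
Qed.

Let int_sum x : (\int[mu]_(t in `[x, (x + 2 * pi)%R]) (`|bv t| ^+ 2)%:E =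
  \sum_k \int[mu]_(t in `[x, (x + 2 * pi)%R]) (b k t ^+ 2)%:E)%E.
Proof.
under eq_integral => t _ do rewrite quat_norm_sum -sumEFin.
rewrite ge0_integral_sum//.
- by apply: eq_bigr => k _; exact: int_coord.
- move=> k; apply/measurable_EFinP; apply: measurable_funX.
  exact: measurable_funS (measurable_boundary_value k).
- by move=> k t _; rewrite lee_fin sqr_ge0.
Qed.

(** Each of the four coordinates is bounded by the full sum [W], whence the factor 4. *)
Lemma boundary_value_sqr_le x :
  (\int[mu]_(t in `[x, (x + 2 * pi)%R]) (`|boundary_value (pext a) i t| ^+ 2)%:E <=
   (4 * (2 * pi * W))%:E)%E.
Proof.
rewrite -/bv int_sum; apply: (@le_trans _ _ (\sum_(k < 4) (2 * pi * W)%:E)%E).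
  by apply: lee_sum => k _; exact: (boundary_sqr_le (bd k) (Wk k) (mb k) (@Hb k)).
by rewrite sumEFin sumr_const card_ord lee_fin -(mulr_natl (2 * pi * W)) lexx.
Qed.

(** No constant is lost here, because the weights of the four coordinates add up to [|a k| ^+ 2]. *)
Lemma boundary_value_sqr_ge x M : ((2 * pi * \sum_(k < M) `|a k| ^+ 2)%:E <=
  \int[mu]_(t in `[x, (x + 2 * pi)%R]) (`|boundary_value (pext a) i t| ^+ 2)%:E)%E.
Proof.
rewrite -/bv int_sum.
have -> : 2 * pi * (\sum_(k < M) `|a k| ^+ 2) = \sum_k (2 * pi * \sum_(m < M) wt (c k) (d k) m).
  rewrite -mulr_sumr exchange_big/=; congr (_ * _); apply: eq_bigr => m _.
  by rewrite -(sum_wt_qcoord a m Si).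
rewrite -sumEFin; apply: lee_sum => k _.
exact: (boundary_sqr_ge (bd k) (Wk k) (mb k) (@Hb k)).
Qed.

End BoundaryValues.

(** * Mean oscillation on an interval *)

Section Oscillation.
Variable R : realType.
Local Notation mu := (@lebesgue_measure R).
Implicit Types (G : R -> quat R) (c : quat R) (a b : R).

Lemma quadratic_moment_le (g : R -> R) a b (c : R) : a < b -> measurable_fun setT g ->
  (\int[mu]_(t in `]a, b[) (g t ^+ 2)%:E < +oo)%E ->
  (\int[mu]_(t in `]a, b[) ((g t - (b - a)^-1 * \int[mu]_(t in `]a, b[) g t) ^+ 2)%:E <=
   \int[mu]_(t in `]a, b[) ((g t - c) ^+ 2)%:E)%E.
Proof.
move=> ab mg g2; pose D : set (measurableTypeR R) := `]a, b[%classic.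
have mD : measurable D := measurable_itv `]a, b[.
have ig2 : mu.-integrable D (EFin \o (fun t => g t ^+ 2)).
  apply/integrableP; split.
    by apply/measurable_EFinP; apply: measurable_funX; exact: measurable_funS mg.
  by under eq_integral => t _ do rewrite /= ger0_norm ?sqr_ge0//.
have ic (k : R) : mu.-integrable D (EFin \o (fun=> k)).
  apply: (@integrableS _ _ _ mu `[a, b]%classic) => //.
    by apply: subset_itv; rewrite bnd_simp.
  by apply: cont_on_integrable; apply: cont_onT => x; exact: cvg_cst.
(* Integrable because [|g| <= g ^+ 2 + 1] on a bounded interval. *)
have ig : mu.-integrable D (EFin \o g).
  apply: (le_integrable mD _ _ (integrableD mD ig2 (ic 1))).
    by apply/measurable_EFinP; exact: measurable_funS mg.
  move=> t _; rewrite lee_fin [leRHS]ger0_norm; last by rewrite addr_ge0// sqr_ge0.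
  by rewrite -(real_normK (num_real (g t))); move: `|g t| => x; nra.
pose P := (\int[mu]_(t in D) g t)%R; pose Q := (\int[mu]_(t in D) (g t ^+ 2))%R.
have l0 : b - a != 0 by rewrite subr_eq0 gt_eqF.
have E k : (\int[mu]_(t in D) ((g t - k) ^+ 2)%:E = (Q - 2 * k * P + k ^+ 2 * (b - a))%:E)%E.
  have Ek t : (g t - k) ^+ 2 = g t ^+ 2 + ((- 2 * k) * g t + k ^+ 2) by ring.
  have igk := integrableZl mD (- 2 * k) ig.
  have igkc := integrableD mD igk (ic (k ^+ 2)).
  have ia := integrableD mD ig2 igkc.
  under eq_integral => t _ do rewrite Ek.
  rewrite -[LHS]fineK; last exact: integrable_fin_num ia.
  congr EFin; rewrite -[LHS]/(\int[mu]_(t in D) (g t ^+ 2 + ((- 2 * k) * g t + k ^+ 2)))%R.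
  rewrite RintegralD// (@RintegralD _ _ _ mu D (fun t => - 2 * k * g t) (fun=> k ^+ 2))//.
  rewrite RintegralZl// Rintegral_cst//= lebesgue_measure_itv/= lte_fin ab /= -/P -/Q.
  by rewrite -/P; ring.
rewrite -/P !E lee_fin -subr_ge0.
set u := (X in 0 <= X).
have -> : u = (b - a) * (c - (b - a)^-1 * P) ^+ 2 by rewrite /u; field.
by rewrite mulr_ge0 ?sqr_ge0// subr_ge0 ltW.
Qed.

Definition measurable_quat G := forall k, measurable_fun setT (fun t => qcoord k (G t)).

Lemma measurable_quat_norm G c : measurable_quat G ->
  measurable_fun setT (fun t => (`|G t - c| ^+ 2)%:E).
Proof.
move=> mG; apply/measurable_EFinP.
under eq_fun do rewrite quat_norm_sum.
apply: measurable_sum => k; apply: measurable_funX.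
under eq_fun do rewrite qcoordB; apply: measurable_funB => //; exact: mG.
Qed.

(** With [osc] below, [mean_value] and [mean_oscillation] for a general function on the line; they
    unfold to the same terms when [G] is a boundary value. *)
Definition interval_mean G a b : quat R := (b - a)^-1 *: quat_integral `]a, b[ G.

Definition osc G a b : \bar R :=
  ((b - a)^-1%:E * \int[mu]_(t in `]a, b[) (`|G t - interval_mean G a b| ^+ 2)%:E)%E.

Lemma qcoord_interval_mean k G a b : qcoord k (interval_mean G a b) =
  (b - a)^-1 * \int[mu]_(t in `]a, b[) qcoord k (G t).
Proof. by rewrite /interval_mean qcoordZ /qcoord /=; case: k => -[|[|[|[|]]]]. Qed.

Lemma integral_quat_norm G c (D : set R) : measurable D -> measurable_quat G ->
  (\int[mu]_(t in D) (`|G t - c| ^+ 2)%:E =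
   \sum_k \int[mu]_(t in D) ((qcoord k (G t) - qcoord k c) ^+ 2)%:E)%E.
Proof.
move=> mD mG; under eq_integral => t _ do rewrite quat_norm_sum -sumEFin.
rewrite ge0_integral_sum//.
- by apply: eq_bigr => k _; apply: eq_integral => t _; rewrite qcoordB.
- move=> k; apply/measurable_EFinP; apply: measurable_funX.
  under eq_fun do rewrite qcoordB; apply: measurable_funB => //.
  exact: measurable_funS (mG k).
- by move=> k t _; rewrite lee_fin sqr_ge0.
Qed.

Lemma osc_le_cst G a b c : a < b -> measurable_quat G ->
  (\int[mu]_(t in `]a, b[) (`|G t| ^+ 2)%:E < +oo)%E ->
  (osc G a b <= (b - a)^-1%:E * \int[mu]_(t in `]a, b[) (`|G t - c| ^+ 2)%:E)%E.
Proof.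
move=> ab mG G2; apply: lee_wpmul2l; first by rewrite lee_fin invr_ge0 subr_ge0 ltW.
rewrite !integral_quat_norm//; apply: lee_sum => k _.
rewrite qcoord_interval_mean; apply: (quadratic_moment_le _ ab (mG k)).
apply: le_lt_trans G2; apply: ge0_le_integral => //.
- by move=> t _; rewrite lee_fin sqr_ge0.
- by apply/measurable_EFinP; apply: measurable_funX; exact: measurable_funS (mG k).
- have := measurable_quat_norm 0 mG; under eq_fun do rewrite subr0; exact: measurable_funS.
- move=> t _; rewrite lee_fin -(real_normK (num_real (qcoord k _))).
  by rewrite lerXn2r ?nnegrE// qcoord_le_norm.
Qed.

Lemma osc_le_dominated G (h : R -> \bar R) a b c : a < b -> measurable_quat G ->
  (\int[mu]_(t in `]a, b[) (`|G t| ^+ 2)%:E < +oo)%E ->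
  measurable_fun setT h -> (forall t, 0 <= h t)%E ->
  mu.-negligible [set t | ~ ((`|G t - c| ^+ 2)%:E <= h t)%E] ->
  (osc G a b <= (b - a)^-1%:E * \int[mu]_(t in `]a, b[) h t)%E.
Proof.
move=> ab mG G2 mh h0 nh; apply: le_trans (osc_le_cst c ab mG G2) _.
apply: lee_wpmul2l; first by rewrite lee_fin invr_ge0 subr_ge0 ltW.
apply: ae_ge0_le_integral => //.
- exact: measurable_funS (measurable_quat_norm c mG).
- exact: measurable_funS mh.
- by apply: negligibleS nh => t /=; apply: contra_not => H _.
Qed.

Lemma integral_reflect (h : R -> \bar R) a b : measurable_fun setT h -> (forall t, 0 <= h t)%E ->
  (\int[mu]_(t in `]a, b[) h (- t)%R = \int[mu]_(t in `](- b)%R, (- a)%R[) h t)%E.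
Proof.
move=> mh h0; rewrite (_ : `]a, b[%classic =
    (-%R : _ -> measurableTypeR R) @^-1` `](- b), (- a)[%classic); last first.
  by rewrite opp_preimage_itvbndbnd/= !opprK.
rewrite -ge0_integral_pushforward//=; last exact: measurable_funS mh.
by apply: eq_measure_integral => //= A mA AS; exact: lebesgue_measureN.
Qed.

End Oscillation.

Section SeriesOperations.
Variable R : realType.
Implicit Types (a b : nat -> quat R) (x c : quat R).

Lemma square_summableD a b : square_summable a -> square_summable b ->
  square_summable (fun k => a k + b k).
Proof.
move=> [W HW] [V HV]; exists (2 * W + 2 * V) => n.
apply: (@le_trans _ _ (2 * (\sum_(k < n) `|a k| ^+ 2) + 2 * (\sum_(k < n) `|b k| ^+ 2))).
  rewrite !mulr_sumr -big_split/=; apply: ler_sum => k _.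
  apply: (@le_trans _ _ ((`|a k| + `|b k|) ^+ 2)).
    by rewrite lerXn2r ?nnegrE ?addr_ge0// ler_normD.
  by move: `|a k| `|b k| => u v; have := sqr_ge0 (u - v); nra.
by apply: lerD; rewrite ler_pM2l.
Qed.

Lemma square_summableMr a c : square_summable a -> square_summable (fun k => a k * c).
Proof.
move=> [W HW]; exists (W * `|c| ^+ 2) => n.
under eq_bigr do rewrite quat_normM exprMn; rewrite -mulr_suml.
by rewrite ler_wpM2r// sqr_ge0.
Qed.

Lemma square_summable_pext_cvg a x : square_summable a -> `|x| < 1 ->
  psum a n x @[n --> \oo] --> pext a x.
Proof.
move=> [W HW] x1; rewrite /pext x1; exact: (psum_cvg (square_summable_bounded HW) x1).
Qed.

Lemma pext_out a x : 1 <= `|x| -> pext a x = 0.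
Proof. by move=> x1; rewrite /pext ltNge x1. Qed.

Lemma pextD a b : square_summable a -> square_summable b ->
  pext (fun k => a k + b k) = pext a + pext b.
Proof.
move=> sa sb; apply/funext => x; have -> : (pext a + pext b) x = pext a x + pext b x by [].
have [x1|x1] := ltP `|x| 1; last by rewrite !pext_out// addr0.
rewrite -(cvg_lim _ (square_summable_pext_cvg (square_summableD sa sb) x1))//.
apply: cvg_lim => //.
have -> : psum (fun k => a k + b k) ^~ x = (fun n => psum a n x + psum b n x).
  by apply/funext => n; rewrite /psum -big_split/=; apply: eq_bigr => k _; rewrite mulrDr.
by apply: cvgD; exact: square_summable_pext_cvg.
Qed.

Lemma pextMr a c : square_summable a ->
  pext (fun k => a k * c) = pointwise_rscale (pext a) c.
Proof.
move=> sa; apply/funext => x; rewrite /pointwise_rscale.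
have [x1|x1] := ltP `|x| 1; last by rewrite !pext_out// mul0r.
rewrite -(cvg_lim _ (square_summable_pext_cvg (square_summableMr c sa) x1))//.
apply: cvg_lim => //.
have -> : psum (fun k => a k * c) ^~ x = (fun n => psum a n x * c).
  by apply/funext => n; rewrite /psum mulr_suml; apply: eq_bigr => k _; rewrite mulrA.
by apply: quat_mulr_cvg; exact: square_summable_pext_cvg.
Qed.

Lemma pext0 : pext (fun=> 0 : quat R) = 0.
Proof.
have s0 : square_summable (fun=> 0 : quat R).
  by exists 0 => n; rewrite big1// => k _; rewrite normr0 expr0n.
have -> : (fun=> 0 : quat R) = (fun k : nat => (fun=> 0 : quat R) k * 0).
  by apply/funext => k; rewrite mulr0.
by rewrite pextMr//; apply/funext => x; rewrite /pointwise_rscale mulr0.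
Qed.

Lemma pext_at0 a : square_summable a -> pext a 0 = a 0%N.
Proof.
move=> sa; have x1 : `|0 : quat R| < 1 by rewrite normr0.
rewrite -(cvg_lim _ (square_summable_pext_cvg sa x1))//; apply: cvg_lim => //.
apply: (@cvg_trans _ ((fun=> a 0%N) @ \oo)); last exact: cvg_cst.
apply: near_eq_cvg; near=> n.
have -> : n = n.-1.+1 by rewrite prednK//; near: n; exact: nbhs_infty_gt.
rewrite /psum big_ord_recl expr0 mul1r big1 ?addr0// => k _.
by rewrite exprS mul0r mul0r.
Unshelve. all: by end_near. Qed.

End SeriesOperations.

(** * Oscillation of the boundary values of Hardy functions *)

Section HardyBoundary.
Variable R : realType.
Local Notation mu := (@lebesgue_measure R).
Implicit Types (f g : quat R -> quat R) (i j c : quat R) (a b K L : R).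

Definition radial_cvg f i (t : R) :=
  f (r *: circle_pt i t) @[r --> 1^'-] --> boundary_value f i t.

Lemma hardyD f g : hardy 2 f -> hardy 2 g -> hardy 2 (f + g).
Proof.
move=> /hardyP[a [sa ->]] /hardyP[b [sb ->]]; apply/hardyP.
by exists (fun k => a k + b k); split; [exact: square_summableD|rewrite pextD].
Qed.

Lemma hardyMr f c : hardy 2 f -> hardy 2 (pointwise_rscale f c).
Proof.
move=> /hardyP[a [sa ->]]; apply/hardyP.
by exists (fun k => a k * c); split; [exact: square_summableMr|rewrite pextMr].
Qed.

Lemma hardy_measurable f i : imag_sphere i -> hardy 2 f -> measurable_quat (boundary_value f i).
Proof. by move=> Si /hardyP[a [[W HW] ->]] k; exact: measurable_boundary_value HW Si k. Qed.

Lemma hardy_cvg_ae f i : imag_sphere i -> hardy 2 f ->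
  mu.-negligible [set t | ~ radial_cvg f i t].
Proof. by move=> Si /hardyP[a [[W HW] ->]]; exact: boundary_value_ae HW Si. Qed.

Lemma pext_boundary_L2 (s : nat -> quat R) W i a b : imag_sphere i ->
  (forall n, \sum_(k < n) `|s k| ^+ 2 <= W) -> b - a <= 2 * pi ->
  (\int[mu]_(t in `]a, b[) (`|boundary_value (pext s) i t| ^+ 2)%:E <= (4 * (2 * pi * W))%:E)%E.
Proof.
move=> Si HW ab; apply: le_trans (boundary_value_sqr_le HW Si a).
apply: ge0_subset_integral => //.
- have := measurable_quat_norm 0 (fun k => measurable_boundary_value HW Si k).
  by under eq_fun do rewrite subr0; exact: measurable_funS.
- apply: subset_itv; rewrite bnd_simp//; lra.
Qed.

Lemma hardy_L2 f i a b : imag_sphere i -> hardy 2 f -> b - a <= 2 * pi ->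
  (\int[mu]_(t in `]a, b[) (`|boundary_value f i t| ^+ 2)%:E < +oo)%E.
Proof.
move=> Si /hardyP[s [[W HW] ->]] ab.
exact: le_lt_trans (pext_boundary_L2 Si HW ab) (ltry _).
Qed.

(** The pointwise inequality [(u + v)^2 <= (1 + e) u^2 + (1 + 1/e) v^2] is integrated. The centre
    [c] is arbitrary, since the mean is the best one. *)
Lemma osc_le_weighted (G G1 G2 : R -> quat R) c c1 c2 a b (e : R) : a < b -> 0 < e ->
  measurable_quat G -> measurable_quat G1 -> measurable_quat G2 ->
  (\int[mu]_(t in `]a, b[) (`|G t| ^+ 2)%:E < +oo)%E ->
  mu.-negligible [set t | ~ `|G t - c| <= `|G1 t - c1| + `|G2 t - c2|] ->
  (osc G a b <=
   (1 + e)%:E * ((b - a)^-1%:E * \int[mu]_(t in `]a, b[) (`|G1 t - c1| ^+ 2)%:E) +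
   (1 + e^-1)%:E * ((b - a)^-1%:E * \int[mu]_(t in `]a, b[) (`|G2 t - c2| ^+ 2)%:E))%E.
Proof.
move=> ab e0 mG mG1 mG2 G2L nG.
have m1 := measurable_quat_norm c1 mG1; have m2 := measurable_quat_norm c2 mG2.
have e1 : 0 <= 1 + e by rewrite addr_ge0// ltW.
have e2 : 0 <= 1 + e^-1 by rewrite addr_ge0// invr_ge0 ltW.
have l0 : 0 <= (b - a)^-1 by rewrite invr_ge0 subr_ge0 ltW.
apply: le_trans (@osc_le_dominated R G (fun t => (1 + e)%:E * (`|G1 t - c1| ^+ 2)%:E +
   (1 + e^-1)%:E * (`|G2 t - c2| ^+ 2)%:E)%E a b c ab mG G2L _ _ _) _.
- by apply: emeasurable_funD; apply: measurable_funeM.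
- by move=> t; rewrite adde_ge0// mule_ge0// lee_fin.
- apply: negligibleS nG => t /=; apply: contra_not => H.
  rewrite lee_fin; apply: (@le_trans _ _ ((`|G1 t - c1| + `|G2 t - c2|) ^+ 2)).
    by rewrite lerXn2r ?nnegrE ?addr_ge0.
  move: `|G1 t - c1| `|G2 t - c2| => u v.
  rewrite -subr_ge0 (_ : _ - _ = (e * u - v) ^+ 2 / e); last by field; rewrite gt_eqF.
  by rewrite divr_ge0 ?sqr_ge0// ltW.
rewrite ge0_integralD//; last 4 first.
- by move=> t _; rewrite mule_ge0// lee_fin.
- by apply: measurable_funeM; exact: measurable_funS m1.
- by move=> t _; rewrite mule_ge0// lee_fin.
- by apply: measurable_funeM; exact: measurable_funS m2.
rewrite !ge0_integralZl//; last 2 first.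
- exact: measurable_funS m2.
- exact: measurable_funS m1.
rewrite ge0_muleDr; last 2 first.
- by rewrite mule_ge0 ?lee_fin//; apply: integral_ge0 => t _; rewrite lee_fin.
- by rewrite mule_ge0 ?lee_fin//; apply: integral_ge0 => t _; rewrite lee_fin.
by rewrite !muleA -!EFinM !(mulrC (b - a)^-1).
Qed.

(** A real bound [K] of the seminorm on one slice; the square removes the root in
    [bmo_seminorm_slice]. *)
Definition osc_bounded f i K := forall a b, a < b -> b - a <= 2 * pi ->
  (osc (boundary_value f i) a b <= (K ^+ 2)%:E)%E.

Lemma osc_ge0 (G : R -> quat R) a b : a < b -> (0 <= osc G a b)%E.
Proof.
move=> ab; apply: mule_ge0; first by rewrite lee_fin invr_ge0 subr_ge0 ltW.
by apply: integral_ge0 => t _; rewrite lee_fin.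
Qed.

Lemma le_sqr_of_weighted (x : \bar R) K L : 0 <= K -> 0 <= L -> (0 <= x)%E ->
  (forall e : R, 0 < e -> (x <= ((1 + e) * K ^+ 2 + (1 + e^-1) * L ^+ 2)%:E)%E) ->
  (x <= ((K + L) ^+ 2)%:E)%E.
Proof.
move=> K0 L0; case: x => [x|//|//]; last by move=> _ /(_ 1 ltr01); rewrite leye_eq.
rewrite !lee_fin => x0 H.
have h : Num.sqrt x <= Num.sqrt (K ^+ 2) + Num.sqrt (L ^+ 2).
  by apply: sqrt_le_of_weighted; rewrite ?sqr_ge0// => e e0; rewrite -lee_fin; exact: H.
move: h; rewrite !sqrtr_sqr !ger0_norm// => h.
by rewrite -[leLHS](sqr_sqrtr x0) lerXn2r ?nnegrE ?addr_ge0 ?sqrtr_ge0.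
Qed.

(** The function [c] builds a centre for [G] from the means of [G1] and [G2]. It is the sum for the
    triangle inequality and the combination of the representation formula for a change of slice. *)
Lemma osc_combine (G G1 G2 : R -> quat R) (c : quat R -> quat R -> quat R) a b K L :
  0 <= K -> 0 <= L -> a < b ->
  measurable_quat G -> measurable_quat G1 -> measurable_quat G2 ->
  (\int[mu]_(t in `]a, b[) (`|G t| ^+ 2)%:E < +oo)%E ->
  (forall c1 c2, mu.-negligible [set t | ~ `|G t - c c1 c2| <= `|G1 t - c1| + `|G2 t - c2|]) ->
  (osc G1 a b <= (K ^+ 2)%:E)%E -> (osc G2 a b <= (L ^+ 2)%:E)%E ->
  (osc G a b <= ((K + L) ^+ 2)%:E)%E.
Proof.
move=> K0 L0 ab mG mG1 mG2 G2L nG o1 o2; apply: le_sqr_of_weighted => //; first exact: osc_ge0.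
move=> e e0; apply: le_trans (osc_le_weighted ab e0 mG mG1 mG2 G2L
  (nG (interval_mean G1 a b) (interval_mean G2 a b))) _.
rewrite (EFinD ((1 + e) * K ^+ 2)) (EFinM (1 + e)) (EFinM (1 + e^-1)).
apply: leeD; apply: lee_wpmul2l; [|exact: o1| |exact: o2].
  by rewrite lee_fin addr_ge0// ltW.
by rewrite lee_fin addr_ge0// invr_ge0 ltW.
Qed.

Lemma boundary_valueD f g i t : radial_cvg f i t -> radial_cvg g i t ->
  boundary_value (f + g) i t = boundary_value f i t + boundary_value g i t.
Proof. by move=> cf cg; apply: cvg_lim => //; exact: cvgD. Qed.

Lemma boundary_valueMr f c i t : radial_cvg f i t ->
  boundary_value (pointwise_rscale f c) i t = boundary_value f i t * c.
Proof. by move=> cf; apply: cvg_lim => //; exact: quat_mulr_cvg. Qed.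

Lemma osc_boundedD f g i K L : imag_sphere i -> hardy 2 f -> hardy 2 g -> 0 <= K -> 0 <= L ->
  osc_bounded f i K -> osc_bounded g i L -> osc_bounded (f + g) i (K + L).
Proof.
move=> Si Hf Hg K0 L0 of_ og a b ab ab2; have Hfg := hardyD Hf Hg.
apply: (osc_combine (c := fun c1 c2 => c1 + c2) K0 L0 ab (hardy_measurable Si Hfg)
  (hardy_measurable Si Hf) (hardy_measurable Si Hg) (hardy_L2 Si Hfg ab2)); last 2 first.
- exact: of_.
- exact: og.
move=> c1 c2; apply: negligibleS (negligibleU (hardy_cvg_ae Si Hf) (hardy_cvg_ae Si Hg)) => t /=.
apply: contra_notP => /not_orP[/contrapT cf /contrapT cg].
by rewrite boundary_valueD// opprD addrACA ler_normD.
Qed.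

Lemma osc_boundedMr f i K c : imag_sphere i -> hardy 2 f ->
  osc_bounded f i K -> osc_bounded (pointwise_rscale f c) i (K * `|c|).
Proof.
move=> Si Hf of_ a b ab ab2; have Hfc := hardyMr c Hf.
have mf := hardy_measurable Si Hf.
set m := interval_mean (boundary_value f i) a b.
have mm := measurable_quat_norm m mf.
have c0 : 0 <= `|c| ^+ 2 by rewrite sqr_ge0.
apply: le_trans (@osc_le_dominated _ _ (fun t => (`|c| ^+ 2)%:E * (`|boundary_value f i t - m| ^+ 2)%:E)%E
  _ _ (m * c) ab (hardy_measurable Si Hfc) (hardy_L2 Si Hfc ab2) _ _ _) _.
- exact: measurable_funeM.
- by move=> t; rewrite mule_ge0// lee_fin.
- apply: negligibleS (hardy_cvg_ae Si Hf) => t /=; apply: contra_not => cf.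
  by rewrite boundary_valueMr// -mulrBl quat_normM exprMn -EFinM mulrC.
rewrite ge0_integralZl//; last exact: measurable_funS mm.
rewrite muleCA (_ : (K * `|c|) ^+ 2 = `|c| ^+ 2 * K ^+ 2); last by rewrite exprMn mulrC.
rewrite (EFinM (`|c| ^+ 2)); apply: lee_wpmul2l; first by rewrite lee_fin.
exact: of_.
Qed.

Lemma boundary_valueN f i t : boundary_value f (- i) t = boundary_value f i (- t).
Proof. by rewrite /boundary_value circle_ptN. Qed.

(** The circle of [- i] is that of [i] traversed backwards; reflection exchanges the intervals
    [(a, b)] and [(- b, - a)]. *)
Lemma osc_boundedN f i K : imag_sphere i -> hardy 2 f ->
  osc_bounded f i K -> osc_bounded f (- i) K.
Proof.
move=> Si Hf of_ a b ab ab2; have SiN := imag_sphereN Si.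
have mf := hardy_measurable Si Hf.
set m := interval_mean (boundary_value f i) (- b) (- a).
have mm := measurable_quat_norm m mf.
apply: le_trans (osc_le_cst m ab (hardy_measurable SiN Hf) (hardy_L2 SiN Hf ab2)) _.
under eq_integral => t _ do rewrite boundary_valueN.
rewrite (integral_reflect (h := fun t => (`|boundary_value f i t - m| ^+ 2)%:E))//.
have -> : b - a = (- a) - (- b) by rewrite opprK addrC.
apply: of_; first by rewrite ltrN2.
by rewrite opprK addrC.
Qed.

Lemma repr_fst_norm i j : imag_sphere i -> imag_sphere j -> `|repr_fst i j| <= 1.
Proof.
move=> [_ i1] [_ j1]; rewrite normrZ ger0_norm//.
rewrite -[leRHS](mulVf (_ : 2 != 0 :> R))// ler_pM2l ?invr_gt0//.
by apply: le_trans (ler_normB _ _) _; rewrite quat_normM i1 j1 quat_norm1; lra.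
Qed.

Lemma repr_snd_norm i j : imag_sphere i -> imag_sphere j -> `|repr_snd i j| <= 1.
Proof.
move=> [_ i1] [_ j1]; rewrite normrZ ger0_norm//.
rewrite -[leRHS](mulVf (_ : 2 != 0 :> R))// ler_pM2l ?invr_gt0//.
by apply: le_trans (ler_normD _ _) _; rewrite quat_normM i1 j1 quat_norm1; lra.
Qed.

Lemma boundary_value_repr f i j t : imag_sphere i -> imag_sphere j -> hardy 2 f ->
  radial_cvg f i t -> radial_cvg f (- i) t ->
  boundary_value f j t =
  repr_fst i j * boundary_value f i t + repr_snd i j * boundary_value f (- i) t.
Proof.
move=> Si Sj /hardyP[a [[W HW] ->]] c1 c2.
have aC := square_summable_bounded HW; apply: cvg_lim => //.
have c12 : repr_fst i j * pext a (r *: circle_pt i t) +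
    repr_snd i j * pext a (r *: circle_pt (- i) t) @[r --> 1^'-] -->
    repr_fst i j * boundary_value (pext a) i t + repr_snd i j * boundary_value (pext a) (- i) t.
  apply: cvgD.
    exact: (quat_mull_cvg (c := repr_fst i j) c1).
  exact: (quat_mull_cvg (c := repr_snd i j) c2).
apply: cvg_trans c12; apply: near_eq_cvg; apply: filterS (near_left1 R) => r /andP[r0 r1].
rewrite /circle_pt !slice_ptZ slice_ptN (pext_repr aC Si Sj)//.
by apply/(slice_pt_norm_lt1 Si); rewrite -slice_ptZ circle_norm.
Qed.

(** The values on the slice of [j] combine those for [i] and [- i], each with a coefficient of norm
    at most 1 and an oscillation bounded by [K]. *)
Lemma osc_bounded_slice f i j K : imag_sphere i -> imag_sphere j -> hardy 2 f -> 0 <= K ->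
  osc_bounded f i K -> osc_bounded f j (K + K).
Proof.
move=> Si Sj Hf K0 of_ a b ab ab2; have SiN := imag_sphereN Si.
apply: (osc_combine (c := fun c1 c2 => repr_fst i j * c1 + repr_snd i j * c2) K0 K0 ab
  (hardy_measurable Sj Hf) (hardy_measurable Si Hf) (hardy_measurable SiN Hf)
  (hardy_L2 Sj Hf ab2)); last 2 first.
- exact: of_.
- exact: (osc_boundedN Si Hf of_).
move=> c1 c2; apply: negligibleS (negligibleU (hardy_cvg_ae Si Hf) (hardy_cvg_ae SiN Hf)) => t /=.
apply: contra_notP => /not_orP[/contrapT ci /contrapT cN].
rewrite (boundary_value_repr Si Sj Hf ci cN) opprD addrACA -!mulrBr.
apply: le_trans (ler_normD _ _) _; rewrite !quat_normM; apply: lerD.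
  by rewrite ler_piMl// repr_fst_norm.
by rewrite ler_piMl// repr_snd_norm.
Qed.

(** Subtracting the mean over [(0, 2 * pi)] changes only the coefficient of index 0, so the lower L2
    bound for the modified series sees all the others. *)
Lemma coef_sum_le_osc (s : nat -> quat R) i K M : imag_sphere i -> square_summable s ->
  osc_bounded (pext s) i K -> \sum_(k < M) `|s k.+1| ^+ 2 <= K ^+ 2.
Proof.
move=> Si ss ob; have p2 := twopi0 R.
have Hf : hardy 2 (pext s) by apply/hardyP; exists s.
set G := boundary_value (pext s) i; set m := interval_mean G 0 (2 * pi).
(* The coefficients of the constant [- m] on the ball. *)
pose d n := if n == 0%N then - m else 0.
have sd : square_summable d.
  exists (`|m| ^+ 2) => -[|n]; first by rewrite big_ord0 sqr_ge0.
  rewrite big_ord_recl big1 ?addr0; first by rewrite /d/= normrN.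
  by move=> k _; rewrite /d /= normr0 expr0n.
have sd' := square_summableD ss sd.
have dE x : `|x| < 1 -> pext d x = - m.
  move=> x1; rewrite -(cvg_lim _ (square_summable_pext_cvg sd x1))//; apply: cvg_lim => //.
  apply: (@cvg_trans _ ((fun=> - m) @ \oo)); last exact: cvg_cst.
  apply: near_eq_cvg; near=> n.
  have -> : n = n.-1.+1 by rewrite prednK//; near: n; exact: nbhs_infty_gt.
  rewrite /psum big_ord_recl expr0 mul1r big1 ?addr0// => k _.
  by rewrite /d /= mulr0.
have bE t : radial_cvg (pext s) i t -> boundary_value (pext (fun k => s k + d k)) i t = G t - m.
  move=> cs; apply: cvg_lim => //.
  have cm : pext s (r *: circle_pt i t) - m @[r --> 1^'-] --> G t - m.
    by apply: cvgB; [exact: cs|exact: cvg_cst].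
  apply: cvg_trans cm; apply: near_eq_cvg; apply: filterS (near_left1 R) => r /andP[r0 r1].
  rewrite pextD// -(dE (r *: circle_pt i t)) ?circle_norm//.
have [W HW] := sd'; pose s' k := s k + d k.
have := @boundary_value_sqr_ge R s' W i HW Si 0 M.+1; rewrite add0r.
have mS := measurable_quat_norm 0 (fun k => @measurable_boundary_value R s' W i HW Si k).
have mG : measurable_quat G := hardy_measurable Si Hf.
rewrite (@integral_itv_bndoo _ 0 (2 * pi)); last first.
  by move: mS; under eq_fun do rewrite subr0; exact: measurable_funS.
rewrite (@ge0_ae_eq_integral _ _ _ mu `]0, (2 * pi)[ _ (fun t => (`|G t - m| ^+ 2)%:E))//; last 3 first.
- by move: mS; under eq_fun do rewrite subr0; exact: measurable_funS.
- exact: measurable_funS (measurable_quat_norm m mG).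
- apply: negligibleS (hardy_cvg_ae Si Hf) => t /=; apply: contra_not => cs _.
  by rewrite bE.
have := ob 0 (2 * pi) p2; rewrite subr0 => /(_ (lexx _)).
rewrite /osc subr0 -/G -/m => h1 h2.
have h3 : ((2 * pi)%:E * ((2 * pi)^-1%:E *
    \int[mu]_(t in `]0%R, (2 * pi)%R[) (`|G t - m| ^+ 2)%:E) <= (2 * pi)%:E * (K ^+ 2)%:E)%E.
  by apply: lee_wpmul2l => //; rewrite lee_fin ltW.
rewrite muleA -EFinM mulfV ?gt_eqF// mul1e in h3.
have := le_trans h2 h3; rewrite -EFinM lee_fin ler_pM2l// => h4.
apply: le_trans h4; rewrite big_ord_recl.
under [X in _ <= _ + X]eq_bigr do rewrite /s' /d /= addr0.
by rewrite lerDr sqr_ge0.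
Unshelve. all: by end_near. Qed.

End HardyBoundary.

(** * The norms *)

Section Seminorms.
Variable R : realType.
Local Notation mu := (@lebesgue_measure R).
Implicit Types (f g : quat R -> quat R) (i j c : quat R) (K L : R).

Lemma bmo_seminorm_slice_leP i f K : 0 <= K ->
  (bmo_seminorm_slice i f <= K%:E)%E <-> osc_bounded f i K.
Proof.
move=> K0; have -> : K%:E = sqrte (K ^+ 2)%:E by rewrite /= sqrtr_sqr ger0_norm.
rewrite /bmo_seminorm_slice lee_sqrt; last by rewrite lee_fin sqr_ge0.
split=> [H a b ab ab2|H].
  apply: le_trans H; apply: ereal_sup_ubound; by exists (a, b).
by apply: ge_ereal_sup => _ [[a b] /= [ab ab2] <-]; exact: H.
Qed.

Lemma bmo_seminorm_leP f K : 0 <= K ->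
  (bmo_seminorm f <= K%:E)%E <-> forall i, imag_sphere i -> osc_bounded f i K.
Proof.
move=> K0; split=> [H i Si|H].
  apply/bmo_seminorm_slice_leP => //; apply: le_trans H; apply: ereal_sup_ubound; by exists i.
by apply: ge_ereal_sup => _ [i Si <-]; apply/bmo_seminorm_slice_leP => //; exact: H.
Qed.

Lemma bmo_seminorm_ge0 f : (0 <= bmo_seminorm f)%E.
Proof.
apply: le_trans (ereal_sup_ubound _); last by exists (e1 R) => //; exact: e1_sphere.
exact: sqrte_ge0.
Qed.

(** One slice controls all of them, so membership can be checked on a single slice. *)
Lemma BMOSH_of_osc_bounded f i K : imag_sphere i -> hardy 2 f -> 0 <= K ->
  osc_bounded f i K -> BMOSH f.
Proof.
move=> Si Hf K0 H; split => //; apply: le_lt_trans (ltry (K + K)).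
by apply/bmo_seminorm_leP => [|j Sj]; [exact: addr_ge0|exact: osc_bounded_slice H].
Qed.

Lemma osc_bounded0 i : osc_bounded (0 : quat R -> quat R) i 0.
Proof.
have bz t : boundary_value (0 : quat R -> quat R) i t = 0 by apply: cvg_lim => //; exact: cvg_cst.
have z : (fun t : R => (`|boundary_value (0 : quat R -> quat R) i t| ^+ 2)%:E) = fun=> 0%:E.
  by apply/funext => t; rewrite bz normr0 expr0n.
move=> a b ab ab2; apply: le_trans (osc_le_cst 0 ab _ _) _.
- by move=> k; under eq_fun do rewrite bz; exact: measurable_cst.
- by rewrite z integral0.
- under eq_integral => t _ do rewrite subr0.
  by rewrite z integral0 mule0 expr0n.
Qed.

Lemma square_summableB (a b : nat -> quat R) : square_summable a -> square_summable b ->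
  square_summable (fun k => a k - b k).
Proof.
move=> sa sb; have -> : (fun k => a k - b k) = (fun k => a k + b k * - 1).
  by apply/funext => k; rewrite mulrN1.
by apply: square_summableD => //; exact: square_summableMr.
Qed.

Lemma pextB (a b : nat -> quat R) : square_summable a -> square_summable b ->
  pext (fun k => a k - b k) = pext a - pext b.
Proof.
move=> sa sb; have -> : (fun k => a k - b k) = (fun k => a k + b k * - 1).
  by apply/funext => k; rewrite mulrN1.
rewrite pextD//; last exact: square_summableMr.
rewrite pextMr//; congr (_ + _); apply/funext => x.
by rewrite /pointwise_rscale mulrN1.
Qed.

Lemma rscaleN1 f : pointwise_rscale f (- 1) = - f.
Proof. by apply/funext => x; rewrite /pointwise_rscale mulrN1. Qed.

Section OscillationNorm.
(** Instantiated with [T] a singleton and with [T] the whole sphere. The seminorm [S] enters only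
    through its sign and through [SP], which says that it is the least common bound for the units of
    [T]. *)
Variables (T : set (quat R)) (i0 : quat R) (S : (quat R -> quat R) -> \bar R).
Hypotheses (TS : T `<=` @imag_sphere R) (Ti0 : T i0) (S0 : forall f, (0 <= S f)%E)
  (SP : forall f K, 0 <= K -> (S f <= K%:E)%E <-> forall i, T i -> osc_bounded f i K).

Let N f := `|f 0| + fine (S f).
Let Si0 : imag_sphere i0 := TS Ti0.

Let fin f : BMOSH f -> S f \is a fin_num.
Proof.
move=> [Hf foo]; have f0 := bmo_seminorm_ge0 f.
have fn : bmo_seminorm f \is a fin_num by rewrite ge0_fin_numE.
rewrite ge0_fin_numE//; apply: le_lt_trans (ltry (fine (bmo_seminorm f))).
apply/SP => [|i Ti]; first exact: fine_ge0.
have : (bmo_seminorm f <= (fine (bmo_seminorm f))%:E)%E by rewrite fineK.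
by move=> /bmo_seminorm_leP; apply; [exact: fine_ge0|exact: TS].
Qed.

Let fineS_ge0 f : 0 <= fine (S f). Proof. exact: fine_ge0. Qed.

Let Sb f : BMOSH f -> forall i, T i -> osc_bounded f i (fine (S f)).
Proof. by move=> Bf; apply/SP => //; rewrite fineK// fin. Qed.

Let S_le f K : 0 <= K -> (forall i, T i -> osc_bounded f i K) -> fine (S f) <= K.
Proof.
move=> K0 /SP-/(_ K0) H; rewrite -lee_fin fineK//.
by rewrite ge0_fin_numE//; apply: le_lt_trans H (ltry _).
Qed.

Let BD f g : BMOSH f -> BMOSH g -> BMOSH (f + g).
Proof.
move=> Bf Bg; have [[Hf _] [Hg _]] := (Bf, Bg).
apply: (BMOSH_of_osc_bounded Si0 (hardyD Hf Hg) (addr_ge0 (fineS_ge0 f) (fineS_ge0 g))).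
by apply: osc_boundedD => //; exact: Sb.
Qed.

Let BM f c : BMOSH f -> BMOSH (pointwise_rscale f c).
Proof.
move=> Bf; have [Hf _] := Bf.
apply: (BMOSH_of_osc_bounded Si0 (hardyMr c Hf) (mulr_ge0 (fineS_ge0 f) (normr_ge0 c))).
by apply: osc_boundedMr => //; exact: Sb.
Qed.

Let BN f : BMOSH f -> BMOSH (- f).
Proof. by move=> Bf; rewrite -rscaleN1; exact: BM. Qed.

Let S_rscale f c : BMOSH f -> fine (S (pointwise_rscale f c)) <= fine (S f) * `|c|.
Proof.
move=> Bf; have [Hf _] := Bf; apply: S_le => [|i Ti]; first exact: mulr_ge0.
by apply: osc_boundedMr => //; [exact: TS|exact: Sb].
Qed.

(** Only one inequality comes from the oscillation bound; the other follows by scaling back with a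
    right inverse of [c]. *)
Lemma osc_normZ f c : BMOSH f -> N (pointwise_rscale f c) = N f * `|c|.
Proof.
move=> Bf; rewrite /N mulrDl; congr (_ + _); first by rewrite /pointwise_rscale quat_normM.
apply/eqP; rewrite eq_le S_rscale//=.
have [->|c0] := eqVneq c 0; first by rewrite normr0 mulr0.
have [y cy] := quat_rinv c0.
have -> : `|c| = `|c| ^+ 2 * `|y|.
  by rewrite expr2 -mulrA -quat_normM cy quat_norm1 mulr1.
have fE : f = pointwise_rscale (pointwise_rscale f c) y.
  by apply/funext => x; rewrite /pointwise_rscale -mulrA cy mulr1.
have cy1 : `|c| * `|y| = 1 by rewrite -quat_normM cy quat_norm1.
have h : fine (S f) <= fine (S (pointwise_rscale f c)) * `|y|.
  by rewrite {1}fE; apply: S_rscale; exact: BM.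
have := ler_wpM2r (normr_ge0 c) h; rewrite -mulrA (mulrC `|y|) cy1 mulr1.
by rewrite expr2 -mulrA cy1 mulr1.
Qed.

Lemma osc_normD f g : BMOSH f -> BMOSH g -> N (f + g) <= N f + N g.
Proof.
move=> Bf Bg; have [[Hf _] [Hg _]] := (Bf, Bg).
rewrite /N addrACA; apply: lerD; first exact: ler_normD.
apply: S_le => [|i Ti]; first exact: addr_ge0.
by apply: osc_boundedD => //; [exact: TS|exact: Sb|exact: Sb].
Qed.

(** One [e ^+ 2] bounds the coefficient of index 0, which is the value at the centre, and one the
    remaining coefficients through the oscillation. *)
Let coef_le (s : nat -> quat R) (e : R) M : square_summable s -> BMOSH (pext s) -> 0 <= e ->
  N (pext s) <= e -> \sum_(k < M) `|s k| ^+ 2 <= 2 * e ^+ 2.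
Proof.
move=> ss Bs ep Ne; have s0 : `|s 0%N| <= e.
  by apply: le_trans Ne; rewrite /N pext_at0// lerDl.
have Se : fine (S (pext s)) <= e by apply: le_trans Ne; rewrite /N lerDr.
case: M => [|M]; first by rewrite big_ord0 mulr_ge0// sqr_ge0.
rewrite big_ord_recl mulr_natl mulr2n; apply: lerD; first by rewrite lerXn2r ?nnegrE.
apply: le_trans (coef_sum_le_osc M Si0 ss (Sb Bs Ti0)) _.
by rewrite lerXn2r ?nnegrE.
Qed.

Lemma osc_norm_eq0 f : BMOSH f -> N f = 0 -> f = 0.
Proof.
move=> Bf Nf; have [/hardyP[a [sa fE]] _] := Bf.
have Bp : BMOSH (pext a) by rewrite -fE.
have Np : N (pext a) <= 0 by rewrite -fE Nf.
have az k : a k = 0.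
  have := coef_le k.+1 sa Bp (lexx 0) Np.
  rewrite expr0n mulr0 big_ord_recr/= => h; apply/eqP; rewrite -normr_eq0 -sqrf_eq0 eq_le sqr_ge0 andbT.
  by apply: le_trans h; rewrite lerDr; apply: sumr_ge0 => l _; exact: sqr_ge0.
rewrite fE -[RHS](pext0 R); congr pext; exact/funext.
Qed.

Section Completeness.
Variable u : nat -> quat R -> quat R.
Hypotheses (Bu : forall n, BMOSH (u n))
  (Cu : forall e : R, 0 < e -> exists n0 : nat, forall m n : nat, (n0 <= m)%N -> (n0 <= n)%N ->
      N (u m - u n) < e).

Let ex_coef n : exists a, square_summable a /\ u n = pext a.
Proof. by have [/hardyP] := Bu n. Qed.

Let al n := sval (cid (ex_coef n)).
Let sal n : square_summable (al n). Proof. exact: (svalP (cid (ex_coef n))).1. Qed.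
Let ual n : u n = pext (al n). Proof. exact: (svalP (cid (ex_coef n))).2. Qed.

Let BB m n : BMOSH (u m - u n). Proof. by apply: BD; [exact: Bu|exact: BN]. Qed.

Let uB m n : u m - u n = pext (fun k => al m k - al n k).
Proof. by rewrite pextB// -!ual. Qed.

Let coef_cauchy (e : R) : 0 < e -> exists n0 : nat, forall m n M, (n0 <= m)%N -> (n0 <= n)%N ->
  \sum_(k < M) `|al m k - al n k| ^+ 2 <= 2 * e ^+ 2 /\
  forall i, T i -> osc_bounded (u m - u n) i e.
Proof.
move=> e0; have [n0 H] := Cu e0; exists n0 => m n M mn nn.
have h := ltW (H m n mn nn); split.
  apply: (@coef_le (fun k => al m k - al n k)); [exact: square_summableB|by rewrite -uB|exact: ltW|].
  by rewrite -uB.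
apply/SP; first exact: ltW.
rewrite -(fineK (fin (BB m n))) lee_fin; apply: le_trans h.
by rewrite /N lerDr.
Qed.

Let al_cvg k : cvg (al n k @[n --> \oo]).
Proof.
apply: cauchy_cvg; apply: cauchy_exP => e e0.
have e2 : 0 < e / 2 by rewrite divr_gt0.
have [n0 H] := coef_cauchy e2; exists (al n0 k).
suff : \forall n \near \oo, ball (al n0 k) e (al n k) by [].
near=> n; rewrite -ball_normE /=.
have nn : (n0 <= n)%N by near: n; exact: nbhs_infty_ge.
have [h _] := H n0 n k.+1 (leqnn _) nn.
have : `|al n0 k - al n k| ^+ 2 <= 2 * (e / 2) ^+ 2.
  apply: le_trans h; rewrite big_ord_recr/= lerDr.
  by apply: sumr_ge0 => l lP; exact: sqr_ge0.
move=> h2; rewrite -(@ltr_pXn2r _ 2)// ?nnegrE ?normr_ge0 ?(ltW e0)//.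
by apply: le_lt_trans h2 _; rewrite expr_div_n; have := exprn_gt0 2 e0; lra.
Unshelve. all: by end_near. Qed.

Let be k := lim (al n k @[n --> \oo]).

(** The first estimate involves finitely many coefficients and passes to the limit in [n]; the
    second is kept for differences [u m - u n], and its limit is the object of [osc_lim]. *)
Let coef_lim (e : R) : 0 < e -> exists n0 : nat, forall m, (n0 <= m)%N ->
  (forall M, \sum_(k < M) `|al m k - be k| ^+ 2 <= 2 * e ^+ 2) /\
  forall n, (n0 <= n)%N -> forall i, T i -> osc_bounded (u m - u n) i e.
Proof.
move=> e0; have [n0 H] := coef_cauchy e0; exists n0 => m mn; split => [M|n nn i Ti]; last first.
  exact: (H m n 0%N mn nn).2.
have cv : \sum_(k < M) `|al m k - al n k| ^+ 2 @[n --> \oo] --> \sum_(k < M) `|al m k - be k| ^+ 2.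
  apply: cvg_sumr => k; apply: cvgM; apply: cvg_norm; apply: cvgB; try exact: cvg_cst;
  exact: al_cvg.
rewrite -(cvg_lim _ cv)//; apply: limr_le; first by apply/cvg_ex; eexists; exact: cv.
near=> n; apply: (H m n M mn _).1; near: n; exact: nbhs_infty_ge.
Unshelve. all: by end_near. Qed.

Let sbe : square_summable be.
Proof.
have [n0 H] := coef_lim ltr01; have [h _] := H n0 (leqnn _).
have sd : square_summable (fun k => al n0 k - be k) by exists (2 * 1 ^+ 2).
have -> : be = (fun k => al n0 k - (al n0 k - be k)).
  by apply/funext => k; rewrite opprB addrC subrK.
exact: square_summableB.
Qed.

Let f := pext be.
Let Hf : hardy 2 f. Proof. by apply/hardyP; exists be. Qed.

Let ufE m : u m - f = pext (fun k => al m k - be k).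
Proof. by rewrite pextB// -ual. Qed.

Let Huf m : hardy 2 (u m - f).
Proof. by apply/hardyP; exists (fun k => al m k - be k); split; [exact: square_summableB|]. Qed.

(** The interval is fixed and [u m - f] split at an index [n]. How large [n] must be depends on the
    length of the interval, but the bound [e] does not. *)
Let osc_lim (e : R) m0 m i : 0 < e -> T i ->
  (forall n, (m0 <= n)%N -> osc_bounded (u m - u n) i e) -> osc_bounded (u m - f) i e.
Proof.
move=> e0 Ti H a b ab ab2; have Si := TS Ti.
(* A second term of size [0]: the part [u n - f] is made small only after the weight [eta] has been
   fixed. *)
rewrite -[e]addr0; apply: le_sqr_of_weighted => //; [exact: ltW|exact: osc_ge0|move=> eta eta0].
rewrite expr0n mulr0 addr0; apply/lee_addgt0Pr => del del0.
(* The factor of [ep ^+ 2] in the second term: [16 * pi] is [4 * (2 * pi * 2)], the upper L2 bound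
   for coefficients of square sum at most [2 * ep ^+ 2]. *)
pose C := (1 + eta^-1) * ((b - a)^-1 * (16 * pi)).
have C0 : 0 < C.
  have h1 : 0 < eta^-1 by rewrite invr_gt0.
  have h2 : 0 < (b - a)^-1 by rewrite invr_gt0 subr_gt0.
  have h3 : 0 < 16 * pi :> R by rewrite mulr_gt0// pi_gt0.
  by apply: mulr_gt0; [exact: addr_gt0|exact: mulr_gt0].
(* The bound by [1] allows [ep ^+ 2] to be replaced by [ep]. *)
pose ep := Num.min 1 (del / C).
have ep0 : 0 < ep by rewrite lt_min ltr01 divr_gt0.
have epC : C * ep ^+ 2 <= del.
  have h1 : ep <= 1 by rewrite ge_min lexx.
  have h2 : ep <= del / C by rewrite ge_min lexx orbT.
  rewrite mulrC -ler_pdivlMr//; apply: le_trans h2; rewrite expr2.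
  by rewrite ler_piMl// ltW.
have [n0 Hn] := coef_lim ep0.
pose n := maxn m0 n0; have [hn _] := Hn n (leq_maxr _ _).
have ob := H n (leq_maxl _ _) a b ab ab2.
have Hmn : hardy 2 (u m - u n) by have [] := BB m n.
have mG1 := hardy_measurable Si Hmn; have mG2 := hardy_measurable Si (Huf n).
set c1 := interval_mean (boundary_value (u m - u n) i) a b.
have nG : mu.-negligible [set t | ~ `|boundary_value (u m - f) i t - c1| <=
   `|boundary_value (u m - u n) i t - c1| + `|boundary_value (u n - f) i t - 0|].
  apply: negligibleS (negligibleU (hardy_cvg_ae Si Hmn) (hardy_cvg_ae Si (Huf n))) => t /=.
  apply: contra_notP => /not_orP[/contrapT r1 /contrapT r2].
  have -> : u m - f = (u m - u n) + (u n - f) by rewrite addrA subrK.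
  by rewrite boundary_valueD// subr0 addrAC ler_normD.
apply: le_trans (osc_le_weighted ab eta0 (hardy_measurable Si (Huf m)) mG1 mG2
  (hardy_L2 Si (Huf m) ab2) nG) _.
rewrite (EFinM (1 + eta)); apply: leeD.
  by apply: lee_wpmul2l; [rewrite lee_fin addr_ge0// ltW|exact: ob].
apply: (@le_trans _ _ (C * ep ^+ 2)%:E); last by rewrite lee_fin.
have -> : C * ep ^+ 2 = (1 + eta^-1) * ((b - a)^-1 * (4 * (2 * pi * (2 * ep ^+ 2)))).
  by rewrite /C; move: pi (eta^-1) (b - a)^-1 => p x y; ring.
rewrite (EFinM (1 + eta^-1)) (EFinM (b - a)^-1).
apply: lee_wpmul2l; first by rewrite lee_fin addr_ge0// invr_ge0 ltW.
apply: lee_wpmul2l; first by rewrite lee_fin invr_ge0 subr_ge0 ltW.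
under eq_integral => t _ do rewrite subr0.
by rewrite ufE; exact: pext_boundary_L2.
Qed.

Lemma osc_norm_complete : exists2 f, BMOSH f & N (u n - f) @[n --> \oo] --> 0.
Proof.
have step (e : R) : 0 < e -> exists n0 : nat, forall m, (n0 <= m)%N ->
    `|al m 0%N - be 0%N| <= 2 * e /\ forall i, T i -> osc_bounded (u m - f) i e.
  move=> e0; have [n0 H] := coef_lim e0; exists n0 => m mn; have [h1 h2] := H m mn; split.
    have := h1 1%N; rewrite big_ord_recl big_ord0 addr0 => h.
    rewrite -(@ler_pXn2r _ 2)// ?nnegrE ?mulr_ge0 ?(ltW e0)//.
    by apply: le_trans h _; rewrite exprMn; have := sqr_ge0 e; lra.
  by move=> i Ti; apply: (@osc_lim e n0) => // n nn; exact: h2.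
exists f.
  have [n0 H] := step 1 ltr01; have [_ h] := H n0 (leqnn _).
  (* The limit is a difference of two Hardy functions of bounded oscillation on the slice of
     [i0]. *)
  have -> : f = u n0 + pointwise_rscale (u n0 - f) (- 1).
    by rewrite rscaleN1 opprB addrC subrK.
  have Hr := hardyMr (- 1) (Huf n0); have [Hun _] := Bu n0.
  have pos : 0 <= fine (S (u n0)) + 1 * `|- 1 : quat R| by rewrite addr_ge0// mulr_ge0.
  have ob1 : osc_bounded (pointwise_rscale (u n0 - f) (- 1)) i0 (1 * `|- 1 : quat R|).
    by apply: (osc_boundedMr _ Si0 (Huf n0)); exact: h.
  apply: (BMOSH_of_osc_bounded Si0 (hardyD Hun Hr) pos).
  apply: (osc_boundedD Si0 Hun Hr (fineS_ge0 _) _ _ ob1); first exact: mulr_ge0.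
  exact: (Sb (Bu n0) Ti0).
(* The value at the centre costs [2 * (e / 3)] and the seminorm [e / 3]. *)
apply/cvgrPdist_le => e e0; have e3 : 0 < e / 3 by rewrite divr_gt0.
have [n0 H] := step _ e3; near=> n.
have nn : (n0 <= n)%N by near: n; exact: nbhs_infty_ge.
have [h1 h2] := H n nn.
rewrite sub0r normrN ger0_norm ?addr_ge0//.
have hS : fine (S (u n - f)) <= e / 3 by apply: S_le => //; exact: ltW.
have h0 : `|(u n - f) 0| <= 2 * (e / 3).
  rewrite ufE pext_at0//; exact: square_summableB.
by apply: le_trans (lerD h0 hS) _; lra.
Unshelve. all: by end_near. Qed.

End Completeness.

Lemma osc_norm_banach : quaternionic_right_banach (@pointwise_rscale R (quat R)) (@BMOSH R) N.
Proof.
split.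
- have H0 : hardy 2 (0 : quat R -> quat R).
    apply/hardyP; exists (fun=> 0); split; last by rewrite pext0.
    by exists 0 => n; rewrite big1// => k _; rewrite normr0 expr0n.
  exact: (BMOSH_of_osc_bounded Si0 H0 (lexx 0) (@osc_bounded0 i0)).
- exact: BD.
- exact: BN.
- exact: BM.
- by move=> f a b _; apply/funext => x; rewrite /pointwise_rscale mulrA.
- by move=> f _; apply/funext => x; rewrite /pointwise_rscale mulr1.
- by move=> f g a _ _; apply/funext => x; rewrite /pointwise_rscale mulrDl.
- by move=> f a b _; apply/funext => x; rewrite /pointwise_rscale mulrDr.
- by move=> f _; apply: addr_ge0.
- exact: osc_norm_eq0.
- exact: osc_normD.
- exact: osc_normZ.
- exact: osc_norm_complete.
Qed.

End OscillationNorm.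

(** A single unit of [T1] bounds the oscillation on every slice up to the factor 2. Keeping both
    sets general serves the comparisons of one slice with the sphere, of the sphere with one slice,
    and of two slices. *)
Lemma osc_norm_le (T1 T2 : set (quat R)) (S1 S2 : (quat R -> quat R) -> \bar R) i1 :
  T1 i1 -> T1 `<=` @imag_sphere R -> T2 `<=` @imag_sphere R ->
  (forall f, (0 <= S1 f)%E) -> (forall f, (0 <= S2 f)%E) ->
  (forall f, BMOSH f -> S1 f \is a fin_num) ->
  (forall f, BMOSH f -> S2 f \is a fin_num) ->
  (forall f K, 0 <= K -> (S1 f <= K%:E)%E <-> forall i, T1 i -> osc_bounded f i K) ->
  (forall f K, 0 <= K -> (S2 f <= K%:E)%E <-> forall i, T2 i -> osc_bounded f i K) ->
  forall f, BMOSH f -> `|f 0| + fine (S2 f) <= 2 * (`|f 0| + fine (S1 f)).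
Proof.
move=> Ti TS1 TS2 p1 p2 fin1 fin2 P1 P2 f Bf; have [Hf _] := Bf.
have K0 : 0 <= fine (S1 f) by exact: fine_ge0.
have ob : osc_bounded f i1 (fine (S1 f)).
  by apply: (P1 _ _ K0).1 => //; rewrite fineK// fin1.
have h : fine (S2 f) <= fine (S1 f) + fine (S1 f).
  rewrite -lee_fin fineK ?fin2//; apply/P2 => [|j Tj]; first exact: addr_ge0.
  by apply: (osc_bounded_slice _ _ Hf K0 ob); [exact: TS1|exact: TS2].
have := normr_ge0 (f 0); lra.
Qed.

End Seminorms.

Theorem lemma4p4 (R : realType) :
  [/\ forall i : quat R, imag_sphere i ->
        quaternionic_right_banach (@pointwise_rscale R (quat R))
          (@BMOSH R) (bmo_norm_slice i),
      quaternionic_right_banach (@pointwise_rscale R (quat R))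
        (@BMOSH R) (@bmo_norm R),
      forall i : quat R, imag_sphere i ->
        equivalent_norms (@BMOSH R) (bmo_norm_slice i) (@bmo_norm R) &
      forall i j : quat R, imag_sphere i -> imag_sphere j ->
        equivalent_norms (@BMOSH R) (bmo_norm_slice i) (bmo_norm_slice j)].
Proof.
have sliceP (i : quat R) f K : 0 <= K ->
    (bmo_seminorm_slice i f <= K%:E)%E <-> forall j, [set i] j -> osc_bounded f j K.
  move=> K0; split=> [/(bmo_seminorm_slice_leP i f K0) H j ->|H]; first exact: H.
  by apply/(bmo_seminorm_slice_leP i f K0); exact: H.
have sub (i : quat R) : imag_sphere i -> [set i] `<=` @imag_sphere R by move=> Si j ->.
have pos (i : quat R) f : (0 <= bmo_seminorm_slice i f)%E by exact: sqrte_ge0.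
have equiv (N1 N2 : (quat R -> quat R) -> R) :
    (forall f, BMOSH f -> N2 f <= 2 * N1 f) -> (forall f, BMOSH f -> N1 f <= 2 * N2 f) ->
    equivalent_norms (@BMOSH R) N1 N2.
  move=> H1 H2; exists 2^-1, 2; split => // f Bf.
  by have := H1 f Bf; have := H2 f Bf; lra.
have fins i : imag_sphere i -> forall f : quat R -> quat R, BMOSH f ->
    bmo_seminorm_slice i f \is a fin_num.
  by move=> Si f; exact: bmo_seminorm_slice_fin_num.
have finb := @bmo_seminorm_fin_num R; have posb := @bmo_seminorm_ge0 R.
have bP := @bmo_seminorm_leP R.
split.
- by move=> i Si; apply: (osc_norm_banach (sub i Si) (erefl : [set i] i) (pos i) (sliceP i)).
- exact: (osc_norm_banach (fun _ => id) (e1_sphere R) posb bP).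
- move=> i Si; apply: equiv.
    exact: (osc_norm_le (erefl : [set i] i) (sub i Si) (fun _ => id) (pos i) posb (fins i Si) finb (sliceP i) bP).
  exact: (osc_norm_le Si (fun _ => id) (sub i Si) posb (pos i) finb (fins i Si) bP (sliceP i)).
- move=> i j Si Sj; apply: equiv.
    exact: (osc_norm_le (erefl : [set i] i) (sub i Si) (sub j Sj) (pos i) (pos j)
      (fins i Si) (fins j Sj) (sliceP i) (sliceP j)).
  exact: (osc_norm_le (erefl : [set j] j) (sub j Sj) (sub i Si) (pos j) (pos i)
    (fins j Sj) (fins i Si) (sliceP j) (sliceP i)).
Qed.
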